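(* Let $d\ge1$, let $\mu$ be a probability measure on $\mathbb{R}^d$ and let $p>0$. Assume one of the three following conditions: (1) there exist $\alpha>p$ and $\gamma>0$ such that $\mathcal{E}_{\alpha,\gamma}(\mu)<\infty$; (2) there exist $\alpha\in(0,p)$ and $\gamma>0$ such that $\mathcal{E}_{\alpha,\gamma}(\mu)<\infty$; (3) there exists $q>2p$ such that $M_q(\mu)<\infty$. Then for all $N\geq 1$ and all $x\in (0,\infty)$, $$ \mathbb{P}(\mathcal{T}_p(\mu_N,\mu)\geq x) \leq a(N,x)\mathbf{1}_{\{x\leq 1\}}+b(N,x), $$ where $$ a(N,x)=C \left\{\begin{array}{ll} \exp(-cNx^2) & \text{if } p>d/2, \\ \exp(-cN(x/\log(2+1/x))^2) & \text{if } p=d/2, \\ \exp(-cN x^{d/p}) & \text{if } p\in(0,d/2)\end{array}\right. $$ and $$ b(N,x)=C\left\{\begin{array}{ll} \exp(-cNx^{\alpha/p})\mathbf{1}_{\{x> 1\}} & \text{under (1)}, \\ \exp(-c(Nx)^{(\alpha-\varepsilon)/p})\mathbf{1}_{\{x\leq 1\}}+\exp(-c (Nx)^{\alpha/p})\mathbf{1}_{\{x>1\}} & \text{for any } \varepsilon\in(0,\alpha), \text{ under (2)},\\ N (Nx)^{-(q-\varepsilon)/p}& \text{for any } \varepsilon\in(0,q), \text{ under (3)}.\end{array}\right. $$ The positive constants $C$ and $c$ depend only on $p,d$ and either on $\alpha,\gamma,\mathcal{E}_{\alpha,\gamma}(\mu)$ (under (1)), or on $\alpha,\gamma,\mathcal{E}_{\alpha,\gamma}(\mu),\varepsilon$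 (under (2)), or on $q,M_q(\mu),\varepsilon$ (under (3)).
   Context: $(X_k)_{k\ge1}$ is an i.i.d. sequence of $\mathbb{R}^d$-valued random variables with law $\mu$, and $\mu_N:=\frac1N\sum_{k=1}^N\delta_{X_k}$. With $|\cdot|$ the Euclidean norm, for $q,\alpha,\gamma>0$, $$M_q(\mu):=\int_{\mathbb{R}^d}|x|^q\,\mu(dx),\qquad \mathcal{E}_{\alpha,\gamma}(\mu):=\int_{\mathbb{R}^d}e^{\gamma|x|^\alpha}\,\mu(dx).$$ For $p>0$ and probability measures $\mu,\nu$ on $\mathbb{R}^d$, $$\mathcal{T}_p(\mu,\nu)=\inf\left\{\int_{\mathbb{R}^d\times\mathbb{R}^d}|x-y|^p\,\xi(dx,dy)\;:\;\xi\in\mathcal{H}(\mu,\nu)\right\},$$ where $\mathcal{H}(\mu,\nu)$ is the set of all probability measures on $\mathbb{R}^d\times\mathbb{R}^d$ with marginals $\mu$ and $\nu$ (no $p$-th root is taken). *)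

(* Defs.v *)
From HB Require Import structures.
From mathcomp Require Import all_boot all_order all_algebra finmap.
From mathcomp Require Import all_classical all_reals all_analysis.

Set Implicit Arguments.
Unset Strict Implicit.
Unset Printing Implicit Defensive.

Import Order.TTheory GRing.Theory Num.Theory.
Import numFieldNormedType.Exports.

Local Open Scope classical_set_scope.
Local Open Scope ring_scope.

(* R^d is [d.-tuple R]: the library equips it with the sigma-algebra generated
   by the coordinates, which is the Borel sigma-algebra of R^d. *)

Section euclidean_space.
Context (R : realType) (d : nat).
Implicit Types (x y : d.-tuple R) (mu : probability (d.-tuple R) R).

Definition eucl_norm x : R := Num.sqrt (\sum_(i < d) tnth x i ^+ 2).

Definition eucl_dist x y : R := Num.sqrt (\sum_(i < d) (tnth x i - tnth y i) ^+ 2).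

Definition moment (q : R) mu : \bar R :=
  (\int[mu]_x (eucl_norm x `^ q)%:E)%E.

Definition exp_moment (alpha gamma : R) mu : \bar R :=
  (\int[mu]_x (expR (gamma * eucl_norm x `^ alpha))%:E)%E.

(* The marginals are allowed to be arbitrary measures only because [empirical]
   is not packaged as a probability; there is no coupling unless both have
   total mass 1. *)
Definition coupling (mu nu : {measure set (d.-tuple R) -> \bar R}) :
    set (probability (d.-tuple R * d.-tuple R)%type R) :=
  [set xi : probability (d.-tuple R * d.-tuple R)%type R |
    forall A : set (d.-tuple R), measurable A ->
     xi (A `*` setT) = mu A /\ xi (setT `*` A) = nu A].

(* No p-th root is taken. *)
Definition transport_cost (p : R)
    (mu nu : {measure set (d.-tuple R) -> \bar R}) : \bar R :=
  ereal_inf [set (\int[xi]_z (eucl_dist z.1 z.2 `^ p)%:E)%E |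
     xi in coupling mu nu].

(* For N = 0 this is the zero measure. *)
Definition empirical (N : nat) (x : nat -> d.-tuple R) :
    {measure set (d.-tuple R) -> \bar R} :=
  mscale (N%:R^-1)%:nng (msum (fun k => \d_(x k)) N).

End euclidean_space.

Section iid.
Context (R : realType) (disp disp' : measure_display).
Context (Omega : measurableType disp) (T : measurableType disp').
Variable P : probability Omega R.

Definition mutually_independent (X : nat -> {RV P >-> T}) : Prop :=
  forall (J : {fset nat}) (A : nat -> set T),
    (forall k, k \in J -> measurable (A k)) ->
    P (\bigcap_(k in [set` J]) (X k @^-1` A k)) =
    (\prod_(k <- J) P (X k @^-1` A k))%E.

Definition iid (mu : probability T R) (X : nat -> {RV P >-> T}) : Prop :=
  mutually_independent X /\
  forall k (A : set T), measurable A -> distribution P (X k) A = mu A.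

End iid.

Section bounds.
Context (R : realType).
Implicit Types (C c p x alpha q eps : R) (d N : nat).

Definition bound_a d p C c N x : R :=
  C * (if d%:R / 2 < p then expR (- c * N%:R * x ^+ 2)
       else if p == d%:R / 2 then
         expR (- c * N%:R * (x / ln (2 + x^-1)) ^+ 2)
       else expR (- c * N%:R * x `^ (d%:R / p))).

Definition bound_b1 p alpha C c N x : R :=
  C * (expR (- c * N%:R * x `^ (alpha / p)) * (1 < x)%R%:R).

Definition bound_b2 p alpha eps C c N x : R :=
  C * (expR (- c * (N%:R * x) `^ ((alpha - eps) / p)) * (x <= 1)%R%:R +
       expR (- c * (N%:R * x) `^ (alpha / p)) * (1 < x)%R%:R).

Definition bound_b3 p q eps C N x : R :=
  C * (N%:R * (N%:R * x) `^ (- (q - eps) / p)).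

(* The sample X_1, X_2, ... is indexed from 0.  The event is measurable whenever
   mu has a finite p-th moment: the cost is then an infimum of continuous
   functions of the sample points, hence upper semicontinuous. *)
Definition deviation_bound d p (mu : probability (d.-tuple R) R)
    (a b : nat -> R -> R) : Prop :=
  forall (disp : measure_display) (Omega : measurableType disp)
      (P : probability Omega R) (X : nat -> {RV P >-> d.-tuple R}),
    iid mu X ->
  forall N x, (1 <= N)%N -> 0 < x ->
    (P [set w | x%:E <= transport_cost p (empirical N (fun k => X k w)) mu] <=
     (a N x * (x <= 1)%R%:R + b N x)%:E)%E.

End bounds.

(* Main.v *)
Require Import Defs.
From HB Require Import structures.
From mathcomp Require Import all_boot all_order all_algebra finmap.
From mathcomp Require Import all_classical all_reals all_analysis.
From mathcomp Require Import measurable_realfun ring lra zify.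

(* R^d is cut into the annuli 2^(n-1) < |z| <= 2^n, and each of these into nested
   cells of diameter of order 2^(n-l), l = 0, 1, 2, ...  Matching mu_N with mu
   greedily, from the finest cells upwards, leaves over in each cell only the
   difference of the two masses, so T_p(mu_N, mu) is at most a constant times

     sum_n 2^(pn) (2^(-p L_n) mu(annulus n) + sum_(l <= L_n) 2^(-pl) Delta_(n,l)) + tails,

   where Delta_(n,l) is the sum of |mu_N(G) - mu(G)| over the cells G of level l
   of annulus n, and the tails are the p-th moments of mu_N and mu outside of a
   ball.  A Chernoff bound for each choice of the signs of mu_N(G) - mu(G) shows
   that Delta_(n,l) exceeds t with probability at most 2^(number of cells)
   exp(-N t^2 / (8 mu(annulus n))); thresholds t growing geometrically in l give
   the term a(N, x), and a moment of order q > 2p makes the sum over n converge.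

   There remains the upper deviation of the mean of |X_k|^p over the k with
   |X_k| > r, for which Bernstein's inequality is applied to the variables
   truncated at |X_k|^p <= N x in case (2) and at |X_k|^p <= (N x)^(1 - eps/q) in
   case (3).  In case (1) no truncation is needed, and for large x the convexity
   of t^(alpha/p) reduces the deviation to one of the mean of |X_k|^alpha. *)

Set Implicit Arguments.
Unset Strict Implicit.
Unset Printing Implicit Defensive.

Import Order.TTheory GRing.Theory Num.Theory.
Import numFieldNormedType.Exports.

Local Open Scope classical_set_scope.
Local Open Scope ring_scope.

(** * Couplings of an empirical measure *)

(** The cost in annulus [n] carries the weight 2^(pn), while the mass of the annulus, hence the
    variance in the Chernoff bound, is only known to be at most of order 2^(-qn). The surplus q - 2p
    > 0 is shared: one half makes the costs allotted to the annuli summable, the other half makes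
    the exponents of the deviation probabilities grow geometrically in [n], so that the union bound
    over annuli and levels costs only a constant. Inside one annulus the natural threshold at level
    [l] grows like 2^(dl/2), the square root of the number of cells, against the weight 2^(-pl);
    whether 2^(d/2 - p) is below, equal to or above 1 separates the three forms of a(N, x).

    The constants see mu only through the value of a moment, so they are chosen before mu, the
    sample and N. Monotonicity of P is used for measurable sets only: the deviation event is first
    shown to be measurable, by upper semicontinuity of the cost in the sample points, and the
    discrepancy events are replaced by measurable events containing them. *)

Section splitting.
Context (R : realType) (d : nat).
Local Notation T := (d.-tuple R).
Implicit Types (nu : {measure set T -> \bar R}) (y z : T).

Lemma measurable_sqrt : measurable_fun [set: R] (@Num.sqrt R).
Proof. by apply: continuous_measurable_fun; exact: sqrt_continuous. Qed.

Lemma measurable_eucl_dist :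
  measurable_fun setT (fun z : T * T => eucl_dist z.1 z.2).
Proof.
apply: (measurableT_comp measurable_sqrt); apply: measurable_sum => i.
by apply/measurable_funX/measurable_funB;
  apply: (measurableT_comp (measurable_tnth i)).
Qed.

Lemma measurable_eucl_norm : measurable_fun setT (@eucl_norm R d).
Proof.
apply: (measurableT_comp measurable_sqrt); apply: measurable_sum => i.
by apply: measurable_funX; exact: measurable_tnth.
Qed.

Lemma measurable_dist_powR p :
  measurable_fun setT (fun z : T * T => (eucl_dist z.1 z.2 `^ p)%:E).
Proof.
apply/measurable_EFinP.
by apply: (measurableT_comp (measurable_powR p)); exact: measurable_eucl_dist.
Qed.

Lemma measurable_distr_powR p y :
  measurable_fun setT (fun z : T => (eucl_dist y z `^ p)%:E).
Proof.
exact: (measurableT_comp (measurable_dist_powR p) (pair1_measurable y)).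
Qed.

(** The product of the point mass at [y] with [nu], written as an image measure so that integrals
    against it reduce to integrals against [nu]. *)
Definition paired nu y : {measure set (T * T)%type -> \bar R} :=
  measure_function_pushforward__canonical__measure_function_Measure nu
    (@pair1_measurable _ _ T T y).

Lemma empiricalE N (x : nat -> T) A :
  empirical N x A = (N%:R^-1%:E * \sum_(k < N) \d_(x k) A)%E.
Proof. by []. Qed.

(* If [\sum_k nu k = mu] with all [nu k] of mass [1/N], then sending the atom at
   [y k] to [nu k] is a coupling. *)
Lemma transport_cost_le_split p N (y : nat -> T)
    (nu : nat -> {measure set T -> \bar R}) (mu : probability T R) :
  (0 < N)%N ->
  (forall k, (k < N)%N -> nu k setT = N%:R^-1%:E) ->
  (forall A, measurable A -> (\sum_(k < N) nu k A = mu A)%E) ->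
  (transport_cost p (empirical N y) mu <=
   \sum_(k < N) \int[nu k]_z (eucl_dist (y k) z `^ p)%:E)%E.
Proof.
move=> N0 nuT numu.
pose xi0 := [the {measure set (T * T)%type -> \bar R} of
   msum (fun k => paired (nu k) (y k)) N].
have xiE A : xi0 A = (\sum_(k < N) nu k (pair (y k) @^-1` A))%E by [].
have xiT : xi0 setT = 1%E.
  by rewrite xiE; under eq_bigr do rewrite preimage_setT; rewrite numu// probability_setT.
pose xi : probability (T * T)%type R :=
  HB.pack (xi0 : set _ -> _) xi0 (Measure_isProbability.Build _ _ _ (xi0 : set _ -> _) xiT).
apply: ge_ereal_inf; exists (\int[xi]_z (eucl_dist z.1 z.2 `^ p)%:E)%E; last first.
  rewrite /= (@ge0_integral_measure_sum _ _ _ _ setT)//; last 2 first.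
    by move=> z _; rewrite lee_fin powR_ge0.
    exact: measurable_dist_powR.
  apply: lee_sum => k _; rewrite [X in (X <= _)%E]ge0_integral_pushforward//.
    exact: measurable_dist_powR.
  by move=> z _; rewrite lee_fin powR_ge0.
exists xi => // A mA; split.
- rewrite [LHS]xiE empiricalE ge0_sume_distrr//.
  apply: eq_bigr => k _; rewrite diracE.
  have [yA|yA] := boolP (y k \in A).
    rewrite (_ : _ @^-1` _ = setT) ?nuT ?mule1//.
    by apply/seteqP; split => z //= _; split => //; rewrite inE in yA.
  rewrite (_ : _ @^-1` _ = set0) ?measure0 ?mule0//.
  by apply/seteqP; split => z //= -[] /mem_set; rewrite (negbTE yA).
- rewrite [LHS]xiE; apply: etrans (numu _ mA); apply: eq_bigr => k _; congr (nu k _).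
  by apply/seteqP; split => z /=; [case|move=> ?; split].
Qed.

End splitting.

(** * Splitting a coupling along the sample points *)

Section semicontinuity.
Context (R : realType) (d : nat).
Local Notation T := (d.-tuple R).

(** Sample points may coincide. Dividing what sits over a point by its multiplicity trades sums over
    sample indices for sums over distinct points. *)
Lemma sum_inv_count (I : eqType) (s : seq I) (F : I -> \bar R) :
  (\sum_(i <- s) ((count_mem i s)%:R^-1%:E * F i) = \sum_(i <- undup s) F i)%E.
Proof.
rewrite -big_undup_iterop_count; apply: eq_big_seq => i; rewrite mem_undup => si.
rewrite -[LHS]/(_ *+ _)%E -mule_natl muleA -EFinM divff ?mul1e//.
by rewrite pnatr_eq0 -lt0n -has_count has_pred1.
Qed.

Lemma ge0_integral_mrestr d0 (S : measurableType d0)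
    (mu : {measure set S -> \bar R}) (D : set S) (mD : measurable D)
    (f : S -> \bar R) : measurable_fun setT f -> (forall s, (0 <= f s)%E) ->
  (\int[mrestr mu mD]_s f s = \int[mu]_(s in D) f s)%E.
Proof.
move=> mf f0; rewrite (@ge0_negligible_integral _ _ _ _ setT (~` D))//.
- rewrite setTD setCK; apply: (eq_measure_integral mu) => A mA AD /=.
  by rewrite /mrestr (setIidl AD).
- exact: measurableC.
- by rewrite -[LHS]/(mu (~` D `&` D)) (_ : _ `&` _ = set0)// -subset0 => s [].
Qed.

Lemma measurable_tuple_set1 (x : T) : measurable [set x].
Proof.
have -> : [set x] = \big[setI/setT]_(i < d) (fun z : T => tnth z i) @^-1` [set tnth x i].
  apply/seteqP; split => z /=.
    by move=> ->; rewrite -bigcap_seq => i _.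
  rewrite -bigcap_seq => zx; apply: eq_from_tnth => i.
  by apply: zx; rewrite /= mem_index_enum.
apply: bigsetI_measurable => i _; rewrite -[X in measurable X]setTI.
by apply: measurable_tnth => //; exact: measurable_set1.
Qed.

Lemma trivIset_slices (F : set (T * T)) (s : seq T) :
  trivIset [set` s] (fun x => [set x] `*` [set: T]).
Proof.
apply/trivIsetP => x y _ _ xy; apply/seteqP; split => // -[z1 z2] /= [[-> _] [xy' _]].
by rewrite xy' eqxx in xy.
Qed.

(* Disintegration of a coupling along the atoms of the empirical measure; an atom
   hit several times shares its mass evenly. *)
Lemma split_of_coupling N (x : nat -> T) (mu : probability T R)
    (xi : probability (T * T)%type R) :
  (0 < N)%N -> coupling (empirical N x) mu xi ->
  exists nu : nat -> {measure set T -> \bar R},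
  [/\ forall k, (k < N)%N -> nu k setT = N%:R^-1%:E,
      forall A, measurable A -> (\sum_(k < N) nu k A = mu A)%E &
      forall f : T * T -> \bar R, measurable_fun setT f -> (forall z, 0 <= f z)%E ->
       (\sum_(k < N) \int[nu k]_z f (x k, z) <= \int[xi]_z f z)%E].
Proof.
move=> N0 cxi; pose xs := [seq x k | k <- index_iota 0 N].
pose D y : set (T * T) := [set y] `*` setT.
have mD y : measurable (D y).
  by apply: measurableX => //; exact: measurable_tuple_set1.
have c0 y : 0 <= (count_mem y xs)%:R^-1 :> R by rewrite invr_ge0.
pose nu0 y := mscale (NngNum (c0 y)) (pushforward (mrestr xi (mD y)) snd).
pose nu k : {measure set T -> \bar R} :=
  [the measure _ _ of mscale (NngNum (c0 (x k)))
    (measure_function_pushforward__canonical__measure_function_Measure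
       (mrestr xi (mD (x k))) measurable_snd)].
have nuI k f : measurable_fun setT f -> (forall z, 0 <= f z)%E ->
    (\int[nu k]_z f (x k, z) =
     (count_mem (x k) xs)%:R^-1%:E * \int[xi]_(z in D (x k)) f z)%E.
  move=> mf f0; rewrite ge0_integral_mscale//; last first.
    by apply: measurableT_comp => //; exact: pair1_measurable.
  congr (_ * _)%E; rewrite [LHS]ge0_integral_pushforward//; last first.
    by apply: measurableT_comp => //; exact: pair1_measurable.
  rewrite preimage_setT [LHS]ge0_integral_mrestr; last 2 first.
    exact: (measurableT_comp (measurableT_comp mf (pair1_measurable (x k)))
      measurable_snd).
    by move=> z /=.
  by apply: eq_integral => -[z1 z2]; rewrite inE => -[/= -> _].
pose S := \big[setU/set0]_(y <- undup xs) D y.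
have mS : measurable S by apply: bigsetU_measurable => y _.
have sumI f : measurable_fun setT f -> (forall z, 0 <= f z)%E ->
    (\sum_(k < N) \int[nu k]_z f (x k, z) = \int[xi]_(z in S) f z)%E.
  move=> mf f0; rewrite ge0_integral_bigsetU//.
  - rewrite -sum_inv_count big_map big_mkord; apply: eq_bigr => k _.
    by rewrite nuI.
  - exact: undup_uniq.
  - exact: trivIset_slices.
  - exact: measurable_funTS.
have empS : empirical N x (~` [set y | y \in xs]) = 0%E.
  rewrite empiricalE big1 ?mule0// => k _; rewrite diracE memNset// /setC/=.
  by apply; apply: map_f; rewrite mem_index_iota leq0n ltn_ord.
(* The first marginal is carried by the sample points, so [xi] has no mass off the slices over
   them. *)
have xiS : xi (~` S) = 0%E.
  have -> : ~` S = (~` [set y | y \in xs]) `*` setT.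
    rewrite /S -bigcup_seq; apply/seteqP; split => -[z1 z2]/=.
      move=> H; split => // z1s; apply: H; exists z1 => //=.
      by rewrite mem_undup.
    by move=> [H _] [y/=]; rewrite mem_undup => ys [/= zy _]; apply: H; rewrite zy.
  rewrite (cxi _ _).1 ?empS//; apply: measurableC.
  rewrite (_ : [set y | _] = \big[setU/set0]_(y <- xs) [set y]).
    by apply: bigsetU_measurable => y _; exact: measurable_tuple_set1.
  rewrite -bigcup_seq; apply/seteqP; split => y /=.
    by move=> yx; exists y.
  by move=> [z zs ->].
have sumA f : measurable_fun setT f -> (forall z, 0 <= f z)%E ->
    (\sum_(k < N) \int[nu k]_z f (x k, z) = \int[xi]_z f z)%E.
  move=> mf f0; rewrite sumI// (@ge0_negligible_integral _ _ _ xi setT (~` S))//.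
    by rewrite setTD setCK.
  exact: measurableC.
exists nu; split.
(* The slice over [x k] has mass multiplicity / N, and the weight 1 / multiplicity leaves 1 / N. *)
- move=> k kN; rewrite /nu/= /mscale/= /pushforward /mrestr/=.
  rewrite preimage_setT setTI (cxi _ (measurable_tuple_set1 _)).1 empiricalE.
  rewrite muleCA -[RHS]mule1; congr (_ * _)%E.
  rewrite (eq_bigr (fun j : 'I_N => ((x j == x k) : nat)%:R%:E)); last first.
    move=> j _; rewrite diracE; congr (_%:R%:E); congr nat_of_bool.
    by apply/idP/eqP; rewrite inE.
  rewrite -(big_mkord xpredT (fun j => ((x j == x k) : nat)%:R%:E)).
  rewrite -(big_map x xpredT (fun y => ((y == x k) : nat)%:R%:E)) -/xs.
  rewrite sumEFin -EFinM -natr_sum.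
  rewrite (_ : (\sum_(j <- xs) _)%N = count_mem (x k) xs); last first.
    by rewrite -sum1_count [RHS]big_mkcond; apply: eq_bigr => j _ /=; case: eqP.
  rewrite mulVf// pnatr_eq0 -lt0n -has_count has_pred1.
  by apply: map_f; rewrite mem_index_iota.
- move=> A mA; rewrite -(cxi A mA).2.
  have := sumA (fun z => (\1_(setT `*` A) z)%:E).
  rewrite integral_indic//; last exact: measurableX.
  rewrite setIT => <-; last 2 first.
    by apply/measurable_EFinP/measurable_indic; exact: measurableX.
    by move=> z; rewrite lee_fin.
  apply: eq_bigr => k _.
  transitivity (\int[nu k]_z (\1_A z)%:E)%E; first by rewrite integral_indic// setIT.
  apply: eq_integral => z _; rewrite !indicE; congr (_%:R%:E); congr nat_of_bool.
  by apply/idP/idP; rewrite !inE//= => -[].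
- by move=> f mf f0; rewrite sumA.
Qed.

End semicontinuity.

(** * Upper semicontinuity of the cost and measurability of the deviation event *)

Section measurable_event.
Context (R : realType) (d : nat).
Local Notation T := (d.-tuple R).

Lemma eucl_dist_ge0 (x y : T) : 0 <= eucl_dist x y.
Proof. exact: sqrtr_ge0. Qed.

(** A substitute for the triangle inequality: its two alternatives can be raised to any power
    [p > 0], while the factor of [eucl_dist x z] stays as close to 1 as desired. It follows from
    Young's inequality for the squared coordinates, according to which of the two terms on the right
    is larger. *)
Lemma eucl_dist_or (eta : R) : 0 < eta -> exists2 K : R, 0 < K &
  forall x y z : T, eucl_dist y z <= (1 + eta) * eucl_dist x z \/
                    eucl_dist y z <= K * eucl_dist y x.
Proof.
move=> eta0; pose b := 1 + eta^-1; pose K := b * ((1 + eta) * eta^-1 + 1).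
have i0 : 0 < eta^-1 by rewrite invr_gt0.
have b1 : 1 <= b by rewrite lerDl ltW.
have K1 : 1 <= K by rewrite mulr_ege1// lerDr mulr_ge0// ?addr_ge0// ltW.
exists K; first exact: lt_le_trans K1.
move=> x y z; rewrite /eucl_dist.
set A := \sum_(i < d) (tnth x i - tnth z i) ^+ 2.
set B := \sum_(i < d) (tnth y i - tnth x i) ^+ 2.
set C := \sum_(i < d) (tnth y i - tnth z i) ^+ 2.
have A0 : 0 <= A by apply: sumr_ge0 => i _; exact: sqr_ge0.
have B0 : 0 <= B by apply: sumr_ge0 => i _; exact: sqr_ge0.
have CAB : C <= (1 + eta) * A + b * B.
  rewrite /A /B /C !mulr_sumr -big_split/=; apply: ler_sum => i _.
  set u := tnth y i; set v := tnth x i; set w := tnth z i.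
  rewrite -subr_ge0.
  (* The gap in Young's inequality with weights 1 + eta and 1 + 1/eta is a perfect square. *)
  have -> : (1 + eta) * (v - w) ^+ 2 + b * (u - v) ^+ 2 - (u - w) ^+ 2 =
            eta^-1 * (eta * (v - w) - (u - v)) ^+ 2.
    by rewrite /b; field; rewrite gt_eqF.
  by rewrite mulr_ge0 ?sqr_ge0// ltW.
have bound L X Y : 0 <= L -> 0 <= X -> Y <= L ^+ 2 * X ->
    Num.sqrt Y <= L * Num.sqrt X.
  move=> L0 X0 YX; rewrite -(ger0_norm L0) -sqrtr_sqr -sqrtrM ?sqr_ge0//.
  by rewrite ler_wsqrtr// mulrC.
have [BA|AB] := leP (b * B) (eta * A); [left|right].
- apply: bound => //; first by rewrite addr_ge0// ltW.
  apply: (le_trans CAB); apply: (@le_trans _ _ ((1 + eta) * A + eta * A)).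
    by rewrite lerD2l.
  by rewrite -mulrDl ler_wpM2r//; nra.
- apply: bound => //; first exact: le_trans K1.
  apply: (@le_trans _ _ (K * B)); last first.
    by rewrite ler_wpM2r// expr2 ler_peMl// (le_trans _ K1).
  apply: (le_trans CAB); rewrite /K mulrDr mulr1 mulrDl lerD2r.
  rewrite -(ler_pM2l eta0) mulrCA.
  have -> : eta * (b * ((1 + eta) / eta) * B) = (1 + eta) * (b * B).
    by field; rewrite gt_eqF.
  by rewrite ler_wpM2l ?ltW// addr_gt0.
Qed.

Lemma eucl_dist_powR_le (p eta : R) : 0 < p -> 0 < eta -> exists2 K : R, 0 < K &
  forall x y z : T, eucl_dist y z `^ p <=
    (1 + eta) `^ p * eucl_dist x z `^ p + K * eucl_dist y x `^ p.
Proof.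
move=> p0 eta0; have [K K0 HK] := eucl_dist_or eta0.
exists (K `^ p); first by rewrite powR_gt0.
move=> x y z; have [H|H] := HK x y z.
- apply: (@le_trans _ _ ((1 + eta) `^ p * eucl_dist x z `^ p)).
    rewrite -powRM ?eucl_dist_ge0//; last by rewrite addr_ge0// ltW.
    by apply: ge0_ler_powR; rewrite ?nnegrE ?eucl_dist_ge0 ?mulr_ge0 ?eucl_dist_ge0 ?addr_ge0// ltW.
  by rewrite lerDl mulr_ge0 ?powR_ge0.
- apply: (@le_trans _ _ (K `^ p * eucl_dist y x `^ p)).
    rewrite -powRM ?eucl_dist_ge0//; last exact: ltW.
    by apply: ge0_ler_powR; rewrite ?nnegrE ?eucl_dist_ge0 ?mulr_ge0 ?eucl_dist_ge0// ltW.
  by rewrite lerDr mulr_ge0 ?powR_ge0.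
Qed.

Lemma eucl_dist_coord (e : R) (x y : T) : 0 < e ->
  (forall i, `|tnth x i - tnth y i| < e) -> eucl_dist x y <= d%:R * e.
Proof.
move=> e0 xy; have de0 : 0 <= d%:R * e by rewrite mulr_ge0// ltW.
rewrite -(ger0_norm de0) -sqrtr_sqr /eucl_dist ler_wsqrtr//.
apply: (@le_trans _ _ (\sum_(i < d) e ^+ 2)).
  apply: ler_sum => i _; rewrite -real_normK ?num_real// ler_sqr ?nnegrE//.
  - exact: ltW.
  - exact: ltW.
rewrite sumr_const card_ord -[e ^+ 2 *+ d]mulr_natl exprMn ler_wpM2r ?sqr_ge0//.
by rewrite -natrX ler_nat; case: (d) => // n; rewrite leq_pmulr.
Qed.

(** An almost optimal coupling for [x] is split along the sample points and its pieces are reused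
    for [y], with [y k] as the origin of [nu k]. The cost grows by a factor close to 1 and by an
    error that vanishes with the displacement of the points. *)
Lemma transport_cost_usc (p : R) N (mu : probability T R) (x : nat -> T) (t : R) :
  0 < p -> (0 < N)%N -> (transport_cost p (empirical N x) mu < t%:E)%E ->
  exists2 e : R, 0 < e & forall y : nat -> T,
    (forall k i, (k < N)%N -> `|tnth (y k) i - tnth (x k) i| < e) ->
    (transport_cost p (empirical N y) mu < t%:E)%E.
Proof.
move=> p0 N0 /ereal_inf_lt[_ [xi cxi <-]] It.
have [nu [nuT numu nuI]] := split_of_coupling N0 cxi.
set I0 := (\int[xi]_z (eucl_dist z.1 z.2 `^ p)%:E)%E in It.
have I0ge0 : (0 <= I0)%E by apply: integral_ge0 => z _; rewrite lee_fin powR_ge0.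
have I0fin : I0 \is a fin_num by rewrite ge0_fin_numE// (lt_trans It) ?ltry.
pose I := fine I0; have IE : I0 = I%:E by rewrite fineK.
have I_ge0 : 0 <= I by rewrite fine_ge0.
rewrite IE lte_fin in It.
(* For I > 0, [eta] is such that (1 + eta)^p I is the midpoint of I and t. *)
have [eta eta0 Heta] : exists2 eta : R, 0 < eta & (1 + eta) `^ p * I < t.
  have [->|I0'] := eqVneq I 0.
    by exists 1 => //; rewrite mulr0 (le_lt_trans _ It).
  have Igt0 : 0 < I by rewrite lt_neqAle eq_sym I0'.
  pose r := (I + t) / 2 / I.
  have r1 : 1 < r by rewrite /r ltr_pdivlMr// mul1r; lra.
  have H1 : 1 < r `^ p^-1.
    have : 1 `^ p^-1 < r `^ p^-1.
      apply: gt0_ltr_powR; rewrite ?nnegrE ?invr_gt0//.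
      exact: ltW (lt_trans _ r1).
    by rewrite powR1.
  exists (r `^ p^-1 - 1); first by rewrite subr_gt0.
  rewrite addrC subrK -powRrM mulVf ?gt_eqF// powRr1; last by rewrite ltW// (lt_trans _ r1).
  by rewrite /r divfK ?gt_eqF//; lra.
have [K K0 HK] := eucl_dist_powR_le p0 eta0.
pose g := t - (1 + eta) `^ p * I.
have g0 : 0 < g by rewrite subr_gt0.
(* Each atom then moves by at most (g / (2 K))^(1/p), and the additive error is at most g / 2. The
   divisor is [d.+1] because [d] may be 0 here. *)
pose e := (g / (2 * K)) `^ p^-1 / d.+1%:R.
have e0 : 0 < e.
  by apply: divr_gt0 => //; apply: powR_gt0; apply: divr_gt0 => //; apply: mulr_gt0.
exists e => // y xy.
apply: (le_lt_trans (transport_cost_le_split p y N0 nuT numu)).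
have yx k : (k < N)%N -> eucl_dist (y k) (x k) `^ p <= g / (2 * K).
  move=> kN; have := eucl_dist_coord e0 (fun i => xy k i kN).
  move=> /le_trans /(_ (_ : _ <= (g / (2 * K)) `^ p^-1)) H.
  have {H} : eucl_dist (y k) (x k) <= (g / (2 * K)) `^ p^-1.
    apply: H; rewrite /e mulrCA ler_piMr ?powR_ge0// ler_pdivrMr// mul1r.
    by rewrite ler_nat.
  move=> /(ge0_ler_powR (ltW p0)); rewrite !nnegrE eucl_dist_ge0 powR_ge0.
  move=> /(_ isT isT) /le_trans; apply.
  by rewrite -powRrM mulVf ?gt_eqF// powRr1// ltW// divr_gt0// mulr_gt0.
pose F (z : T * T) := ((1 + eta) `^ p * eucl_dist z.1 z.2 `^ p + g / 2)%:E.
have mF : measurable_fun setT F.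
  apply/measurable_EFinP/measurable_funD => //; apply: measurable_funM => //.
  by have /measurable_EFinP := @measurable_dist_powR R d p.
have F0 z : (0 <= F z)%E.
  rewrite lee_fin addr_ge0 ?mulr_ge0 ?powR_ge0// ?invr_ge0//; exact: ltW.
apply: (@le_lt_trans _ _ (\sum_(k < N) \int[nu k]_z F (x k, z))%E).
  apply: lee_sum => k _; apply: ge0_le_integral => //.
  - by move=> z _; rewrite lee_fin powR_ge0.
  - exact: measurable_distr_powR.
  - exact: (measurableT_comp mF (pair1_measurable (x k))).
  - move=> z _; rewrite lee_fin; apply: (le_trans (HK (x k) (y k) z)).
    rewrite lerD2l; have := yx k (ltn_ord k).
    rewrite -(ler_pM2l K0) => /le_trans; apply.
    rewrite (_ : K * (g / (2 * K)) = g / 2)//; field; rewrite gt_eqF//.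
apply: (le_lt_trans (nuI _ mF F0)).
rewrite /F; under eq_integral do rewrite EFinD EFinM.
rewrite ge0_integralD//=; last 3 first.
- by move=> z _; rewrite -EFinM lee_fin mulr_ge0 ?powR_ge0.
- apply/measurable_EFinP; apply: measurable_funM => //.
  by have /measurable_EFinP := @measurable_dist_powR R d p.
- by move=> z _; rewrite lee_fin divr_ge0// ltW.
rewrite ge0_integralZl//; last 3 first.
- exact: measurable_dist_powR.
- by move=> z _; rewrite lee_fin powR_ge0.
- by rewrite lee_fin powR_ge0.
rewrite integral_cst// [X in (_ + _ * X)%E]probability_setT mule1 -/I0 IE -EFinM -EFinD lte_fin.
by rewrite /g; lra.
Qed.

(** A condition that is open in the first [N] points is a countable union of the rational boxes
    contained in it, and each box is a finite intersection of coordinate events. *)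
Lemma measurable_open_event disp (Omega : measurableType disp)
    (P : probability Omega R) (X : nat -> {RV P >-> T}) N
    (Q : (nat -> T) -> Prop) :
  (forall x, Q x -> exists2 e : R, 0 < e & forall y : nat -> T,
    (forall k i, (k < N)%N -> `|tnth (y k) i - tnth (x k) i| < e) -> Q y) ->
  measurable [set w | Q (fun k => X k w)].
Proof.
move=> Qo.
pose U := ({ffun 'I_N * 'I_d -> rat} * nat)%type.
pose inball (u : U) (y : nat -> T) := forall (k : 'I_N) (i : 'I_d),
  `|tnth (y k) i - ratr (u.1 (k, i))| < u.2.+1%:R^-1.
pose good (u : U) := forall y, inball u y -> Q y.
pose F (u : U) := [set w | good u /\ inball u (fun k => X k w)].
have -> : [set w | Q (fun k => X k w)] = \bigcup_u F u.
  apply/seteqP; split => w /=; last by move=> [u _ [gu iu]]; exact: gu.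
  move=> /Qo[e e0 He].
  (* The radius is below e / 2: it is used once from the sample to the rational centre and once from
     the centre to any point of the box. *)
  have [n _ /(_ n (leqnn n)) /= Hn] :=
    near_infty_natSinv_lt (PosNum (divr_gt0 e0 (ltr0n R 2))).
  have /choice[r Hr] : forall ki : 'I_N * 'I_d, exists q : rat,
      `|tnth (X ki.1 w) ki.2 - ratr q| < n.+1%:R^-1.
    move=> ki; set a := tnth _ _.
    have aa : a - n.+1%:R^-1 < a + n.+1%:R^-1.
      by rewrite ltrBlDr -addrA ltrDl addr_gt0.
    have [q] := rat_in_itvoo aa; rewrite in_itv/= => aq.
    by exists q; rewrite ltr_distlC.
  exists (finfun r, n) => //; split => [y iy|k i] /=.
  - apply: He => k i kN; have := iy (Ordinal kN) i; have := Hr (Ordinal kN, i).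
    rewrite /= ffunE; set q := ratr _ => H1 H2.
    rewrite (_ : _ - _ = (tnth (y k) i - q) - (tnth (X k w) i - q)); last by ring.
    apply: (le_lt_trans (ler_normB _ _)).
    by rewrite (splitr e); apply: ltrD; exact: lt_trans Hn.
  - by rewrite ffunE; exact: (Hr (k, i)).
apply: countable_bigcupT_measurable; first exact: countableP.
move=> u.
have [gu|gu] := pselect (good u); last first.
  by rewrite (_ : F u = set0)//; apply/seteqP; split => // w [].
have -> : F u = \big[setI/setT]_(ki : 'I_N * 'I_d)
   [set w | `|tnth (X ki.1 w) ki.2 - ratr (u.1 ki)| < u.2.+1%:R^-1].
  rewrite -bigcap_seq; apply/seteqP; split => w /=.
    by move=> [_ iu] [k i] _; exact: iu.
  by move=> H; split => // k i; apply: (H (k, i)); rewrite /= mem_index_enum.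
apply: bigsetI_measurable => -[k i] _ /=.
rewrite -[X in measurable X]setTI.
pose h w := `|tnth (X k w) i - ratr (u.1 (k, i))|.
have mh : measurable_fun setT h.
  apply: measurableT_comp => //; apply: measurable_funB => //.
  by apply: (measurableT_comp (measurable_tnth i)).
have := @measurable_fun_ltr _ _ _ setT h (cst u.2.+1%:R^-1) mh (@measurable_cst _ _ _ _ _ _).
exact.
Qed.

(** Required whenever the deviation event is compared with another event or its probability is
    bounded by 1. *)
Lemma measurable_transport_event disp (Omega : measurableType disp)
    (P : probability Omega R) (X : nat -> {RV P >-> T}) N p
    (mu : probability T R) (t : R) : 0 < p -> (0 < N)%N ->
  measurable [set w | (t%:E <= transport_cost p (empirical N (fun k => X k w)) mu)%E].
Proof.
move=> p0 N0; rewrite -[X in measurable X]setCK; apply: measurableC.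
have -> : ~` [set w | (t%:E <= transport_cost p (empirical N (fun k => X k w)) mu)%E] =
   [set w | (fun x => transport_cost p (empirical N x) mu < t%:E)%E (fun k => X k w)].
  by apply/seteqP; split => w /=; rewrite ltNge => /negP.
apply: (@measurable_open_event _ _ _ X N
  (fun x => transport_cost p (empirical N x) mu < t%:E)%E) => x.
exact: transport_cost_usc.
Qed.

End measurable_event.

(** * Multiscale matching *)

Section matching.
Context (R : realType) (I J : finType).
Implicit Types (a : I -> R) (b : J -> R) (m c : I -> J -> R).

Definition submatching a b m :=
  [/\ forall i j, 0 <= m i j,
      forall i, \sum_j m i j <= a i & forall j, \sum_i m i j <= b j].

Lemma sum_fiber (G : finType) (K : finType) (f : K -> G) (a : K -> R) :
  \sum_i a i = \sum_h \sum_(i | f i == h) a i.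
Proof.
rewrite (exchange_big_dep xpredT)//=; apply: eq_bigr => i _.
by rewrite (big_pred1 (f i))// => h; rewrite eq_sym.
Qed.

(** Inside a group of masses [A h] and [B h], the product plan a_i b_j divided by the larger mass
    respects both marginals and exhausts the lighter side. *)
Lemma greedy_matching (G : finType) (f : I -> G) (g : J -> G) a b :
  (forall i, 0 <= a i) -> (forall j, 0 <= b j) ->
  exists m, [/\ submatching a b m,
    forall i j, f i != g j -> m i j = 0 &
    forall h, \sum_(i | f i == h) (a i - \sum_j m i j) = 0 \/
              \sum_(j | g j == h) (b j - \sum_i m i j) = 0].
Proof.
move=> a0 b0.
pose A h := \sum_(i | f i == h) a i; pose B h := \sum_(j | g j == h) b j.
have A0 h : 0 <= A h by apply: sumr_ge0.
have B0 h : 0 <= B h by apply: sumr_ge0.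
pose M h := Num.max (A h) (B h).
have M0 h : 0 <= M h by rewrite le_max A0.
pose m i j := if f i == g j then a i * b j / M (f i) else 0.
have row i : \sum_j m i j = a i * (B (f i) / M (f i)).
  rewrite mulrA /B mulr_sumr mulr_suml [LHS]big_mkcond/= [RHS]big_mkcond/=.
  by apply: eq_bigr => j _; rewrite /m eq_sym.
have col j : \sum_i m i j = b j * (A (g j) / M (g j)).
  rewrite mulrA /A mulr_sumr mulr_suml [LHS]big_mkcond/= [RHS]big_mkcond/=.
  by apply: eq_bigr => i _; rewrite /m; case: eqP => // ->; rewrite (mulrC (a i)).
have BM h : B h / M h <= 1.
  have [->|Mh] := eqVneq (M h) 0; first by rewrite invr0 mulr0.
  rewrite ler_pdivrMr; last by rewrite lt_neqAle eq_sym Mh M0.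
  by rewrite mul1r /M le_max lexx orbT.
have AM h : A h / M h <= 1.
  have [->|Mh] := eqVneq (M h) 0; first by rewrite invr0 mulr0.
  rewrite ler_pdivrMr; last by rewrite lt_neqAle eq_sym Mh M0.
  by rewrite mul1r /M le_max lexx.
exists m; split.
- split => [i j|i|j].
  + by rewrite /m; case: ifP => // _; rewrite divr_ge0// mulr_ge0.
  + by rewrite row ler_piMr.
  + by rewrite col ler_piMr.
- by move=> i j /negbTE fg; rewrite /m fg.
- move=> h.
  have HA : \sum_(i | f i == h) (a i - \sum_j m i j) = A h * (1 - B h / M h).
    rewrite /A mulr_suml; apply: eq_bigr => i /eqP fi.
    by rewrite row fi mulrBr mulr1.
  have HB : \sum_(j | g j == h) (b j - \sum_i m i j) = B h * (1 - A h / M h).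
    rewrite [in RHS]/B mulr_suml; apply: eq_bigr => j /eqP gj.
    by rewrite col gj mulrBr mulr1.
  rewrite HA HB.
  have [->|Ah] := eqVneq (A h) 0; first by left; rewrite mul0r.
  have Agt : 0 < A h by rewrite lt_neqAle eq_sym Ah A0.
  have [AB|BA] := leP (A h) (B h); [left|right].
    rewrite /M (max_idPr AB) divff ?subrr ?mulr0// gt_eqF//.
    exact: lt_le_trans AB.
  by rewrite /M (max_idPl (ltW BA)) divff ?subrr ?mulr0// gt_eqF.
Qed.

Lemma sum_matching_fiber (G : finType) (f : I -> G) (g : J -> G) m h :
  (forall i j, f i != g j -> m i j = 0) ->
  \sum_(i | f i == h) \sum_j m i j = \sum_(j | g j == h) \sum_i m i j.
Proof.
move=> fg; rewrite exchange_big/= [RHS]big_mkcond/=.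
apply: eq_bigr => j _; case: eqP => [gj|/eqP gj].
- rewrite [LHS]big_mkcond; apply: eq_bigr => i _; case: eqP => // /eqP fi.
  by rewrite fg// gj.
- by rewrite big1// => i /eqP fi; rewrite fg// fi eq_sym.
Qed.

(** Matching inside a group removes the same mass from both sides and so preserves the difference of
    the two masses. As one of the two leftovers is zero, their sum is the absolute value of that
    difference. *)
Lemma leftover_fiber (G : finType) (f : I -> G) (g : J -> G) a b m :
  submatching a b m -> (forall i j, f i != g j -> m i j = 0) ->
  (forall h, \sum_(i | f i == h) (a i - \sum_j m i j) = 0 \/
             \sum_(j | g j == h) (b j - \sum_i m i j) = 0) ->
  \sum_i (a i - \sum_j m i j) + \sum_j (b j - \sum_i m i j) =
  \sum_h `|\sum_(i | f i == h) a i - \sum_(j | g j == h) b j|.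
Proof.
move=> [m0 ma mb] fg H.
rewrite (sum_fiber f) [X in _ + X](sum_fiber g) -big_split/=.
apply: eq_bigr => h _.
set x := \sum_(i | f i == h) (_ - _); set y := \sum_(j | g j == h) (_ - _).
have x0 : 0 <= x by apply: sumr_ge0 => i _; rewrite subr_ge0.
have y0 : 0 <= y by apply: sumr_ge0 => i _; rewrite subr_ge0.
have -> : \sum_(i | f i == h) a i - \sum_(j | g j == h) b j = x - y.
  rewrite /x /y !sumrB (sum_matching_fiber h fg); ring.
have [x00|y00] : x = 0 \/ y = 0 by exact: H.
- by rewrite x00 add0r sub0r normrN ger0_norm.
- by rewrite y00 addr0 subr0 ger0_norm.
Qed.

(* Bottom-up greedy matching: whatever is left over inside a cell of level [l]
   after the levels [L, ..., l] is exactly the mass discrepancy of that cell. *)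
Lemma multiscale_matching (Lab : nat -> finType) (f : forall l, I -> Lab l)
    (g : forall l, J -> Lab l) a b c (L : nat) (D : nat -> R) :
  (forall i, 0 <= a i) -> (forall j, 0 <= b j) -> (forall l, 0 <= D l) ->
  (forall l i j, f l.+1 i = g l.+1 j -> f l i = g l j) ->
  (forall l i j, (l <= L)%N -> f l i = g l j -> 0 < a i -> 0 < b j -> c i j <= D l) ->
  exists m, [/\ submatching a b m,
    \sum_i (a i - \sum_j m i j) + \sum_j (b j - \sum_i m i j) =
      \sum_(h : Lab 0) `|\sum_(i | f 0 i == h) a i - \sum_(j | g 0 j == h) b j| &
    \sum_i \sum_j m i j * c i j <= D L * \sum_j b j +
     \sum_(l < L) D l * \sum_(h : Lab l.+1)
       `|\sum_(i | f l.+1 i == h) a i - \sum_(j | g l.+1 j == h) b j| ].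
Proof.
move=> a0 b0 D0 nest cD.
pose Delta l := \sum_(h : Lab l)
  `|\sum_(i | f l i == h) a i - \sum_(j | g l j == h) b j|.
(* Stated for masses below [a] and [b], so that it applies to leftovers. *)
have cost l a' b' m' : (l <= L)%N -> (forall i, a' i <= a i) -> (forall j, b' j <= b j) ->
    submatching a' b' m' ->
    (forall i j, f l i != g l j -> m' i j = 0) ->
    \sum_i \sum_j m' i j * c i j <= D l * \sum_i \sum_j m' i j.
  move=> lL aa bb [m0 ma mb] mfg; rewrite mulr_sumr; apply: ler_sum => i _.
  rewrite mulr_sumr; apply: ler_sum => j _.
  have [->|mij] := eqVneq (m' i j) 0; first by rewrite mul0r mulr0.
  have mgt : 0 < m' i j by rewrite lt_neqAle eq_sym mij m0.
  rewrite mulrC ler_pM2r//; apply: cD => //.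
  - by apply/eqP; apply: contra_neqT mij => ?; rewrite mfg.
  - apply: (lt_le_trans mgt); apply: le_trans (aa i); apply: le_trans (ma i).
    by rewrite (bigD1 j)//= lerDl sumr_ge0.
  - apply: (lt_le_trans mgt); apply: le_trans (bb j); apply: le_trans (mb j).
    by rewrite (bigD1 i)//= lerDl sumr_ge0.
(* Induction on the number [k] of levels treated after the finest one. The invariant says that the
   plan respects the labels of level [L - k] and that each cell of this level has one side
   exhausted. *)
suff /(_ L (leqnn L)) : forall k, (k <= L)%N -> exists m, [/\ submatching a b m,
    forall i j, f (L - k)%N i != g (L - k)%N j -> m i j = 0,
    forall h, \sum_(i | f (L - k)%N i == h) (a i - \sum_j m i j) = 0 \/
              \sum_(j | g (L - k)%N j == h) (b j - \sum_i m i j) = 0 &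
    \sum_i \sum_j m i j * c i j <= D L * \sum_j b j +
     \sum_(L - k <= l < L) D l * Delta l.+1].
  rewrite subnn big_mkord => -[m [ms mfg mh mc]]; exists m; split => //.
  exact: leftover_fiber.
elim=> [_|k IH kL].
  rewrite subn0; have [m [ms mfg mh]] := greedy_matching (f L) (g L) a0 b0.
  exists m; split => //; rewrite big_geq// addr0.
  apply: (le_trans (cost _ _ _ _ (leqnn L) (fun=> lexx _) (fun=> lexx _) ms mfg)).
  rewrite ler_wpM2l// exchange_big/=; apply: ler_sum => j _.
  by case: ms.
have [m [ms mfg mh mc]] := IH (ltnW kL).
set l := (L - k.+1)%N; have lk : (L - k)%N = l.+1 by rewrite /l; lia.
rewrite lk in mfg mh mc.
have [m0 ma mb] := ms.
pose a' i := a i - \sum_j m i j; pose b' j := b j - \sum_i m i j.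
have a'0 i : 0 <= a' i by rewrite subr_ge0.
have b'0 j : 0 <= b' j by rewrite subr_ge0.
have [m' [ms' mfg' mh']] := greedy_matching (f l) (g l) a'0 b'0.
have [m'0 ma' mb'] := ms'.
exists (fun i j => m i j + m' i j); split.
- split => [i j|i|j]; first by rewrite addr_ge0.
  + by rewrite big_split/= addrC -lerBrDr; exact: ma'.
  + by rewrite big_split/= addrC -lerBrDr; exact: mb'.
- move=> i j fg; rewrite mfg' // mfg ?addr0//.
  by apply: contra_neq fg; exact: nest.
- move=> h; have [H|H] := mh' h; [left|right]; rewrite -[RHS]H.
  + by apply: eq_bigr => i _; rewrite big_split/= opprD addrA.
  + by apply: eq_bigr => j _; rewrite big_split/= opprD addrA.
- have -> : \sum_i \sum_j (m i j + m' i j) * c i j =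
      \sum_i \sum_j m i j * c i j + \sum_i \sum_j m' i j * c i j.
    rewrite -big_split; apply: eq_bigr => i _ /=; rewrite -big_split.
    by apply: eq_bigr => j _; rewrite mulrDl.
  rewrite big_ltn; last by rewrite /l; lia.
  rewrite addrCA addrC; apply: lerD => //.
  have aa i : a' i <= a i by rewrite gerBl sumr_ge0.
  have bb j : b' j <= b j by rewrite gerBl sumr_ge0.
  have lL : (l <= L)%N by rewrite leq_subr.
  (* The mass moved at level [l] is at most what level [l.+1] left over, which is [Delta l.+1]. *)
  apply: (le_trans (cost l _ _ _ lL aa bb ms' mfg')); rewrite ler_wpM2l//.
  apply: (@le_trans _ _ (\sum_i a' i)); first exact: ler_sum.
  rewrite /Delta -(leftover_fiber ms mfg mh) lerDl.
  by apply: sumr_ge0 => j _; exact: b'0.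
Qed.

End matching.

(** * Matching of the annuli and of what they leave over *)

Section block_matching.
Context (R : realType) (I J : finType).

(** Each block below [B] is matched on its own; the leftovers, together with the whole blocks from
    [B] on, are then matched by a product plan. Equal total masses make the two remainders equal in
    mass, and the bound c <= u + v splits the cost of the product plan into one term per side. *)
Lemma block_matching (Lab : nat -> finType) (f : forall l, I -> Lab l)
    (g : forall l, J -> Lab l) (a : I -> R) (b : J -> R) (c : I -> J -> R)
    (B : nat) (p : I -> nat) (q : J -> nat) (L : nat -> nat) (D : nat -> nat -> R)
    (V : nat -> R) (u : I -> R) (v : J -> R) :
  (forall i, 0 <= a i) -> (forall j, 0 <= b j) -> \sum_i a i = \sum_j b j ->
  (forall n l, 0 <= D n l) ->
  (forall i, 0 <= u i) -> (forall j, 0 <= v j) ->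
  (forall l i j, f l.+1 i = g l.+1 j -> f l i = g l j) ->
  (forall n l i j, (n < B)%N -> (l <= L n)%N -> p i = n -> q j = n ->
     f l i = g l j -> 0 < b j -> c i j <= D n l) ->
  (forall i j, 0 < b j -> c i j <= u i + v j) ->
  (forall i, (p i < B)%N -> u i <= V (p i)) ->
  (forall j, (q j < B)%N -> v j <= V (q j)) ->
  exists m : I -> J -> R, [/\ forall i j, 0 <= m i j,
    forall i, \sum_j m i j = a i, forall j, \sum_i m i j = b j &
    \sum_i \sum_j m i j * c i j <=
      \sum_(n < B) (D n (L n) * (\sum_(j | q j == n) b j) +
        \sum_(l < L n) D n l * (\sum_(h : Lab l.+1)
          `|\sum_(i | (p i == n) && (f l.+1 i == h)) a i -
            \sum_(j | (q j == n) && (g l.+1 j == h)) b j|) +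
        V n * (\sum_(h : Lab 0)
          `|\sum_(i | (p i == n) && (f 0 i == h)) a i -
            \sum_(j | (q j == n) && (g 0 j == h)) b j|)) +
      \sum_(i | (B <= p i)%N) a i * u i + \sum_(j | (B <= q j)%N) b j * v j].
Proof.
move=> a0 b0 ab D0 u0 v0 nest cD cuv uV vV.
pose an (n : nat) i := if p i == n then a i else 0.
pose bn (n : nat) j := if q j == n then b j else 0.
have an0 n i : 0 <= an n i by rewrite /an; case: ifP.
have bn0 n j : 0 <= bn n j by rewrite /bn; case: ifP.
have anE n (P : pred I) : \sum_(i | P i) an n i = \sum_(i | (p i == n) && P i) a i.
  by rewrite [RHS]big_mkcondl.
have bnE n (P : pred J) : \sum_(j | P j) bn n j = \sum_(j | (q j == n) && P j) b j.
  by rewrite [RHS]big_mkcondl.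
have /choice[M HM] : forall n : 'I_B, exists m, [/\ submatching (an n) (bn n) m,
    \sum_i (an n i - \sum_j m i j) + \sum_j (bn n j - \sum_i m i j) =
      \sum_(h : Lab 0) `|\sum_(i | f 0 i == h) an n i - \sum_(j | g 0 j == h) bn n j| &
    \sum_i \sum_j m i j * c i j <= D n (L n) * \sum_j bn n j +
     \sum_(l < L n) D n l * \sum_(h : Lab l.+1)
       `|\sum_(i | f l.+1 i == h) an n i - \sum_(j | g l.+1 j == h) bn n j| ].
  move=> n; apply: multiscale_matching => // l i j lL fg.
  rewrite /an /bn; case: eqP => [pi _|]; last by rewrite ltxx.
  case: eqP => [qj bj|]; last by rewrite ltxx.
  exact: cD.
pose ra (n : 'I_B) i := an n i - \sum_j M n i j.
pose rb (n : 'I_B) j := bn n j - \sum_i M n i j.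
have Msub (n : 'I_B) : submatching (an n) (bn n) (M n) by case: (HM n).
have M0 (n : 'I_B) i j : 0 <= M n i j by case: (Msub n).
have ra0 (n : 'I_B) i : 0 <= ra n i by rewrite subr_ge0; case: (Msub n).
have rb0 (n : 'I_B) j : 0 <= rb n j by rewrite subr_ge0; case: (Msub n).
have aS i : a i = \sum_(n < B) an n i + (if (B <= p i)%N then a i else 0).
  case: leqP => pB.
    rewrite big1 ?add0r// => n _; rewrite /an; case: eqP => // pi.
    by move: pB; rewrite pi leqNgt ltn_ord.
  rewrite addr0 (bigD1 (Ordinal pB))//= big1 ?addr0 /an/= ?eqxx// => n nE.
  by case: eqP => // pi; case/eqP: nE; apply: val_inj.
have bS j : b j = \sum_(n < B) bn n j + (if (B <= q j)%N then b j else 0).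
  case: leqP => pB.
    rewrite big1 ?add0r// => n _; rewrite /bn; case: eqP => // pi.
    by move: pB; rewrite pi leqNgt ltn_ord.
  rewrite addr0 (bigD1 (Ordinal pB))//= big1 ?addr0 /bn/= ?eqxx// => n nE.
  by case: eqP => // pi; case/eqP: nE; apply: val_inj.
pose r i := \sum_(n < B) ra n i + (if (B <= p i)%N then a i else 0).
pose s j := \sum_(n < B) rb n j + (if (B <= q j)%N then b j else 0).
have rE i : r i = a i - \sum_(n < B) \sum_j M n i j.
  by rewrite [in RHS]aS /r addrAC -sumrB.
have sE j : s j = b j - \sum_(n < B) \sum_i M n i j.
  by rewrite [in RHS]bS /s addrAC -sumrB.
have r0 i : 0 <= r i by rewrite addr_ge0 ?sumr_ge0//; case: ifP.
have s0 j : 0 <= s j by rewrite addr_ge0 ?sumr_ge0//; case: ifP.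
pose S := \sum_i r i.
have SE : S = \sum_j s j.
  rewrite /S (eq_bigr _ (fun i _ => rE i)) (eq_bigr _ (fun j _ => sE j)) !sumrB ab.
  congr (_ - _); rewrite exchange_big/= [RHS]exchange_big/=.
  by apply: eq_bigr => n _; rewrite exchange_big.
have S0 : 0 <= S by rewrite sumr_ge0.
(* If [S] is 0 all remainders vanish, so the division by [S] in [W] is harmless. *)
have rS i : r i * (S / S) = r i.
  have [S00|Sn] := eqVneq S 0; last by rewrite divff// mulr1.
  by rewrite (psumr_eq0P (fun i _ => r0 i) S00 (i := i))// mul0r.
have sS j : s j * (S / S) = s j.
  have [S00|Sn] := eqVneq S 0; last by rewrite divff// mulr1.
  rewrite SE in S00.
  by rewrite (psumr_eq0P (fun i _ => s0 i) S00 (i := j))// mul0r.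
pose W i j := r i * s j / S.
have W0 i j : 0 <= W i j by rewrite divr_ge0// mulr_ge0.
have Wr i : \sum_j W i j = r i.
  by rewrite /W -mulr_suml -mulr_sumr -SE -mulrA rS.
have Ws j : \sum_i W i j = s j.
  by rewrite /W -mulr_suml -mulr_suml (mulrC _ (s j)) -mulrA sS.
exists (fun i j => \sum_(n < B) M n i j + W i j); split.
- by move=> i j; rewrite addr_ge0// sumr_ge0.
- move=> i; rewrite big_split/= Wr rE exchange_big/=.
  by rewrite addrC subrK.
- move=> j; rewrite big_split/= Ws sE exchange_big/=.
  by rewrite addrC subrK.
have -> : \sum_i \sum_j (\sum_(n < B) M n i j + W i j) * c i j =
   \sum_(n < B) (\sum_i \sum_j M n i j * c i j) + \sum_i \sum_j W i j * c i j.
  rewrite [X in _ = X + _]exchange_big -big_split; apply: eq_bigr => i _ /=.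
  rewrite [X in _ = X + _]exchange_big -big_split; apply: eq_bigr => j _ /=.
  by rewrite mulrDl mulr_suml.
have Wc : \sum_i \sum_j W i j * c i j <= \sum_i r i * u i + \sum_j s j * v j.
  apply: (@le_trans _ _ (\sum_i \sum_j (W i j * u i + W i j * v j))).
    apply: ler_sum => i _; apply: ler_sum => j _; rewrite -mulrDr.
    have [->|Wij] := eqVneq (W i j) 0; first by rewrite !mul0r.
    rewrite ler_wpM2l// cuv//.
    rewrite lt_neqAle b0 andbT eq_sym; apply: contra_neq Wij => bj.
    have sj : s j = 0.
      apply/eqP; rewrite eq_le s0 andbT sE bj sub0r oppr_le0.
      by apply: sumr_ge0 => n _; apply: sumr_ge0 => k _; exact: M0.
    by rewrite /W sj mulr0 mul0r.
  under eq_bigr do rewrite big_split/= -mulr_suml Wr.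
  rewrite big_split/= lerD2l exchange_big/=.
  by apply: ler_sum => j _; rewrite -mulr_suml Ws.
have ru : \sum_i r i * u i <= \sum_(n < B) V n * (\sum_i ra n i) +
    \sum_(i | (B <= p i)%N) a i * u i.
  rewrite /r; under eq_bigr do rewrite mulrDl.
  rewrite big_split/=; apply: lerD; last first.
    rewrite [leRHS]big_mkcond; apply: ler_sum => i _.
    by case: ifP => //; rewrite mul0r.
  under [leRHS]eq_bigr do rewrite mulr_sumr.
  rewrite exchange_big/=; apply: ler_sum => i _.
  rewrite mulr_suml; apply: ler_sum => n _; rewrite mulrC.
  have [->|rni] := eqVneq (ra n i) 0; first by rewrite !mulr0.
  rewrite ler_wpM2r//.
  have pin : p i = n.
    apply/eqP; apply: contra_neqT rni => pin.
    apply/eqP; rewrite eq_le ra0 andbT /ra /an (negbTE pin) sub0r oppr_le0.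
    by apply: sumr_ge0 => k _; exact: M0.
  by rewrite -pin uV// pin.
have sv : \sum_j s j * v j <= \sum_(n < B) V n * (\sum_j rb n j) +
    \sum_(j | (B <= q j)%N) b j * v j.
  rewrite /s; under eq_bigr do rewrite mulrDl.
  rewrite big_split/=; apply: lerD; last first.
    rewrite [leRHS]big_mkcond; apply: ler_sum => i _.
    by case: ifP => //; rewrite mul0r.
  under [leRHS]eq_bigr do rewrite mulr_sumr.
  rewrite exchange_big/=; apply: ler_sum => i _.
  rewrite mulr_suml; apply: ler_sum => n _; rewrite mulrC.
  have [->|rni] := eqVneq (rb n i) 0; first by rewrite !mulr0.
  rewrite ler_wpM2r//.
  have pin : q i = n.
    apply/eqP; apply: contra_neqT rni => pin.
    apply/eqP; rewrite eq_le rb0 andbT /rb /bn (negbTE pin) sub0r oppr_le0.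
    by apply: sumr_ge0 => k _; exact: M0.
  by rewrite -pin vV// pin.
apply: (le_trans (lerD (lexx _) (le_trans Wc (lerD ru sv)))).
rewrite [X in _ + X <= _]addrACA [leLHS]addrA -[leRHS]addrA; apply: lerD => //.
rewrite -!big_split/=.
apply: ler_sum => n _; have [_ H1 H2] := HM n.
rewrite -mulrDr H1.
have -> : \sum_(j | q j == n) b j = \sum_j bn n j.
  by rewrite bnE; apply: eq_bigl => j; rewrite andbT.
rewrite lerD//.
- apply: (le_trans H2); rewrite lerD2l; apply: ler_sum => l _.
  rewrite ler_wpM2l//; apply: ler_sum => h _.
  by rewrite anE bnE.
- rewrite le_eqVlt; apply/orP; left; apply/eqP; congr (_ * _).
  by apply: eq_bigr => h _; rewrite anE bnE.
Qed.

End block_matching.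

(** * From finite matchings to couplings of measures *)

Section partition.
Context d0 (S : measurableType d0) (R : realType) (J : finType) (F : S -> J).
Hypothesis mF : forall j, measurable [set z | F z = j].
Variable mu : {measure set S -> \bar R}.

Lemma ge0_integral_partition (f : S -> \bar R) :
  measurable_fun setT f -> (forall z, 0 <= f z)%E ->
  (\int[mu]_z f z = \sum_j \int[mu]_(z in [set z | F z = j]) f z)%E.
Proof.
move=> mf f0.
have T : setT = \big[setU/set0]_(j <- enum J) [set z | F z = j].
  rewrite -bigcup_seq; apply/seteqP; split => z //= _.
  by exists (F z) => //=; rewrite mem_enum.
rewrite [in LHS]T ge0_integral_bigsetU//.
- by rewrite big_enum.
- exact: enum_uniq.
- apply/trivIsetP => i j _ _ ij; apply/seteqP; split => // z /= [Fi Fj].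
  by move: ij; rewrite -Fi -Fj eqxx.
- exact: measurable_funTS.
Qed.

Lemma measure_partition (A : set S) : measurable A ->
  (mu A = \sum_j mu (A `&` [set z | F z = j]))%E.
Proof.
move=> mA; have := @ge0_integral_partition (fun z => (\1_A z)%:E).
rewrite integral_indic// setIT => ->.
- by apply: eq_bigr => j _; rewrite integral_indic.
- exact/measurable_EFinP/measurable_indic.
- by move=> z; rewrite lee_fin.
Qed.

End partition.

Section deterministic.
Context (R : realType) (d : nat).
Local Notation T := (d.-tuple R).

Lemma sum_nth_enum (V : nmodType) (J : finType) (j0 : J) (G : J -> V) :
  \sum_(t < #|J|) G (nth j0 (enum J) t) = \sum_j G j.
Proof.
rewrite -[RHS]big_enum (big_nth j0) -cardE big_mkord.
by apply: eq_bigl.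
Qed.

(** The mass [m k j] sent to cell [j] is spread there in proportion to [mu], so a unit of it pays
    the mean [c k j] of the cost over the cell. The column sums of [m] are the masses of the cells,
    hence the pieces add up to [mu]. *)
Lemma transport_cost_le_matching (p : R) N (x : nat -> T) (mu : probability T R)
    (J : finType) (F : T -> J) (m : 'I_N -> J -> R) (c : 'I_N -> J -> R) :
  (0 < N)%N -> (forall j, measurable [set z | F z = j]) ->
  (forall k j, 0 <= m k j) ->
  (forall k, \sum_j m k j = N%:R^-1) ->
  (forall j, \sum_k m k j = fine (mu [set z | F z = j])) ->
  (forall (k : 'I_N) j, (\int[mu]_(z in [set z | F z = j]) (eucl_dist (x k) z `^ p)%:E =
    (c k j * fine (mu [set z | F z = j]))%:E)%E) ->
  (transport_cost p (empirical N x) mu <= (\sum_k \sum_j m k j * c k j)%:E)%E.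
Proof.
move=> N0 mF m0 mr ms mc.
pose b j := fine (mu [set z | F z = j]).
have bE j : mu [set z | F z = j] = (b j)%:E by rewrite fineK// fin_num_measure.
have b0 j : 0 <= b j by rewrite fine_ge0.
pose j0 := F (x 0); pose e t := nth j0 (enum J) t.
have w0 k j : 0 <= m k j / b j by rewrite divr_ge0.
have mz k j : b j = 0 -> m k j = 0.
  move=> bj; apply/eqP; rewrite eq_le m0 andbT -bj /b -ms (bigD1 k)//= lerDl.
  by rewrite sumr_ge0.
have mw k j : m k j / b j * b j = m k j.
  have [bj|bj] := eqVneq (b j) 0; last by rewrite divfK.
  by rewrite mz// bj mulr0.
(* The default [k0] concerns only indices [k >= N], over which nothing is summed. *)
pose k0 := Ordinal N0; pose nu (k : nat) : {measure set T -> \bar R} :=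
  [the measure _ _ of msum (fun t => [the measure _ _ of
     mscale (NngNum (w0 (insubd k0 k) (e t))) (mrestr mu (mF (e t)))]) #|J|].
have nuE (k : 'I_N) A : nu k A = (\sum_j (m k j / b j)%:E * mu (A `&` [set z | F z = j]))%E.
  rewrite /nu/= /msum/= -(sum_nth_enum j0); apply: eq_bigr => t _.
  by rewrite /mscale/= /mrestr/= valKd.
apply: le_trans.
  apply: (@transport_cost_le_split _ _ p N x nu) => //.
  - move=> k kN; rewrite -[k]/(val (Ordinal kN)) nuE -(mr (Ordinal kN)) -sumEFin.
    by apply: eq_bigr => j _; rewrite setTI bE -EFinM mw.
  - move=> A mA; rewrite (measure_partition mF mu mA).
    under eq_bigr do rewrite nuE.
    rewrite exchange_big/=; apply: eq_bigr => j _.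
    rewrite -ge0_sume_distrl; last by move=> k _; rewrite lee_fin.
    rewrite sumEFin -mulr_suml ms -/(b j).
    have [bj|bj] := eqVneq (b j) 0; last by rewrite divff// mul1e.
    rewrite bj mul0r mul0e; apply/esym/eqP; rewrite eq_le measure_ge0 andbT.
    rewrite -(_ : (mu [set z | F z = j] = 0)%E); last by rewrite bE bj.
    by apply: le_measure => //; rewrite ?inE//; exact: measurableI.
rewrite -sumEFin; apply: lee_sum => k _.
have d0 (z : T) : (0 <= (eucl_dist (x k) z `^ p)%:E)%E by rewrite lee_fin powR_ge0.
rewrite ge0_integral_measure_sum//; last exact: measurable_distr_powR.
rewrite -sumEFin -(sum_nth_enum j0 (fun j => (m k j * c k j)%:E)).
apply: lee_sum => t _.
rewrite ge0_integral_mscale//; last exact: measurable_distr_powR.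
rewrite ge0_integral_mrestr//; last exact: measurable_distr_powR.
by rewrite mc/= valKd -EFinM -/(b _) mulrA mulrAC mw.
Qed.

End deterministic.

Section multiscale.
Context (R : realType) (d : nat).
Local Notation T := (d.-tuple R).
Variables (Lab : nat -> finType) (lev : forall l, T -> Lab l) (blk : T -> nat).
Hypothesis mlev : forall l h, measurable [set z | lev l z = h].
Hypothesis mblk : forall n, measurable [set z | blk z = n].
Hypothesis nest : forall l y z, lev l.+1 y = lev l.+1 z -> lev l y = lev l z.

(** Delta_(n,l) of the overview, for abstract cells [lev] and blocks [blk]. *)
Definition discrepancy (mu : probability T R) N (x : nat -> T) (n l : nat) : R :=
  \sum_(h : Lab l)
   `|\sum_(k < N | (blk (x k) == n) && (lev l (x k) == h)) N%:R^-1 -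
     fine (mu [set z | blk z = n /\ lev l z = h])|.

Lemma measurable_blk_ge B : measurable [set z | (B <= blk z)%N].
Proof.
have -> : [set z | (B <= blk z)%N] = ~` \big[setU/set0]_(n < B) [set z | blk z = n].
  rewrite -bigcup_seq; apply/seteqP; split => z /=.
    move=> Bz [n _ /= zn]; move: Bz; rewrite zn leqNgt; apply/negP/negPn.
    exact: ltn_ord.
  move=> H; rewrite leqNgt; apply/negP => zB; apply: H.
  by exists (Ordinal zB) => //=; rewrite mem_index_enum.
by apply: measurableC; apply: bigsetU_measurable => n _.
Qed.

Lemma lev_downward l l' y z : (l <= l')%N -> lev l' y = lev l' z -> lev l y = lev l z.
Proof.
move=> /subnK <-; elim: (l' - l)%N => // k IH; rewrite addSn => /nest.
exact: IH.
Qed.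

(** The sample points are matched with the cells of the finest level in use, all blocks from [B] on
    being merged into one to keep the label type finite. The cost towards a cell is a mean over that
    cell, so a bound valid for any two points of a common coarser cell passes to it. *)
Lemma transport_cost_multiscale (p : R) N (x : nat -> T) (mu : probability T R)
    (w : T -> R) (B : nat) (L : nat -> nat) (D : nat -> nat -> R) (V : nat -> R) :
  (0 < N)%N -> measurable_fun setT w -> (forall z, 0 <= w z) ->
  (\int[mu]_z (w z)%:E < +oo)%E ->
  (forall n l, 0 <= D n l) -> (forall n, 0 <= V n) ->
  (forall n l y z, (n < B)%N -> (l <= L n)%N -> blk y = n -> blk z = n ->
     lev l y = lev l z -> eucl_dist y z `^ p <= D n l) ->
  (forall y z, eucl_dist y z `^ p <= w y + w z) ->
  (forall z, (blk z < B)%N -> w z <= V (blk z)) ->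
  (transport_cost p (empirical N x) mu <=
   (\sum_(n < B) (D n (L n) * fine (mu [set z | blk z = n]) +
       \sum_(l < L n) D n l * discrepancy mu N x n l.+1 +
       V n * discrepancy mu N x n 0) +
    \sum_(k < N | (B <= blk (x k))%N) N%:R^-1 * w (x k))%:E +
   \int[mu]_(z in [set z | (B <= blk z)%N]) (w z)%:E)%E.
Proof.
move=> N0 mw w0 wfin D0 V0 HD Hw HV.
pose Lmax := \max_(n < B) L n.
pose J := ('I_B.+1 * Lab Lmax)%type.
pose F (z : T) : J := (inord (minn (blk z) B), lev Lmax z).
have F1 z : (F z).1 = minn (blk z) B :> nat.
  by rewrite /= inordK// ltnS geq_minr.
have mF (j : J) : measurable [set z | F z = j].
  have -> : [set z | F z = j] = [set z | if (j.1 < B)%N then blk z = j.1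
      else (B <= blk z)%N] `&` [set z | lev Lmax z = j.2].
    apply/seteqP; split => z /=.
      move=> <-; split => //; rewrite F1; case: ltnP => H; lia.
    move=> [H1 H2]; case: j H1 H2 => j1 j2 /= H1 <-; congr pair.
    apply: val_inj => /=; rewrite inordK; last by rewrite ltnS geq_minr.
    by have := ltn_ord j1; case: ltnP H1; lia.
  apply: measurableI => //; case: (ltnP j.1 B) => _; first exact: mblk.
  exact: measurable_blk_ge.
(* Coarser labels of a cell are read off a representative. The default [x 0] occurs only for empty
   cells, whose mass is 0. *)
pose rep (j : J) := xget (x 0) [set z | F z = j].
have repP z (j : J) : F z = j -> F (rep j) = j.
  by move=> zj; apply: (@xgetPex _ (x 0) [set z | F z = j]); exists z.
have FD z z' : F z = F z' -> minn (blk z) B = minn (blk z') B /\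
    forall l, (l <= Lmax)%N -> lev l z = lev l z'.
  move=> zz'; split; first by rewrite -!F1 zz'.
  by move=> l lL; apply: (lev_downward lL); case: zz'.
pose b j := fine (mu [set z | F z = j]).
have bE j : mu [set z | F z = j] = (b j)%:E by rewrite fineK// fin_num_measure.
have b0 j : 0 <= b j by rewrite fine_ge0.
have bgt j : 0 < b j -> exists z, F z = j.
  move=> bj; have [//|nz] := pselect (exists z, F z = j).
  move: bj; rewrite /b (_ : [set z | F z = j] = set0) ?measure0 ?ltxx//.
  by apply/seteqP; split => // z /= zj; apply: nz; exists z.
have mdist k := @measurable_distr_powR R d p (x k).
have mwE : measurable_fun setT (fun z => (w z)%:E) by exact/measurable_EFinP.
have dist0 y (z : T) : (0 <= (eucl_dist y z `^ p)%:E)%E by rewrite lee_fin powR_ge0.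
pose cI (k : 'I_N) j := (\int[mu]_(z in [set z | F z = j]) (eucl_dist (x k) z `^ p)%:E)%E.
pose vI j := (\int[mu]_(z in [set z | F z = j]) (w z)%:E)%E.
have vI0 j : (0 <= vI j)%E by apply: integral_ge0 => z _; rewrite lee_fin.
have cI0 k j : (0 <= cI k j)%E by apply: integral_ge0 => z _.
have vIfin j : vI j \is a fin_num.
  rewrite ge0_fin_numE//; apply: le_lt_trans wfin.
  by apply: ge0_subset_integral => // z _; rewrite lee_fin.
have cIle k j : (cI k j <= (w (x k) * b j)%:E + vI j)%E.
  rewrite EFinM -bE -integral_cst// -ge0_integralD//=; last 3 first.
  - by move=> z _; rewrite lee_fin.
  - by move=> z _; rewrite lee_fin.
  - exact: measurable_funTS.
  apply: ge0_le_integral => //; [exact: measurable_funTS| |].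
  - by apply: emeasurable_funD => //; exact: measurable_funTS.
  - by move=> z _; rewrite -EFinD lee_fin.
have cIfin k j : cI k j \is a fin_num.
  rewrite ge0_fin_numE//; apply: (le_lt_trans (cIle k j)).
  by rewrite lte_add_pinfty// ?ltry// -ge0_fin_numE.
(* Means over the cell. For a cell of mass 0 they are 0 by the convention on division, and the
   integrals vanish too. *)
pose c k j := fine (cI k j) / b j; pose v j := fine (vI j) / b j.
have null j : b j = 0 -> mu [set z | F z = j] = 0%E by move=> bj; rewrite bE bj.
have cE k j : cI k j = (c k j * b j)%:E.
  have [bj|bj] := eqVneq (b j) 0; last by rewrite /c divfK// fineK.
  rewrite bj mulr0; apply: null_set_integral => //; [|exact: null].
  exact: measurable_funTS.
have vE j : vI j = (b j * v j)%:E.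
  have [bj|bj] := eqVneq (b j) 0; last by rewrite mulrC /v divfK// fineK.
  rewrite bj mul0r; apply: null_set_integral => //; [|exact: null].
  exact: measurable_funTS.
have sumb (A : set T) (P : pred J) : measurable A ->
    (forall z, A z <-> P (F z)) -> \sum_(j | P j) b j = fine (mu A).
  move=> mA AP; rewrite (measure_partition mF mu mA) -sum_fine; last first.
    by move=> j _; rewrite fin_num_measure//; exact: measurableI.
  rewrite big_mkcond; apply: eq_bigr => j _; case: ifP => Pj.
    congr (fine (mu _)); apply/seteqP; split => z /=; last by case.
    by move=> zj; split => //; apply/AP; rewrite zj.
  rewrite (_ : A `&` _ = set0) ?measure0//; apply/seteqP; split => // z /= [/AP Pz zj].
  by rewrite zj Pj in Pz.
have bT : \sum_(k < N) N%:R^-1 = \sum_j b j :> R.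
  rewrite (sumb setT xpredT)// probability_setT/= sumr_const card_ord.
  by rewrite -[LHS]mulr_natl divff// pnatr_eq0 -lt0n.
have LL n : (n < B)%N -> (L n <= Lmax)%N.
  by move=> nB; exact: (leq_bigmax (Ordinal nB)).
have [|||||||||||m [m0 mr ms mc]] := @block_matching R 'I_N J Lab
    (fun l k => lev l (x k)) (fun l j => lev l (rep j))
    (fun=> N%:R^-1) b c B (fun k => minn (blk (x k)) B) (fun j => j.1) L D V
    (fun k => w (x k)) v => //.
- by move=> j; rewrite divr_ge0// fine_ge0.
- by move=> l i j; exact: nest.
- move=> n l i j nB lL pi qj fg bj; have [z0 z0j] := bgt _ bj.
  rewrite ler_pdivrMr// -lee_fin fineK// EFinM -bE -integral_cst//.
  apply: ge0_le_integral => //; [exact: measurable_funTS|] => z /= zj.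
  have [H1 H2] := FD z (rep j) (etrans zj (esym (repP _ _ z0j))).
  have H3 : minn (blk z) B = n by rewrite -F1 zj.
  rewrite lee_fin; apply: (HD n l) => //; [lia|lia|].
  by rewrite fg H2// (leq_trans lL)// LL.
- move=> i j bj; rewrite ler_pdivrMr// mulrDl /v divfK ?gt_eqF// -lee_fin fineK//.
  by rewrite EFinD fineK.
- move=> k H; have {}H : (blk (x k) < B)%N by move: H; lia.
  by rewrite (minn_idPl (ltnW H)) HV.
- move=> j jB; have [bj|bj] := eqVneq (b j) 0; first by rewrite /v bj invr0 mulr0.
  rewrite ler_pdivrMr ?lt_neqAle 1?eq_sym ?bj ?b0// -lee_fin fineK// EFinM -bE -integral_cst//.
  apply: ge0_le_integral => //;
    [by move=> z _; rewrite lee_fin|exact: measurable_funTS|] => z /= zj.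
  have H3 : minn (blk z) B = j.1 by rewrite -F1 zj.
  have H4 : blk z = j.1 by move: jB H3 => /=; lia.
  by rewrite lee_fin -H4 HV// H4.
have := transport_cost_le_matching N0 mF m0 mr ms cE.
move=> /le_trans; apply.
have vout : ((\sum_(j : J | (B <= j.1)%N) b j * v j)%:E <=
    \int[mu]_(z in [set z | (B <= blk z)%N]) (w z)%:E)%E.
  rewrite integral_mkcond (ge0_integral_partition mF)//=; last 2 first.
  - apply/(measurable_restrictT _ (measurable_blk_ge B)); exact: measurable_funTS.
  - by move=> z; apply: erestrict_ge0 => y _; rewrite lee_fin.
  rewrite -sumEFin big_mkcond; apply: lee_sum => j _; case: ifP => jB.
    rewrite -vE /vI le_eqVlt; apply/orP; left; apply/eqP; apply: eq_integral => z.
    rewrite inE /= => zj; rewrite patchE mem_set//=.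
    by have := F1 z; rewrite zj; lia.
  by apply: integral_ge0 => z _; apply: erestrict_ge0 => y _; rewrite lee_fin.
apply: le_trans (leeD (lexx _) vout); rewrite -EFinD lee_fin.
apply: (le_trans mc); rewrite lerD2r; apply: lerD; last first.
  by rewrite le_eqVlt; apply/orP; left; apply/eqP; apply: eq_bigl => k; lia.
apply: ler_sum => n _.
have eqn k : (minn (blk (x k)) B == n) = (blk (x k) == n).
  by have := ltn_ord n; lia.
have discE l : (l <= L n)%N ->
    \sum_(h : Lab l) `|\sum_(i < N | (minn (blk (x i)) B == n) && (lev l (x i) == h)) N%:R^-1 -
       \sum_(j : J | (j.1 == n :> nat) && (lev l (rep j) == h)) b j| =
    discrepancy mu N x n l.
  move=> lL; apply: eq_bigr => h _; congr `|_ - _|.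
    by apply: eq_bigl => k; rewrite eqn.
  apply: sumb.
    by rewrite (_ : [set z | _] = [set z | blk z = n] `&` [set z | lev l z = h])//;
      exact: measurableI.
  move=> z /=; have [_ H2] := FD _ _ (repP z _ erefl).
  have H1 := F1 z; rewrite /= in H1.
  rewrite H2 ?(leq_trans lL) ?LL// H1; have := ltn_ord n => nB.
  split; first by move=> [zn ->]; rewrite eqxx andbT; lia.
  by move=> /andP[/eqP H /eqP ->]; split => //; lia.
rewrite discE//; apply: lerD => //; apply: lerD; last first.
  by apply: ler_sum => l _; rewrite discE.
rewrite le_eqVlt; apply/orP; left; apply/eqP; congr (_ * _); apply: sumb => // z.
rewrite F1; have nB := ltn_ord n; split => /= [zn|/eqP zn]; last by lia.
by apply/eqP; lia.
Qed.

End multiscale.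

(** * Dyadic annuli and their cells *)

Section dyadic.
Context (R : realType) (d : nat).
Local Notation T := (d.-tuple R).

Lemma annulus_exists (z : T) : exists n, eucl_norm z <= 2 ^+ n.
Proof.
exists (Num.truncn (eucl_norm z)).+1; apply: ltW.
apply: (lt_le_trans (truncnS_gt _)); rewrite -natrX ler_nat.
by rewrite ltnW// ltn_expl.
Qed.

(* [annulus z = 0] when [|z| <= 1], and [n > 0] when [2 ^ (n - 1) < |z| <= 2 ^ n]. *)
Definition annulus (z : T) : nat := ex_minn (annulus_exists z).

Lemma annulus_le z n : (annulus z <= n)%N = (eucl_norm z <= 2 ^+ n).
Proof.
rewrite /annulus; case: ex_minnP => m zm Hm; apply/idP/idP; last exact: Hm.
by move=> mn; apply: (le_trans zm); rewrite ler_weXn2l// ler1n.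
Qed.

Lemma annulus_gt z n : (n < annulus z)%N = (2 ^+ n < eucl_norm z).
Proof. by rewrite ltnNge annulus_le ltNge. Qed.

Lemma measurable_norm_le (r : R) : measurable [set z : T | eucl_norm z <= r].
Proof.
have := @measurable_fun_ler _ _ _ setT _ (cst r) (@measurable_eucl_norm R d)
  (@measurable_cst _ _ _ _ _ _) measurableT [set true].
by rewrite setTI; apply.
Qed.

Lemma measurable_annulus n : measurable [set z | annulus z = n].
Proof.
have mle k : measurable [set z | (annulus z <= k)%N].
  rewrite (_ : [set z | _] = [set z | eucl_norm z <= 2 ^+ k]).
    exact: measurable_norm_le.
  by apply/seteqP; split => z /=; rewrite annulus_le.
case: n => [|n].
  rewrite (_ : [set z | _] = [set z | (annulus z <= 0)%N])//.
  by apply/seteqP; split => z /=; lia.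
rewrite (_ : [set z | _] = [set z | (annulus z <= n.+1)%N] `\` [set z | (annulus z <= n)%N]).
  exact: measurableD.
by apply/seteqP; split => z /=; [move=> ->; split => //; lia|move=> [] ? /negP; lia].
Qed.

Lemma coord_le_norm (z : T) i : `|tnth z i| <= eucl_norm z.
Proof.
rewrite -sqrtr_sqr ler_wsqrtr// (bigD1 i)//= lerDl.
by apply: sumr_ge0 => j _; exact: sqr_ge0.
Qed.

(** Coordinates are brought to [-1, 1] by the outer radius 2^n of the annulus, then to [0, 2^(l+1)];
    their integer parts number a grid of cubes of side 2^(n-l). *)
Definition scaled (l : nat) (z : T) (i : 'I_d) : R :=
  2 ^+ l * (tnth z i / 2 ^+ annulus z + 1).

Lemma scaled_ge0 l z i : 0 <= scaled l z i.
Proof.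
rewrite mulr_ge0 ?exprn_ge0// -lerBlDr sub0r ler_pdivlMr ?exprn_gt0// mulN1r.
have : eucl_norm z <= 2 ^+ annulus z by rewrite -annulus_le.
by move=> /(le_trans (coord_le_norm z i)); rewrite ler_norml => /andP[].
Qed.

Lemma scaled_trunc_lt l z i : (Num.truncn (scaled l z i) < (2 ^ l.+1).+1)%N.
Proof.
rewrite ltnS -(ler_nat R); apply: (le_trans (_ : _ <= scaled l z i)).
  by rewrite truncn_le scaled_ge0.
rewrite natrX exprSr ler_pM2l ?exprn_gt0// -lerBrDr.
rewrite (_ : 2 - 1 = 1 :> R); last by rewrite -addrA subrr addr0.
rewrite ler_pdivrMr ?exprn_gt0// mul1r.
have : eucl_norm z <= 2 ^+ annulus z by rewrite -annulus_le.
by move=> /(le_trans (coord_le_norm z i)); rewrite ler_norml => /andP[].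
Qed.

(** The integer part 2^(l+1) does occur, for a coordinate equal to 2^n, whence one value more than
    2^(l+1). *)
Definition cell_label (l : nat) : finType := {ffun 'I_d -> 'I_(2 ^ l.+1).+1}.

Definition cell (l : nat) (z : T) : cell_label l :=
  [ffun i => inord (Num.truncn (scaled l z i))].

Lemma cellP l z (h : cell_label l) : cell l z = h <->
  forall i, (h i)%:R <= scaled l z i < (h i).+1%:R.
Proof.
split=> [<- i|H].
  rewrite /cell ffunE inordK ?scaled_trunc_lt//.
  by rewrite truncn_le scaled_ge0 truncnS_gt.
apply/ffunP => i; rewrite ffunE; apply: val_inj; rewrite /= inordK ?scaled_trunc_lt//.
exact: truncn_def.
Qed.

(** The scaled coordinate doubles from one level to the next, and the integer part of v is half that
    of 2 v, rounded down. *)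
Lemma cell_nested l y z : cell l.+1 y = cell l.+1 z -> cell l y = cell l z.
Proof.
have E u i : (cell l u i : nat) = (cell l.+1 u i)./2.
  rewrite /cell !ffunE !inordK ?scaled_trunc_lt//.
  set v := scaled l u i.
  have -> : scaled l.+1 u i = 2 * v by rewrite /v /scaled exprS mulrA.
  have v0 : 0 <= v by exact: scaled_ge0.
  apply: truncn_def; have v2 : 0 <= 2 * v by rewrite mulr_ge0.
  have := truncn_itv v2; set k := Num.truncn _ => /andP[k1 k2].
  have kE : k = (k./2 * 2 + odd k)%N by rewrite muln2 addnC odd_double_half.
  apply/andP; split.
    rewrite -(ler_pM2l (ltr0Sn R 1)); apply: le_trans k1.
    by rewrite -natrM ler_nat; lia.
  rewrite -(ltr_pM2l (ltr0Sn R 1)); apply: (lt_le_trans k2).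
  by rewrite -natrM ler_nat; lia.
by move=> yz; apply/ffunP => i; apply: val_inj; rewrite /= !E yz.
Qed.

Lemma measurable_cell l h : measurable [set z | cell l z = h].
Proof.
pose G n i := [set z : T | (h i)%:R <= 2 ^+ l * (tnth z i / 2 ^+ n + 1) < (h i).+1%:R].
have -> : [set z | cell l z = h] =
    \bigcup_n ([set z | annulus z = n] `&` \big[setI/setT]_(i < d) G n i).
  apply/seteqP; split => z /=.
    move=> /cellP H; exists (annulus z) => //; split => //.
    by rewrite -bigcap_seq => i _; exact: H.
  move=> [n _ [/= zn]]; rewrite -bigcap_seq => H; apply/cellP => i.
  by rewrite /scaled zn; apply: H; rewrite /= mem_index_enum.
apply: bigcupT_measurable => n; apply: measurableI; first exact: measurable_annulus.
apply: bigsetI_measurable => i _.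
pose s (z : T) := 2 ^+ l * (tnth z i / 2 ^+ n + 1).
have ms : measurable_fun setT s.
  apply: measurable_funM => //; apply: measurable_funD => //.
  by apply: measurable_funM => //; exact: measurable_tnth.
rewrite (_ : G n i = s @^-1` `[(h i)%:R, (h i).+1%:R[).
  by rewrite -[X in measurable X]setTI; exact: ms.
by apply/seteqP; split => z /=; rewrite in_itv.
Qed.

Lemma cell_dist l (y z : T) : annulus y = annulus z -> cell l y = cell l z ->
  eucl_dist y z <= d%:R * (2 ^+ annulus z / 2 ^+ l).
Proof.
move=> yz /cellP H; have Hz := (cellP z (cell l z)).1 erefl.
apply: eucl_dist_coord; first by rewrite divr_gt0// exprn_gt0.
move=> i; have := H i; have := Hz i; rewrite /scaled yz.
set a := 2 ^+ annulus z; set b := 2 ^+ l; set k := (_%:R : R).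
have a0 : 0 < a by rewrite exprn_gt0.
have b0 : 0 < b by rewrite exprn_gt0.
rewrite -natr1 => /andP[z1 z2] /andP[y1 y2].
rewrite ltr_pdivlMr// -{1}(gtr0_norm b0) -normrM -(ltr_pM2r (_ : 0 < a^-1)) ?invr_gt0//.
rewrite divff ?gt_eqF// -{1}(gtr0_norm (_ : 0 < a^-1)) ?invr_gt0// -normrM.
rewrite (_ : (_ - _) * b / a = b * (tnth y i / a + 1) - b * (tnth z i / a + 1)); last by ring.
by rewrite ltr_norml; apply/andP; split; lra.
Qed.

Lemma card_cell_label l : (#|cell_label l| <= (4 * 2 ^ l) ^ d)%N.
Proof.
rewrite card_ffun !card_ord; case: (d) => // n; rewrite leq_exp2r//.
by rewrite expnS; have := expn_gt0 2 l; lia.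
Qed.

Lemma eucl_norm_ge0 (z : T) : 0 <= eucl_norm z.
Proof. exact: sqrtr_ge0. Qed.

Lemma eucl_norm0E (z : T) : eucl_dist [tuple 0 | i < d] z = eucl_norm z /\
  eucl_dist z [tuple 0 | i < d] = eucl_norm z.
Proof.
split; congr Num.sqrt; apply: eq_bigr => i _; rewrite tnth_mktuple.
  by rewrite sub0r sqrrN.
by rewrite subr0.
Qed.

(** Comparison through the origin with eta = 1, which treats p < 1 and p >= 1 alike. *)
Lemma dist_le_norms (p : R) : 0 < p -> exists2 K : R, 0 < K & forall y z : T,
  eucl_dist y z `^ p <= K * eucl_norm y `^ p + K * eucl_norm z `^ p.
Proof.
move=> p0; have [K K0 HK] := eucl_dist_powR_le d p0 (@ltr01 R).
exists (Num.max K ((1 + 1) `^ p)); first by rewrite lt_max K0.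
move=> y z; apply: (le_trans (HK [tuple 0 | i < d] y z)).
rewrite (eucl_norm0E z).1 (eucl_norm0E y).2 addrC; apply: lerD.
  by rewrite ler_wpM2r ?powR_ge0// le_max lexx.
by rewrite ler_wpM2r ?powR_ge0// le_max lexx orbT.
Qed.

(** Named so that one [K], fixed before the moment data, serves both in this estimate and in the
    thresholds x / (2 K) for the tail mean. *)
Definition dyadic_estimate (p K : R) : Prop :=
  forall N (x : nat -> T) (mu : probability T R) B (L : nat -> nat), (0 < N)%N ->
  (\int[mu]_z (eucl_norm z `^ p)%:E < +oo)%E ->
  (transport_cost p (empirical N x) mu <=
   (K * (\sum_(n < B) (2 `^ p) ^+ n *
           ((2 `^ p) ^- L n * fine (mu [set z | annulus z = n]) +
            \sum_(l < (L n).+1) (2 `^ p) ^- l * discrepancy cell annulus mu N x n l) +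
         \sum_(k < N | (B <= annulus (x k))%N) N%:R^-1 * eucl_norm (x k) `^ p))%:E +
   K%:E * \int[mu]_(z in [set z | (B <= annulus z)%N]) (eucl_norm z `^ p)%:E)%E.

Lemma transport_cost_dyadic (p : R) : 0 < p -> exists2 K : R, 0 < K & dyadic_estimate p K.
Proof.
move=> p0; have [K0 K00 HK0] := dist_le_norms p0.
pose c := 2 `^ p : R; have c1 : 1 < c.
  have : 1 `^ p < 2 `^ p by apply: gt0_ltr_powR; rewrite ?nnegrE ?ltr1n.
  by rewrite powR1.
have c0 : 0 < c by exact: lt_trans c1.
have cn n : (2 ^+ n) `^ p = c ^+ n.
  by rewrite -powR_mulrn// -powRrM mulrC powRrM powR_mulrn ?powR_ge0.
(* The factor [c] pays for an index shift: what level l + 1 leaves over travels inside cells of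
   level l, and c^(-l) is c times c^(-(l+1)). *)
pose K := Num.max K0 (d%:R `^ p * c).
have K0K : K0 <= K by rewrite le_max lexx.
have dK : d%:R `^ p <= K.
  by rewrite le_max; apply/orP; right; rewrite ler_peMr ?powR_ge0// ltW.
have Kgt0 : 0 < K by exact: lt_le_trans K0K.
exists K => // N x mu B L N0 fin.
have mw : measurable_fun setT (fun z : T => eucl_norm z `^ p).
  exact: (measurableT_comp (measurable_powR p) (@measurable_eucl_norm R d)).
have mwE : measurable_fun setT (fun z : T => (eucl_norm z `^ p)%:E).
  exact/measurable_EFinP.
pose w (z : T) := K * eucl_norm z `^ p : R.
have disc0 n l : 0 <= discrepancy cell annulus mu N x n l by apply: sumr_ge0.
have Dge0 n l : 0 <= d%:R `^ p * (c ^+ n / c ^+ l).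
  by rewrite mulr_ge0 ?powR_ge0// divr_ge0// exprn_ge0// ltW.
have wint (A : set T) : measurable A -> (\int[mu]_(z in A) (w z)%:E =
   K%:E * \int[mu]_(z in A) (eucl_norm z `^ p)%:E)%E.
  move=> mA; under eq_integral do rewrite EFinM.
  rewrite ge0_integralZl//; first exact: measurable_funTS.
  - by move=> z _; rewrite lee_fin powR_ge0.
  - by rewrite lee_fin ltW.
apply: le_trans.
  apply: (@transport_cost_multiscale R d cell_label cell annulus measurable_cell
    measurable_annulus cell_nested p N x mu w B L
    (fun n l => d%:R `^ p * (c ^+ n / c ^+ l)) (fun n => K * c ^+ n)) => //.
  - exact: measurable_funM.
  - by move=> z; rewrite mulr_ge0 ?powR_ge0// ltW.
  - by rewrite wint// lte_mul_pinfty// lee_fin ltW.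
  - by move=> n; rewrite mulr_ge0 ?exprn_ge0// ltW.
  - move=> n l y z nB lL yn zn yz.
    have yzl := cell_dist (etrans yn (esym zn)) yz.
    rewrite -[X in _ * (X / _)]cn -[X in _ * (_ / X)]cn -powRN.
    rewrite -(powR_inv1 (exprn_ge0 l (ler0n R 2))) in yzl.
    rewrite -[X in _ * (_ * X)](_ : ((2 ^+ l) `^ (-1)) `^ p = _); last first.
      by rewrite -powRrM mulN1r.
    rewrite -!powRM ?powR_ge0 ?mulr_ge0 ?powR_ge0//.
    by rewrite -zn ge0_ler_powR ?nnegrE ?eucl_dist_ge0 ?mulr_ge0 ?powR_ge0// ltW.
  - move=> y z; apply: (le_trans (HK0 y z)).
    by apply: lerD; rewrite ler_wpM2r ?powR_ge0.
  - move=> z _; rewrite /w ler_pM2l// -cn ge0_ler_powR ?nnegrE ?eucl_norm_ge0 ?(ltW p0)//.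
    by rewrite -annulus_le.
rewrite wint; last exact: measurable_blk_ge measurable_annulus B.
apply: leeD => //; rewrite lee_fin mulrDr; apply: lerD; last first.
  by rewrite mulr_sumr; apply: ler_sum => k _; rewrite /w mulrCA.
rewrite mulr_sumr; apply: ler_sum => n _.
rewrite [leRHS]mulrCA -[leLHS]addrA mulrDr mulrDr; apply: lerD.
  rewrite mulrCA -!mulrA ler_wpM2r// ?mulr_ge0 ?fine_ge0 ?invr_ge0 ?exprn_ge0 ?(ltW c0)//.
rewrite big_ord_recl expr0 invr1 mul1r !mulrDr [leRHS]addrC.
apply: lerD; last by rewrite mulrCA mulrA.
rewrite !mulr_sumr; apply: ler_sum => l _.
rewrite lift0 -/c -mulrA.
set D1 := discrepancy _ _ _ _ _ _ _.
have cl0 : c ^+ l != 0 by rewrite expf_neq0// gt_eqF.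
have -> : c ^+ n * (K * (c ^- l.+1 * D1)) = K / c * (c ^+ n / c ^+ l * D1).
  by rewrite exprS; field; rewrite cl0 gt_eqF.
rewrite ler_wpM2r//; last by rewrite ler_pdivlMr// le_max lexx orbT.
by rewrite !mulr_ge0 ?invr_ge0 ?exprn_ge0// ?disc0// ltW.
Qed.

End dyadic.

(** * Chernoff bounds for the discrepancies *)

Section independence.
Context (R : realType) (disp disp' : measure_display).
Context (Omega : measurableType disp) (T : measurableType disp').
Variables (P : probability Omega R) (mu : probability T R).

Import HBNNSimple.

(** [G] stands for the factors carried by the other variables and [K] for their expectation. The
    factorisation is known for indicators and extends to [g] by simple functions and monotone
    convergence. *)
Lemma integral_weighted_distribution (X : {RV P >-> T}) (G : Omega -> R) (K : R)
    (g : T -> R) :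
  measurable_fun setT G -> (forall w, 0 <= G w) -> 0 <= K ->
  (forall A, measurable A ->
     (\int[P]_w (G w * \1_A (X w))%:E = K%:E * mu A)%E) ->
  measurable_fun setT g -> (forall z, 0 <= g z) ->
  (\int[P]_w (G w * g (X w))%:E = K%:E * \int[mu]_z (g z)%:E)%E.
Proof.
move=> mG G0 K0 GA mg g0.
have mgE : measurable_fun setT (EFin \o g) by exact/measurable_EFinP.
pose f_ := nnsfun_approx measurableT mgE.
have mX : measurable_fun setT X by [].
have mfX n : measurable_fun setT (f_ n \o X) by exact: measurableT_comp.
have step n : (\int[P]_w (G w * f_ n (X w))%:E = K%:E * \int[mu]_z (f_ n z)%:E)%E.
  set h := f_ n.
  transitivity (\sum_(k \in range h) \int[P]_w (k * (G w * \1_(h @^-1` [set k]) (X w)))%:E)%E.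
    rewrite -ge0_integral_fsum//.
    - apply: eq_integral => w _; rewrite fsumEFin//; congr EFin.
      rewrite (fimfunE h) !fsbig_finite//= big_distrr/=.
      by apply: eq_bigr => k _; rewrite mulrCA.
    - move=> k; apply/measurable_EFinP; apply: measurable_funM => //.
      apply: measurable_funM => //; apply: measurableT_comp => //.
    - move=> k w _; rewrite lee_fin.
      have [k0|k0] := leP 0 k; first by rewrite !mulr_ge0.
      by rewrite preimage_nnfun0// indic0/= !mulr0.
  transitivity (\sum_(k \in range h) (K%:E * \int[mu]_z (k * \1_(h @^-1` [set k]) z)%:E))%E.
    apply: eq_fsbigr => k /[!inE] kh.
    have k0 : 0 <= k by case: kh => z _ <-.
    under eq_integral do rewrite EFinM.
    rewrite ge0_integralZl//; last 2 first.
      apply/measurable_EFinP; apply: measurable_funM => //; exact: measurableT_comp.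
      by move=> w _; rewrite lee_fin mulr_ge0.
    rewrite GA//; under [in RHS]eq_integral do rewrite EFinM.
    rewrite ge0_integralZl//; last exact/measurable_EFinP.
    by rewrite integral_indic// setIT muleCA.
  rewrite -ge0_mule_fsumr; last first.
    move=> k; apply: integral_ge0 => z _; rewrite lee_fin.
    have [k0|k0] := leP 0 k; first by rewrite !mulr_ge0.
    by rewrite preimage_nnfun0// indic0/= !mulr0.
  congr (_ * _)%E; rewrite -ge0_integral_fsum//.
  - by apply: eq_integral => z _; rewrite fsumEFin// -(fimfunE h).
  - by move=> k; apply/measurable_EFinP; apply: measurable_funM.
  - move=> k w _; rewrite lee_fin.
    have [k0|k0] := leP 0 k; first by rewrite !mulr_ge0.
    by rewrite preimage_nnfun0// indic0/= !mulr0.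
have fg z : (f_ n z)%:E @[n --> \oo] --> (g z)%:E.
  by apply: cvg_nnsfun_approx => // y _; rewrite lee_fin.
have nd z a b : (a <= b)%N -> f_ a z <= f_ b z.
  by move=> ab; exact/lefP/nd_nnsfun_approx.
transitivity (limn (fun n => \int[P]_w (G w * f_ n (X w))%:E)%E).
  rewrite -monotone_convergence//.
  - apply: eq_integral => w _; apply/esym/cvg_lim => //.
    rewrite (_ : (fun n => _) = (fun n => (G w)%:E * (f_ n (X w))%:E)%E); last exact/funext.
    have H : ((G w)%:E * (f_ n (X w))%:E)%E @[n --> \oo] --> ((G w)%:E * (g (X w))%:E)%E.
      by apply: cvgeZl => //; exact: fg.
    exact: H.
  - by move=> n; apply/measurable_EFinP/measurable_funM => //; exact: mfX.
  - by move=> n w _; rewrite lee_fin mulr_ge0.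
  - by move=> w _ a b ab; rewrite lee_fin ler_wpM2l// nd.
rewrite (_ : (\int[mu]_z (g z)%:E)%E = limn (fun n => \int[mu]_z (f_ n z)%:E)%E); last first.
  rewrite -monotone_convergence//.
  - by apply: eq_integral => w _; apply/esym/cvg_lim => //; exact: fg.
  - by move=> n; exact/measurable_EFinP.
  - by move=> n w _; rewrite lee_fin.
  - by move=> w _ a b ab; rewrite lee_fin nd.
rewrite -limeMl//; last first.
  apply: ereal_nondecreasing_is_cvgn => a b ab; apply: ge0_le_integral => //.
  - by move=> z _; rewrite lee_fin.
  - exact/measurable_EFinP.
  - exact/measurable_EFinP.
  - by move=> z _; rewrite lee_fin nd.
by congr (limn _); apply/funext => n; rewrite step.
Qed.

Variable X : nat -> {RV P >-> T}.
Hypothesis iidX : iid mu X.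

Lemma iid_prod_indic (A : nat -> set T) m : (forall k, measurable (A k)) ->
  (\int[P]_w (\prod_(k < m) \1_(A k) (X k w))%:E = (\prod_(k < m) fine (mu (A k)))%:E)%E.
Proof.
move=> mA; have [ind dist] := iidX.
pose J := [fset k in iota 0 m]%fset.
have JE k : (k \in J) = (k < m)%N by rewrite !inE mem_iota.
have mX k : measurable (X k @^-1` A k) by exact: measurable_funPTI.
have fA k : mu (A k) = (fine (mu (A k)))%:E by rewrite fineK// fin_num_measure.
transitivity (\int[P]_w (\1_(\bigcap_(k in [set` J]) (X k @^-1` A k)) w)%:E)%E.
  apply: eq_integral => w _; congr EFin; rewrite indicE.
  have [wJ|wJ] := boolP (w \in _).
    rewrite big1// => k _; rewrite indicE mem_set//.
    by move: wJ; rewrite inE => /(_ k); apply; rewrite /= JE.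
  have [k [kJ wk]] : exists k, (k \in J) /\ ~ A k (X k w).
    apply/not_existsP => H; case/negP: wJ; apply/mem_set => k /= kJ.
    by apply: contrapT => wk; apply: (H k).
  rewrite JE in kJ; rewrite (bigD1 (Ordinal kJ))//= indicE.
  by rewrite (negbTE (_ : X k w \notin A k)) ?mul0r// notin_setE.
have mI : measurable (\bigcap_(k in [set` J]) (X k @^-1` A k)).
  by rewrite bigcap_fset; apply: bigsetI_measurable.
rewrite integral_indic// setIT; apply: (etrans (ind J A (fun k _ => mA k))).
rewrite (perm_big (iota 0 m)); last first.
  by apply: uniq_perm; [exact: fset_uniq|exact: iota_uniq|move=> k; rewrite JE mem_iota].
rewrite -[X in iota 0 X]subn0 big_mkord.
elim/big_ind2 : _ => [//|x1 x2 y1 y2 -> -> //|k _].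
by rewrite -fA -(dist k _ (mA k)).
Qed.

(** Independence is given for events. Indicator factors are turned into factors [g] one at a time,
    all other factors serving as the weight [G]. *)
Lemma iid_expectation_prod (g : T -> R) (e : R) N :
  measurable_fun setT g -> (forall z, 0 <= g z) ->
  (\int[mu]_z (g z)%:E = e%:E)%E ->
  (\int[P]_w (\prod_(k < N) g (X k w))%:E = (e ^+ N)%:E)%E.
Proof.
move=> mg g0 ge.
have e0 : 0 <= e by rewrite -lee_fin -ge; apply: integral_ge0 => z _; rewrite lee_fin.
(* The first [n] factors are already functions, the next [m] are still indicators. *)
suff H n m (A : nat -> set T) : (forall k, measurable (A k)) ->
   (\int[P]_w (\prod_(k < n) g (X k w) * \prod_(k < m) \1_(A k) (X (n + k)%N w))%:E =
   (e ^+ n * \prod_(k < m) fine (mu (A k)))%:E)%E.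
  have := H N 0%N (fun=> setT) (fun=> measurableT).
  by rewrite big_ord0 mulr1 => <-; apply: eq_integral => w _; rewrite big_ord0 mulr1.
elim: n m A => [|n IH] m A mA.
  rewrite expr0 mul1r; apply: etrans (iid_prod_indic m mA).
  by apply: eq_integral => w _; rewrite big_ord0 mul1r.
pose G w := \prod_(k < n) g (X k w) * \prod_(k < m) \1_(A k) (X (n.+1 + k)%N w).
have mG : measurable_fun setT G.
  apply: measurable_funM; apply: measurable_prod => k _.
    by apply: (measurableT_comp mg).
  by apply: (measurableT_comp (measurable_indic (mA k))).
have fA B : measurable B -> mu B = (fine (mu B))%:E.
  by move=> mB; rewrite fineK// fin_num_measure.
have := @integral_weighted_distribution (X n) G
  (e ^+ n * \prod_(k < m) fine (mu (A k))) g mG.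
rewrite ge => H; rewrite exprSr mulrAC EFinM -H//.
- by apply: eq_integral => w _; rewrite big_ord_recr/= /G mulrAC.
- by move=> w; rewrite mulr_ge0// prodr_ge0// => k _; rewrite indicE.
- by rewrite mulr_ge0 ?exprn_ge0// prodr_ge0// => k _; rewrite fine_ge0.
- move=> B mB; pose A' k := if k is k'.+1 then A k' else B.
  have := IH m.+1 A'; rewrite big_ord_recl/= fA// -EFinM mulrAC -mulrA => <-.
    apply: eq_integral => w _; congr EFin; rewrite big_ord_recl/= addn0 /G.
    rewrite -mulrA; congr (_ * _); rewrite mulrC; congr (_ * _).
    by apply: eq_bigr => k _; rewrite /= /bump/= add1n addSnnS.
  by case.
Qed.

(** Exponential Markov inequality; the usual free parameter is part of [Z]. *)
Lemma iid_chernoff (Z : T -> R) (v u : R) N : measurable_fun setT Z ->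
  (\int[mu]_z (expR (Z z))%:E <= (expR v)%:E)%E ->
  (P [set w | (u <= \sum_(k < N) Z (X k w))%R] <= (expR (N%:R * v - u))%:E)%E.
Proof.
move=> mZ Zv.
have mS : measurable_fun setT (fun w => \sum_(k < N) Z (X k w)).
  by apply: measurable_sum => k; exact: (measurableT_comp mZ).
have mE : measurable [set w | u <= \sum_(k < N) Z (X k w)].
  have := @measurable_fun_ler _ _ _ setT (cst u) _ (@measurable_cst _ _ _ _ _ _) mS
    measurableT [set true].
  by rewrite setTI; apply.
set E := [set w | _] in mE *.
set I := (\int[mu]_z _)%E in Zv.
have I0 : (0 <= I)%E by apply: integral_ge0 => z _; rewrite lee_fin expR_ge0.
have Ifin : I = (fine I)%:E.
  by rewrite fineK// ge0_fin_numE// (le_lt_trans Zv)// ltry.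
have := @iid_expectation_prod (expR \o Z) (fine I) N.
move=> /(_ (measurableT_comp (@measurable_expR R) mZ) (fun z => expR_ge0 _) Ifin) H.
have : ((expR u)%:E * P E <= (fine I ^+ N)%:E)%E.
  rewrite -H -[X in (X <= _)%E](_ : (\int[P]_w ((expR u)%:E * (\1_E w)%:E))%E = _); last first.
    rewrite ge0_integralZl//; first by rewrite integral_indic// setIT.
    exact/measurable_EFinP/measurable_indic.
  apply: ge0_le_integral => //.
  - by apply/measurable_EFinP/measurable_funM => //; exact: measurable_indic.
  - apply/measurable_EFinP; apply: measurable_prod => k _.
    by apply: (measurableT_comp (@measurable_expR R)); exact: (measurableT_comp mZ).
  - move=> w _; rewrite -EFinM lee_fin -expR_sum.
    rewrite indicE; have [wE|_] := boolP (w \in E); last by rewrite mulr0 expR_ge0.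
    by rewrite mulr1 ler_expR; move: wE; rewrite inE.
have PE : P E = (fine (P E))%:E by rewrite fineK// fin_num_measure.
rewrite PE -EFinM !lee_fin expRD expRN => HE.
rewrite ler_pdivlMr ?expR_gt0// mulrC; apply: (le_trans HE).
rewrite expRM_natl lerXn2r ?nnegrE ?expR_ge0 ?fine_ge0//.
by rewrite -lee_fin -Ifin.
Qed.

End independence.

Lemma measure_bigsetU_le d0 (S : measurableType d0) (R : realType)
    (mu : {measure set S -> \bar R}) (I : Type) (s : seq I) (E : I -> set S) :
  (forall i, measurable (E i)) ->
  (mu (\big[setU/set0]_(i <- s) E i) <= \sum_(i <- s) mu (E i))%E.
Proof.
move=> mE; elim: s => [|i s IH]; first by rewrite !big_nil measure0.
rewrite !big_cons; apply: (le_trans (measureU2 _ _ _)) => //.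
  by apply: bigsetU_measurable.
exact: leeD.
Qed.

Lemma measurable_finite_comp d0 (S : measurableType d0) (R : realType) (J : finType)
    (F : S -> J) (zeta : J -> R) : (forall j, measurable [set z | F z = j]) ->
  measurable_fun setT (fun z => zeta (F z)).
Proof.
move=> mF _ A mA; rewrite setTI.
rewrite (_ : _ @^-1` A = \big[setU/set0]_(j <- enum J | zeta j \in A) [set z | F z = j]).
  by apply: bigsetU_measurable => j _.
rewrite -bigcup_seq_cond; apply/seteqP; split => z /=.
  by move=> Az; exists (F z) => //=; rewrite mem_enum/= mem_set.
by move=> [j /= /andP[_]]; rewrite inE => Aj ->.
Qed.

Section concentration.
Context (R : realType) (disp disp' : measure_display).
Context (Omega : measurableType disp) (T : measurableType disp').
Variables (P : probability Omega R) (mu : probability T R).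
Variable X : nat -> {RV P >-> T}.
Hypothesis iidX : iid mu X.

(** From exp(-z) >= 1 - z, that is exp z <= 1 / (1 - z) for z < 1. *)
Lemma expR_le_quadratic (z : R) : z <= 2^-1 -> expR z <= 1 + z + 2 * z ^+ 2.
Proof.
move=> z2; have z1 : 0 < 1 - z by lra.
have H : expR z <= (1 - z)^-1.
  rewrite -[expR z]invrK lef_pV2 ?posrE ?invr_gt0 ?expR_gt0// -expRN.
  exact: expR_ge1Dx.
apply: (le_trans H); rewrite -[leLHS]mul1r ler_pdivrMr//.
have -> : (1 + z + 2 * z ^+ 2) * (1 - z) = 1 + z ^+ 2 * (1 - 2 * z) by ring.
by rewrite lerDl mulr_ge0 ?sqr_ge0//; lra.
Qed.

(** The logarithm of the exponential moment is at most the mean plus twice the second moment, by the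
    quadratic bound and 1 + s <= exp s. *)
Lemma finite_chernoff (J : finType) (F : T -> J) (r zeta : J -> R) (u : R) N :
  (forall j, measurable [set z | F z = j]) -> (forall j, zeta j <= 2^-1) ->
  (forall j, mu [set z | F z = j] = (r j)%:E) ->
  (P [set w | (u <= \sum_(k < N) zeta (F (X k w)))%R] <=
   (expR (N%:R * (\sum_j zeta j * r j + 2 * \sum_j zeta j ^+ 2 * r j) - u))%:E)%E.
Proof.
move=> mF z2 rE.
have r0 j : 0 <= r j by rewrite -lee_fin -rE.
have r1 : \sum_j r j = 1.
  apply: EFin_inj; rewrite -sumEFin -(@probability_setT _ _ _ mu).
  rewrite (measure_partition mF mu measurableT); apply: eq_bigr => j _.
  by rewrite setTI; apply/esym/rE.
have mZ := measurable_finite_comp zeta mF.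
apply: (iid_chernoff iidX _ _ mZ).
rewrite (ge0_integral_partition mF); last 2 first.
- by apply/measurable_EFinP; exact: measurableT_comp.
- by move=> z; rewrite lee_fin expR_ge0.
rewrite (eq_bigr (fun j => (expR (zeta j) * r j)%:E)); last first.
  move=> j _; rewrite EFinM -(rE j) -integral_cst//.
  by apply: eq_integral => z; rewrite inE => /= ->.
rewrite sumEFin lee_fin; apply: le_trans (expR_ge1Dx _).
rewrite -[X in X + _]r1 mulr_sumr -!big_split/=; apply: ler_sum => j _.
rewrite -[X in X + _]mul1r [X in _ * _ + (_ + X)]mulrA -!mulrDl ler_wpM2r// addrA.
exact: expR_le_quadratic.
Qed.

End concentration.

Section discrepancy_tail.
Context (R : realType) (d : nat).
Local Notation T := (d.-tuple R).
Context (disp : measure_display) (Omega : measurableType disp).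
Variables (P : probability Omega R) (mu : probability T R).
Variable X : nat -> {RV P >-> T}.
Hypothesis iidX : iid mu X.
Variables (Lab : nat -> finType) (lev : forall l, T -> Lab l) (blk : T -> nat).
Hypothesis mlev : forall l h, measurable [set z | lev l z = h].
Hypothesis mblk : forall n, measurable [set z | blk z = n].

(* Union bound over the [2 ^ #|Lab l|] ways of choosing the signs of the
   differences in the sum defining the discrepancy. *)
Lemma discrepancy_tail N n l (beta t : R) :
  (0 < N)%N -> 0 < beta -> fine (mu [set z | blk z = n]) <= beta ->
  0 <= t <= 2 * beta ->
  exists E : set Omega, [/\ measurable E,
    (P E <= (expR (#|Lab l|%:R - N%:R * t ^+ 2 / (8 * beta)))%:E)%E &
    forall w, t <= discrepancy lev blk mu N (fun k => X k w) n l -> E w].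
Proof.
move=> N0 b0 mub /andP[t0 t2].
have NR : 0 < N%:R :> R by rewrite ltr0n.
(* Minimiser of 2 lam^2 beta - lam t, with minimum -t^2 / (8 beta). The assumption t <= 2 beta keeps
   it below 1/2, the range of the quadratic bound. *)
pose lam := t / (4 * beta).
have lam0 : 0 <= lam by rewrite divr_ge0// mulr_ge0// ltW.
have lam2 : lam <= 2^-1.
  by rewrite ler_pdivrMr ?mulr_gt0//; lra.
(* Only membership in block [n] is kept, so that the pair takes finitely many values. *)
pose F z := (blk z == n, lev l z).
pose C h := [set z | blk z = n /\ lev l z = h].
have mF j : measurable [set z | F z = j].
  case: j => b h; rewrite (_ : [set z | _] = [set z | (blk z == n) = b] `&` [set z | lev l z = h]).
    apply: measurableI => //; case: b.
      by rewrite (_ : [set z | _] = [set z | blk z = n])//; apply/seteqP; split => z /= /eqP.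
    rewrite (_ : [set z | _] = ~` [set z | blk z = n]); first exact: measurableC.
    by apply/seteqP; split => z /=; [move=> /negbT/eqP|move=> /eqP/negbTE].
  by apply/seteqP; split => z /=; [move=> [<- <-]|move=> [<- <-]].
pose r j := fine (mu [set z | F z = j]).
have r0 j : 0 <= r j by rewrite fine_ge0.
have rE j : mu [set z | F z = j] = (r j)%:E by rewrite fineK// fin_num_measure.
have rC h : r (true, h) = fine (mu (C h)).
  rewrite /r; congr (fine (mu _)); apply/seteqP; split => z /=.
    by move=> [/eqP zn <-].
  by move=> [zn <-]; rewrite /F zn eqxx.
have rsum : \sum_h r (true, h) <= beta.
  apply: le_trans mub; rewrite le_eqVlt; apply/orP; left; apply/eqP.
  rewrite (measure_partition mF mu (mblk n)) -sum_fine; last first.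
    by move=> j _; rewrite fin_num_measure//; exact: measurableI.
  rewrite (eq_bigr (fun j : bool * Lab l =>
    fine (mu ([set z | blk z = n] `&` [set z | F z = (j.1, j.2)])))); last by move=> [].
  rewrite -(pair_bigA _ (fun b h => fine (mu ([set z | blk z = n] `&` [set z | F z = (b, h)]))))/=.
  rewrite big_bool [X in _ = _ + X]big1 ?addr0; last first.
    move=> h _; rewrite (_ : _ `&` _ = set0) ?measure0//.
    by apply/seteqP; split => // z /= [/eqP zn []]; rewrite zn.
  apply: eq_bigr => h _; congr (fine (mu _)); apply/seteqP; split => z /=; last by case.
  by move=> zh; split => //; case: zh => /eqP.
pose sg (b : bool) : R := (-1) ^+ b.
have sgle b : sg b <= 1 by case: b; rewrite /sg ?expr0// expr1; lra.
have sg2 b : sg b ^+ 2 = 1 by rewrite /sg sqrr_sign.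
pose zeta (s : {ffun Lab l -> bool}) (j : bool * Lab l) : R :=
  if j.1 then lam * sg (s j.2) else 0.
have zeta2 s j : zeta s j <= 2^-1.
  rewrite /zeta; case: ifP => // _.
  by apply: le_trans lam2; rewrite ler_piMr.
have zE s (G : bool -> Lab l -> R) : \sum_j zeta s j * G j.1 j.2 =
    lam * \sum_h sg (s h) * G true h.
  rewrite -(pair_bigA _ (fun b h => zeta s (b, h) * G b h))/= big_bool /=.
  rewrite [X in _ + X]big1 ?addr0; last by move=> h _; rewrite mul0r.
  by rewrite mulr_sumr; apply: eq_bigr => h _; rewrite mulrA.
have z2E s : \sum_j zeta s j ^+ 2 * r j <= lam ^+ 2 * beta.
  rewrite (eq_bigr (fun j => zeta s j * (zeta s j * r j))); last first.
    by move=> j _; rewrite expr2 mulrA.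
  rewrite (eq_bigr (fun j : bool * Lab l =>
      zeta s j * (zeta s (j.1, j.2) * r (j.1, j.2)))); last first.
    by move=> [].
  rewrite (zE s (fun b h => zeta s (b, h) * r (b, h))) /zeta/= expr2 -mulrA.
  rewrite ler_wpM2l//; apply: le_trans (ler_wpM2l lam0 rsum).
  rewrite mulr_sumr; apply: ler_sum => h _.
  have -> : sg (s h) * (lam * sg (s h) * r (true, h)) =
    lam * (sg (s h) ^+ 2 * r (true, h)) by ring.
  by rewrite sg2 mul1r.
pose m (s : {ffun Lab l -> bool}) := \sum_h sg (s h) * r (true, h).
pose E (s : {ffun Lab l -> bool}) :=
  [set w | N%:R * (lam * m s + lam * t) <= \sum_(k < N) zeta s (F (X k w))].
have PE s : (P (E s) <= (expR (- (N%:R * t ^+ 2 / (8 * beta))))%:E)%E.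
  apply: le_trans (finite_chernoff iidX _ N mF (zeta2 s) rE) _; rewrite lee_fin ler_expR.
  rewrite (eq_bigr (fun j : bool * Lab l => zeta s j * r (j.1, j.2))); last by move=> [].
  rewrite (zE s (fun b h => r (b, h))) -/(m s).
  have H := z2E s; set q := \sum_j _ in H *.
  apply: (@le_trans _ _ (N%:R * (2 * (lam ^+ 2 * beta) - lam * t))).
    rewrite -mulrBr ler_wpM2l ?ler0n//; lra.
  rewrite le_eqVlt; apply/orP; left; apply/eqP; rewrite /lam; field.
  by rewrite gt_eqF.
have mE s : measurable (E s).
  have mZ : measurable_fun setT (fun w => \sum_(k < N) zeta s (F (X k w))).
    apply: measurable_sum => k.
    exact: (measurableT_comp (measurable_finite_comp (zeta s) mF)).
  have := @measurable_fun_ler _ _ _ setT (cst (N%:R * (lam * m s + lam * t))) _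
    (@measurable_cst _ _ _ _ _ _) mZ measurableT [set true].
  by rewrite setTI; apply.
exists (\big[setU/set0]_(s : {ffun Lab l -> bool}) E s); split.
- by apply: bigsetU_measurable.
- apply: (@le_trans _ _ (\sum_(s : {ffun Lab l -> bool}) P (E s))%E).
    exact: measure_bigsetU_le.
  apply: (@le_trans _ _
    (\sum_(s : {ffun Lab l -> bool}) (expR (- (N%:R * t ^+ 2 / (8 * beta))))%:E)%E).
    exact: lee_sum.
  (* The number 2^#|Lab l| of sign patterns is absorbed by 2 <= exp 1. *)
  rewrite sumEFin lee_fin sumr_const card_ffun card_bool -[leLHS]mulr_natl expRD.
  rewrite ler_wpM2r ?expR_ge0// natrX -[X in expR X]mulr1 expRM_natl.
  rewrite lerXn2r ?nnegrE ?expR_ge0//.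
  by have := @expR_ge1Dx R 1; lra.
- move=> w tw.
  (* With the actual signs of the differences, the sum of absolute values becomes a linear statistic
     of the sample, to which one of the events [E s] applies. *)
  pose D h := \sum_(k < N | (blk (X k w) == n) && (lev l (X k w) == h)) N%:R^-1 - r (true, h) : R.
  pose s : {ffun Lab l -> bool} := [ffun h => D h < 0].
  rewrite -bigcup_seq; exists s; first by rewrite /= mem_index_enum.
  have DE h : sg (s h) * D h = `|D h|.
    rewrite /s ffunE /sg; have [Dh|Dh] := ltP (D h) 0.
      by rewrite expr1 mulN1r ltr0_norm.
    by rewrite expr0 mul1r ger0_norm.
  have empE : \sum_(k < N) zeta s (F (X k w)) = N%:R * (lam * (\sum_h `|D h| + m s)).
    rewrite -big_split/= (eq_bigr (fun h => sg (s h) *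
      \sum_(k < N | (blk (X k w) == n) && (lev l (X k w) == h)) N%:R^-1)); last first.
      by move=> h _; rewrite -DE -mulrDr subrK.
    rewrite !mulr_sumr.
    rewrite (eq_bigr (fun h => \sum_(k < N | (blk (X k w) == n) && (lev l (X k w) == h))
       lam * sg (s h))); last first.
      move=> h _; rewrite !mulr_sumr; apply: eq_bigr => k _.
      by field; rewrite gt_eqF.
    under [RHS]eq_bigr do rewrite big_mkcond.
    rewrite exchange_big/=; apply: eq_bigr => k _; rewrite /zeta /F/=.
    case: eqP => kn /=; last by rewrite big1.
    by rewrite -big_mkcond/= (big_pred1 (lev l (X k w)))// => h; rewrite eq_sym.
  rewrite /E/= empE ler_pM2l// -mulrDr ler_wpM2l// addrC lerD2r.
  apply: (le_trans tw); rewrite le_eqVlt; apply/orP; left; apply/eqP.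
  by apply: eq_bigr => h _; rewrite /D rC.
Qed.

End discrepancy_tail.

(** * The rate function *)

Section rate.
Context (R : realType).
Implicit Types (p x y z K : R) (d : nat).

Definition rate d p x : R :=
  if d%:R / 2 < p then x ^+ 2
  else if p == d%:R / 2 then (x / ln (2 + x^-1)) ^+ 2
  else x `^ (d%:R / p).

Lemma bound_aE d p C c N x : bound_a d p C c N x = C * expR (- (c * (N%:R * rate d p x))).
Proof. by rewrite /bound_a /rate; case: ifP => _; [|case: ifP => _]; rewrite !mulNr mulrA. Qed.

Lemma ler_sqr_nneg x y : 0 <= x -> x <= y -> x ^+ 2 <= y ^+ 2.
Proof. by move=> x0 xy; rewrite lerXn2r ?nnegrE// (le_trans x0). Qed.

Lemma ln2_gt0 : 0 < ln 2 :> R.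
Proof. by rewrite ln_gt0// ltr1n. Qed.

Lemma ltr_powR2 x y : (2 `^ x < 2 `^ y) = (x < y).
Proof. by rewrite /powR pnatr_eq0/= ltr_expR ltr_pM2r ?ln2_gt0. Qed.

Lemma ln2_le x : 0 < x -> ln 2 <= ln (2 + x^-1).
Proof.
move=> x0; have i0 : 0 < x^-1 by rewrite invr_gt0.
by rewrite ler_ln ?posrE ?addr_gt0// lerDl ltW.
Qed.

Lemma ln2V_gt0 x : 0 < x -> 0 < ln (2 + x^-1).
Proof. by move=> /ln2_le; apply: lt_le_trans; exact: ln2_gt0. Qed.

Lemma rate_gt0 d p x : 0 < x -> 0 < rate d p x.
Proof.
move=> x0; rewrite /rate; case: ifP => _; first by rewrite exprn_gt0.
case: ifP => _; last by rewrite powR_gt0.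
by rewrite exprn_gt0// divr_gt0// ln2V_gt0.
Qed.

Lemma rate_exponent d p : 0 < p -> (d%:R / 2 < p) = false -> 2 <= d%:R / p.
Proof. by move=> p0 /negbT; rewrite -leNgt => H; rewrite ler_pdivlMr//; lra. Qed.

(** All three forms grow at least quadratically: in the middle one the logarithm decreases with [x],
    in the last one d / p >= 2. *)
Lemma rate_scale_ge d p x z : 0 < p -> 0 < x -> 1 <= z ->
  z ^+ 2 * rate d p x <= rate d p (x * z).
Proof.
move=> p0 x0 z1; have z0 : 0 < z by exact: lt_le_trans z1.
rewrite /rate; case: ifP => [_|dp]; first by rewrite exprMn mulrC.
case: ifP => _.
  have lx := ln2V_gt0 x0; rewrite -exprMn; apply: ler_sqr_nneg.
    by rewrite mulr_ge0// ?divr_ge0// ltW.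
  rewrite mulrCA mulrA ler_wpM2l ?mulr_ge0 ?(ltW z0) ?(ltW x0)//.
  rewrite lef_pV2 ?posrE ?ln2V_gt0 ?mulr_gt0//.
  rewrite ler_ln ?posrE ?addr_gt0 ?invr_gt0 ?mulr_gt0// lerD2l.
  by rewrite lef_pV2 ?posrE ?mulr_gt0// ler_peMr// ltW.
rewrite powRM ?(ltW x0) ?(ltW z0)// mulrC ler_wpM2l ?powR_ge0//.
rewrite -powR_mulrn ?(ltW z0)// ler_powR//.
exact: rate_exponent.
Qed.

(** Lets a constant factor inside [rate] be moved to the constant of the exponent. In the
    logarithmic case ln (2 + K / x) <= ln K + ln (2 + 1/x), where ln K <= (ln K / ln 2) ln (2 +
    1/x). *)
Lemma rate_shrink_ge d p K : 0 < p -> 1 <= K -> exists2 c : R, 0 < c &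
  forall x, 0 < x -> c * rate d p x <= rate d p (x / K).
Proof.
move=> p0 K1; have K0 : 0 < K by exact: lt_le_trans K1.
have Ki : 0 < K^-1 by rewrite invr_gt0.
rewrite /rate; have [_|dp] := boolP (d%:R / 2 < p).
  exists (K^-1 ^+ 2); first by rewrite exprn_gt0.
  by move=> x x0; rewrite exprMn mulrC.
have [_|_] := eqVneq p (d%:R / 2); last first.
  exists (K^-1 `^ (d%:R / p)); first by rewrite powR_gt0.
  by move=> x x0; rewrite powRM ?(ltW x0) ?(ltW Ki)// mulrC.
have l2 := ln2_gt0; have lK : 0 <= ln K by rewrite ln_ge0.
pose a := 1 + ln K / ln 2; have a1 : 1 <= a by rewrite lerDl divr_ge0// ltW.
have a0 : 0 < a by exact: lt_le_trans a1.
exists ((K^-1 / a) ^+ 2); first by rewrite exprn_gt0// divr_gt0.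
move=> x x0; have xK : 0 < x / K by rewrite mulr_gt0.
have lx := ln2V_gt0 x0; rewrite -exprMn; apply: ler_sqr_nneg.
  by rewrite !mulr_ge0// ?invr_ge0// ltW.
rewrite (_ : K^-1 / a * _ = x / K * (a * ln (2 + x^-1))^-1); last first.
  by field; rewrite !gt_eqF// ln2V_gt0.
rewrite ler_wpM2l ?(ltW xK)// lef_pV2 ?posrE ?mulr_gt0 ?ln2V_gt0//.
have xi : 0 < x^-1 by rewrite invr_gt0.
apply: (@le_trans _ _ (ln (K * (2 + x^-1)))).
  rewrite ler_ln ?posrE ?addr_gt0 ?mulr_gt0 ?invr_gt0 ?addr_gt0//.
  rewrite invfM invrK mulrDr [K * x^-1]mulrC lerD2r; lra.
rewrite lnM ?posrE ?addr_gt0// mulrDl mul1r addrC lerD2l.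
rewrite mulrAC ler_pdivlMr// ler_wpM2l//.
exact: ln2_le.
Qed.

(** Allows a Gaussian term exp(-c N x^2) with x <= 1 to be absorbed by a(N, x). *)
Lemma rate_le_sqr d p : 0 < p -> exists2 c : R, 0 < c &
  forall x, 0 < x <= 1 -> rate d p x <= c * x ^+ 2.
Proof.
move=> p0; have l2 := ln2_gt0.
exists (1 + (ln 2)^-1 ^+ 2); first by rewrite addr_gt0// exprn_gt0// invr_gt0.
move=> x /andP[x0 x1]; rewrite /rate; case: ifP => [_|dp].
  by rewrite ler_peMl ?sqr_ge0// lerDl sqr_ge0.
case: ifP => _.
  rewrite exprMn mulrC ler_wpM2r ?sqr_ge0//.
  apply: (@le_trans _ _ ((ln 2)^-1 ^+ 2)); last by rewrite lerDr.
  apply: ler_sqr_nneg; first by rewrite invr_ge0 ltW// ln2V_gt0.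
  by rewrite lef_pV2 ?posrE ?ln2V_gt0// ln2_le.
apply: (@le_trans _ _ (x ^+ 2)); last by rewrite ler_peMl ?sqr_ge0// lerDl sqr_ge0.
rewrite -powR_mulrn ?(ltW x0)// ger_powR ?x0//.
exact: rate_exponent.
Qed.

Lemma geometric_sum_le (s : R) L : 0 <= s < 1 -> \sum_(l < L) s ^+ l <= (1 - s)^-1.
Proof.
move=> /andP[s0 s1]; rewrite -[leRHS]mul1r ler_pdivlMr ?subr_gt0//.
have := subrX1 s L => H.
have -> : (\sum_(l < L) s ^+ l) * (1 - s) = 1 - s ^+ L.
  by rewrite mulrC -opprB mulNr -H opprB.
by rewrite gerBl exprn_ge0.
Qed.

(* Number of levels needed to resolve the relative accuracy [y]. *)
Lemma depth_exists (a y : R) : 1 < a -> 0 < y <= 1 ->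
  exists L : nat, a ^- L <= y <= a * a ^- L.
Proof.
move=> a1 /andP[y0 y1]; have a0 : 0 < a by exact: lt_trans a1.
have ex : exists L : nat, a ^- L <= y.
  have l0 : 0 < ln a by rewrite ln_gt0.
  have := truncnS_gt (ln y^-1 / ln a); set k := (_.+1) => Hk; exists k.
  rewrite -[y]invrK lef_pV2 ?posrE ?exprn_gt0 ?invr_gt0//.
  rewrite -ler_ln ?posrE ?exprn_gt0 ?invr_gt0// lnXn// -mulr_natl -ler_pdivrMr//.
  exact: ltW.
case: (ex_minnP ex) => L Ly Lmin; exists L; rewrite Ly /=.
case: L Ly Lmin => [|L] Ly Lmin.
  by rewrite expr0 invr1 mulr1 (le_trans y1)// ltW.
rewrite exprS invfM mulrA divff ?gt_eqF// mul1r ltW// ltNge; apply/negP => H.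
by have := Lmin _ H; rewrite ltnn.
Qed.

Lemma rate_levels d p : 0 < p -> exists2 C : R, 0 < C &
  forall y, 0 < y <= 1 -> exists L : nat,
  [/\ (2 `^ p) ^- L <= y, y <= 2 `^ p * (2 `^ p) ^- L &
    Num.sqrt (rate d p y) * \sum_(l < L.+1) (2 `^ (d%:R / 2) / 2 `^ p) ^+ l <= C * y].
Proof.
move=> p0; set a := 2 `^ p; set s := _ / a.
have a0 : 0 < a by rewrite powR_gt0.
have a1 : 1 < a.
  have : 1 `^ p < 2 `^ p :> R by apply: gt0_ltr_powR; rewrite ?nnegrE ?ltr1n.
  by rewrite powR1.
have s0 : 0 < s by rewrite divr_gt0// powR_gt0.
have lna : 0 < ln a by rewrite ln_gt0.
have sE : s = 2 `^ (d%:R / 2 - p).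
  by rewrite /s powRB//; apply/implyP => _; rewrite pnatr_eq0.
have [dp|dp] := boolP (d%:R / 2 < p).
  have s1 : s < 1.
    by have := ltr_powR2 (d%:R / 2 - p) 0; rewrite powRr0 -sE subr_lt0 dp.
  exists (1 - s)^-1; first by rewrite invr_gt0 subr_gt0.
  move=> y y01; have /andP[y0 _] := y01; have [L /andP[L1 L2]] := depth_exists a1 y01.
  exists L; split => //; rewrite /rate dp sqrtr_sqr gtr0_norm// mulrC.
  by rewrite ler_wpM2r ?(ltW y0)// geometric_sum_le// ltW.
have [pd|pd] := eqVneq p (d%:R / 2).
  exists (2 / ln 2 + (ln a)^-1); first by rewrite addr_gt0 ?divr_gt0 ?invr_gt0 ?ln2_gt0.
  move=> y y01; have /andP[y0 _] := y01; have [L /andP[L1 L2]] := depth_exists a1 y01.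
  have l2y := ln2V_gt0 y0.
  exists L; split => //; rewrite /rate (negbTE dp) (introT eqP pd).
  rewrite sqrtr_sqr gtr0_norm ?divr_gt0//.
  rewrite (eq_bigr (fun=> 1)); last first.
    by move=> l _; rewrite sE -pd subrr powRr0 expr1n.
  rewrite sumr_const card_ord -mulrA mulrC ler_wpM2r ?(ltW y0)//.
  rewrite ler_pdivrMl// mulrC mulrDl.
  have H1 : 2 <= 2 / ln 2 * ln (2 + y^-1).
    rewrite mulrAC ler_pdivlMr ?ln2_gt0// ler_pM2l//; exact: ln2_le.
  have H2 : L%:R - 1 <= (ln a)^-1 * ln (2 + y^-1).
    rewrite mulrC ler_pdivlMr//.
    apply: (@le_trans _ _ (ln y^-1)); last first.
      by rewrite ler_ln ?posrE ?addr_gt0 ?invr_gt0// lerDr.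
    have : ln y <= ln (a * a ^- L).
      by rewrite ler_ln ?posrE ?mulr_gt0 ?invr_gt0 ?exprn_gt0.
    rewrite lnM ?posrE ?invr_gt0 ?exprn_gt0// !lnV ?posrE ?exprn_gt0// lnXn//.
    by rewrite -mulr_natl; lra.
  by rewrite -addn1 natrD; lra.
have pd' : p < d%:R / 2 by rewrite lt_neqAle pd leNgt.
have s1 : 1 < s.
  by have := ltr_powR2 0 (d%:R / 2 - p); rewrite powRr0 -sE subr_gt0 pd'.
(* Since s = a^theta and a^L <= a / y, the dominant term s^L is at most s y^(-theta). *)
pose theta := d%:R / 2 / p - 1.
have theta0 : 0 <= theta by rewrite subr_ge0 ler_pdivlMr// mul1r ltW.
have sa : s = a `^ theta.
  rewrite sE /a -powRrM /theta mulrBr mulr1 mulrCA divff ?gt_eqF// mulr1//.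
exists (s / (s - 1) * s); first by rewrite mulr_gt0// divr_gt0// subr_gt0.
move=> y y01; have /andP[y0 _] := y01; have [L /andP[L1 L2]] := depth_exists a1 y01.
exists L; split => //.
have sL : s ^+ L <= s * y `^ (- theta).
  have -> : s ^+ L = (a ^+ L) `^ theta.
    rewrite -(powR_mulrn L (ltW s0)) -(powR_mulrn L (ltW a0)) sa -!powRrM.
    by rewrite (mulrC theta).
  have -> : s * y `^ (- theta) = (a / y) `^ theta.
    rewrite powRM ?invr_ge0 ?(ltW a0) ?(ltW y0)// -sa; congr (_ * _).
    by rewrite -(powR_inv1 (ltW y0)) -powRrM mulN1r.
  apply: ge0_ler_powR => //; rewrite ?nnegrE ?mulr_ge0 ?invr_ge0 ?exprn_ge0 ?(ltW a0) ?(ltW y0)//.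
  by rewrite ler_pdivlMr// mulrC -ler_pdivlMr ?exprn_gt0.
have sqE : Num.sqrt (rate d p y) = y * y `^ theta.
  rewrite /rate (negbTE dp) (negbTE pd) -powR12_sqrt ?powR_ge0// -powRrM.
  rewrite -{2}(powRr1 (ltW y0)) -powRD; last by apply/implyP => _; rewrite gt_eqF.
  by congr (_ `^ _); rewrite /theta; field; rewrite gt_eqF.
have sumE : \sum_(l < L.+1) s ^+ l <= s / (s - 1) * s ^+ L.
  rewrite -ler_pdivrMl ?divr_gt0 ?subr_gt0// invf_div mulrAC ler_pdivrMr// -subrX1.
  by rewrite -exprSr gerBl.
rewrite sqE; apply: (@le_trans _ _ (y * y `^ theta * (s / (s - 1) * (s * y `^ (- theta))))).
  rewrite ler_wpM2l ?mulr_ge0 ?powR_ge0 ?(ltW y0)//; apply: (le_trans sumE).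
  by rewrite ler_wpM2l// divr_ge0 ?(ltW s0)// subr_ge0 ltW.
rewrite le_eqVlt; apply/orP; left; apply/eqP.
rewrite powRN; field; rewrite subr_eq0 gt_eqF// gt_eqF// powR_gt0//.
Qed.

End rate.

(** * Deviations of the transport cost *)

Section moments.
Context (R : realType) (d : nat).
Local Notation T := (d.-tuple R).
Implicit Types (mu : probability T R) (p q r M : R).

Lemma measurable_norm_powR p : measurable_fun setT (fun z : T => (eucl_norm z `^ p)%:E).
Proof.
apply/measurable_EFinP.
exact: (measurableT_comp (measurable_powR p) (@measurable_eucl_norm R d)).
Qed.

Lemma measurable_norm_gt r : measurable [set z : T | r < eucl_norm z].
Proof.
rewrite (_ : [set z | _] = ~` [set z | eucl_norm z <= r]).
  by apply: measurableC; exact: measurable_norm_le.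
by apply/seteqP; split => z /=; rewrite ltNge => /negP.
Qed.

Lemma measure_norm_gt_le mu q M r : 0 <= q -> 0 < r ->
  (moment q mu <= M%:E)%E -> (mu [set z | (r < eucl_norm z)%R] <= (M / r `^ q)%:E)%E.
Proof.
move=> q0 r0 HM; have rq : 0 < r `^ q by rewrite powR_gt0.
have mE := measurable_norm_gt r.
have : ((r `^ q)%:E * mu [set z | (r < eucl_norm z)%R] <= M%:E)%E.
  apply: le_trans HM; rewrite -integral_cst//; apply: (@le_trans _ _
    (\int[mu]_(z in [set z | (r < eucl_norm z)%R]) (eucl_norm z `^ q)%:E)%E).
    apply: ge0_le_integral; [exact: mE|by move=> z _; rewrite lee_fin ltW| |
      by apply: measurable_funTS; exact: measurable_norm_powR|]; first exact: measurable_cst.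
    move=> z /= rz; rewrite lee_fin ge0_ler_powR ?nnegrE ?eucl_norm_ge0// ltW//.
  apply: ge0_subset_integral => //; first exact: measurable_norm_powR.
  by move=> z _; rewrite lee_fin powR_ge0.
have -> : mu [set z | (r < eucl_norm z)%R] = (fine (mu [set z | (r < eucl_norm z)%R]))%:E.
  by rewrite fineK// fin_num_measure.
by rewrite -EFinM !lee_fin => H; rewrite ler_pdivlMr// mulrC.
Qed.

Lemma integral_norm_gt_le mu p q M r : p <= q -> 0 < r ->
  (moment q mu <= M%:E)%E ->
  (\int[mu]_(z in [set z | (r < eucl_norm z)%R]) (eucl_norm z `^ p)%:E <=
   (M * r `^ (p - q))%:E)%E.
Proof.
move=> pq r0 HM; have mE := measurable_norm_gt r.
have rp : 0 <= r `^ (p - q) by rewrite powR_ge0.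
apply: (@le_trans _ _ (\int[mu]_(z in [set z | (r < eucl_norm z)%R])
   ((r `^ (p - q))%:E * (eucl_norm z `^ q)%:E))%E).
  apply: ge0_le_integral; [exact: mE|by move=> z _; rewrite lee_fin powR_ge0|
    by apply: measurable_funTS; exact: measurable_norm_powR| |].
    by apply: measurable_funeM; apply: measurable_funTS; exact: measurable_norm_powR.
  move=> z /= rz; have z0 : 0 < eucl_norm z by exact: lt_trans rz.
  have -> : eucl_norm z `^ p = eucl_norm z `^ (p - q) * eucl_norm z `^ q.
    by rewrite -powRD ?subrK//; apply/implyP => _; rewrite gt_eqF.
  rewrite -EFinM lee_fin.
  rewrite ler_wpM2r ?powR_ge0// -opprB !powRN lef_pV2 ?posrE ?powR_gt0//.
  by rewrite ge0_ler_powR ?nnegrE ?subr_ge0 ?(ltW z0) ?(ltW r0)// ltW.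
rewrite ge0_integralZl; [|exact: mE|by apply: measurable_funTS; exact: measurable_norm_powR|
  by move=> z _; rewrite lee_fin powR_ge0|by rewrite lee_fin].
rewrite mulrC EFinM; apply: lee_wpmul2l; first by rewrite lee_fin.
apply: le_trans HM; apply: ge0_subset_integral => //; first exact: measurable_norm_powR.
by move=> z _; rewrite lee_fin powR_ge0.
Qed.

Lemma integral_norm_le mu p q M : 0 <= p <= q -> (moment q mu <= M%:E)%E ->
  (\int[mu]_z (eucl_norm z `^ p)%:E <= (1 + M)%:E)%E.
Proof.
move=> /andP[p0 pq] HM.
apply: (@le_trans _ _ (\int[mu]_z (1 + (eucl_norm z `^ q)%:E))%E).
  apply: ge0_le_integral; [exact: measurableT|by move=> z _; rewrite lee_fin powR_ge0|
    exact: measurable_norm_powR| |].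
    by apply: emeasurable_funD; [exact: measurable_cst|exact: measurable_norm_powR].
  move=> z _; rewrite -EFinD lee_fin; have [z1|z1] := leP (eucl_norm z) 1.
    apply: (@le_trans _ _ 1); last by rewrite lerDl powR_ge0.
    have := @ge0_ler_powR R p p0 (eucl_norm z) 1; rewrite !nnegrE powR1 eucl_norm_ge0.
    by apply.
  by apply: (@le_trans _ _ (eucl_norm z `^ q)); [rewrite ler_powR// ltW|rewrite lerDr].
rewrite ge0_integralD; [|exact: measurableT|by []|exact: measurable_cst|
  by move=> z _; rewrite lee_fin powR_ge0|exact: measurable_norm_powR].
rewrite integral_cst// [X in (_ * X + _)%E]probability_setT mule1 EFinD.
exact: leeD.
Qed.

(** Markov's inequality at the inner radius 2^(n-1), which costs the factor 2^q; the summand 1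
    covers the unit ball, n = 0. *)
Lemma measure_annulus_le mu q M n : 0 <= q -> 0 <= M -> (moment q mu <= M%:E)%E ->
  fine (mu [set z | annulus z = n]) <= (1 + 2 `^ q * M) * (2 `^ q) ^- n.
Proof.
move=> q0 M0 HM; have mA := @measurable_annulus R d n.
have Q0 : 0 < 2 `^ q :> R by rewrite powR_gt0.
rewrite -lee_fin fineK ?fin_num_measure//.
case: n mA => [|n] mA.
  rewrite expr0 invr1 mulr1; apply: (le_trans (probability_le1 _ mA)).
  by rewrite lee_fin lerDl mulr_ge0// ltW.
have n0 : 0 < 2 ^+ n :> R by rewrite exprn_gt0.
apply: (@le_trans _ _ (mu [set z | (2 ^+ n < eucl_norm z)%R])).
  apply: le_measure; rewrite ?inE//; first exact: measurable_norm_gt.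
  by move=> z /= zn; rewrite -annulus_gt zn.
apply: (le_trans (measure_norm_gt_le q0 n0 HM)); rewrite lee_fin.
have -> : (2 ^+ n) `^ q = (2 `^ q) ^+ n.
  by rewrite -powR_mulrn// -powRrM mulrC powRrM powR_mulrn ?powR_ge0.
rewrite exprS invfM mulrA ler_wpM2r ?invr_ge0 ?exprn_ge0 ?(ltW Q0)//.
by rewrite ler_pdivlMr// mulrC lerDr.
Qed.

End moments.

(** Since 2^(dl) >= 1 + l and, by Bernoulli, g^n >= 1 + n (g - 1), their product is at least 1 + l +
    n (g - 1). As A >= 1, the exponent is at least A + l + n (g - 1), and two geometric series
    remain. *)
Lemma double_exp_sum_le (R : realType) d (g : R) : (0 < d)%N -> 1 < g ->
  exists2 C : R, 0 < C & forall (A : R) (B : nat) (L : nat -> nat), 1 <= A ->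
  \sum_(n < B) \sum_(l < L n) expR (- (A * (2 ^ (d * l))%:R * g ^+ n)) <= C * expR (- A).
Proof.
move=> d0 g1; have [tau gE] : exists tau, g = 1 + tau by exists (g - 1); rewrite addrC subrK.
have tau0 : 0 < tau by move: g1; rewrite gE ltrDl.
have geo (t : R) : 0 < t -> forall m, \sum_(l < m) expR (- t) ^+ l <= (1 - expR (- t))^-1.
  move=> t0 m; apply: geometric_sum_le.
  by rewrite expR_ge0/= -expR0 ltr_expR oppr_lt0.
have gpos (t : R) : 0 < t -> 0 < (1 - expR (- t))^-1.
  by move=> t0; rewrite invr_gt0 subr_gt0 -expR0 ltr_expR oppr_lt0.
exists ((1 - expR (- tau))^-1 * (1 - expR (- 1))^-1); first by rewrite mulr_gt0// gpos.
move=> A B L A1.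
have bern n : 1 + n%:R * tau <= g ^+ n.
  elim: n => [|n IH]; first by rewrite mul0r addr0 expr0.
  rewrite exprS; apply: (@le_trans _ _ (g * (1 + n%:R * tau))); last first.
    by rewrite ler_wpM2l// ltW// (lt_trans ltr01).
  rewrite -natr1 gE -subr_ge0 (_ : _ - _ = n%:R * tau ^+ 2); last by ring.
  by rewrite mulr_ge0 ?sqr_ge0.
have term n l : expR (- (A * (2 ^ (d * l))%:R * g ^+ n)) <=
    expR (- A) * (expR (- tau) ^+ n * expR (- 1) ^+ l).
  rewrite -!expRM_natl -!expRD ler_expR.
  have u : 1 + l%:R <= (2 ^ (d * l))%:R :> R.
    rewrite nat1r ler_nat; apply: (leq_trans (ltn_expl l (ltnSn 1))).
    by rewrite leq_pexp2l// leq_pmull.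
  have v := bern n.
  have l0 : 0 <= l%:R :> R by rewrite ler0n.
  have nt0 : 0 <= n%:R * tau by rewrite mulr_ge0// ltW.
  have uv : (1 + l%:R) * (1 + n%:R * tau) <= (2 ^ (d * l))%:R * g ^+ n.
    by apply: ler_pM => //; rewrite addr_ge0.
  have H : A * (1 + l%:R + n%:R * tau) <= A * ((2 ^ (d * l))%:R * g ^+ n).
    rewrite ler_wpM2l ?(le_trans ler01)//; apply: le_trans uv.
    have -> : (1 + l%:R) * (1 + n%:R * tau) = 1 + l%:R + n%:R * tau + l%:R * (n%:R * tau).
      by ring.
    by rewrite lerDl mulr_ge0.
  have H2 : A + l%:R + n%:R * tau <= A * (1 + l%:R + n%:R * tau).
    by rewrite -!addrA mulrDr mulr1 lerD2l ler_peMl// addr_ge0.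
  rewrite -mulrA; lra.
apply: (@le_trans _ _ (\sum_(n < B) \sum_(l < L n)
    expR (- A) * (expR (- tau) ^+ n * expR (- 1) ^+ l))).
  by apply: ler_sum => n _; apply: ler_sum => l _.
under eq_bigr do rewrite -mulr_sumr -mulr_sumr.
rewrite -mulr_sumr mulrC ler_wpM2r ?expR_ge0//.
apply: (@le_trans _ _ (\sum_(n < B) expR (- tau) ^+ n * (1 - expR (- 1))^-1)).
  by apply: ler_sum => n _; rewrite ler_wpM2l ?exprn_ge0 ?expR_ge0// geo.
rewrite -mulr_suml ler_wpM2r ?(ltW (gpos _ _))//; exact: geo.
Qed.

(** * Deviations for bounded x: union bound over annuli and levels *)

Section deviation.
Context (R : realType) (d : nat).
Local Notation T := (d.-tuple R).

Definition tail_mean (p r : R) N (x : nat -> T) : R :=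
  \sum_(k < N | r < eucl_norm (x k)) N%:R^-1 * eucl_norm (x k) `^ p.

Lemma measurable_tail_mean disp (Omega : measurableType disp) (P : probability Omega R)
    (X : nat -> {RV P >-> T}) p r N (u : R) :
  measurable [set w | u <= tail_mean p r N (fun k => X k w)].
Proof.
pose f w := \sum_(k < N) N%:R^-1 * eucl_norm (X k w) `^ p * \1_[set z | r < eucl_norm z] (X k w).
have fE w : tail_mean p r N (fun k => X k w) = f w.
  rewrite /tail_mean /f big_mkcond; apply: eq_bigr => k _; rewrite indicE.
  have [rk|rk] := boolP (r < eucl_norm (X k w)).
    by rewrite mem_set// mulr1.
  by rewrite memNset ?mulr0// => /=; apply/negP.
have mI : measurable_fun setT (\1_[set z : T | r < eucl_norm z] : T -> R).
  by apply: measurable_indic; exact: measurable_norm_gt.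
have mN : measurable_fun setT (fun z : T => eucl_norm z `^ p).
  exact: (measurableT_comp (measurable_powR p) (@measurable_eucl_norm R d)).
have mf : measurable_fun setT f.
  apply: measurable_sum => k; apply: measurable_funM; last exact: (measurableT_comp mI).
  by apply: measurable_funM => //; exact: (measurableT_comp mN).
rewrite (_ : [set w | _] = [set w | u <= f w]); last first.
  by apply/seteqP; split => w /=; rewrite fE.
have := @measurable_fun_ler _ _ _ setT (cst u) _ (@measurable_cst _ _ _ _ _ _) mf
  measurableT [set true].
by rewrite setTI; apply.
Qed.

(** Annulus n is granted the relative accuracy y_n = y0 rho^n. Its cost is then of order c1 x
    e^(-n), while beta_n rate(y_n) is at least of order g^n rate(min(x, 1)), because [rate] grows at
    least quadratically; costs and probabilities can thus both be summed over n. The annuli where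
    y_n would exceed 1 are left to the tails beyond radius [r]. *)
Lemma small_deviation (p q M x0 K : R) :
  (0 < d)%N -> 0 < p -> 2 * p < q -> 0 <= M -> 1 <= x0 -> 0 < K ->
  dyadic_estimate d p K ->
  exists C c : R, [/\ 0 < C, 0 < c & forall mu : probability T R,
   (moment q mu <= M%:E)%E ->
   forall (disp : measure_display) (Omega : measurableType disp)
      (P : probability Omega R) (X : nat -> {RV P >-> T}), iid mu X ->
   forall N x, (0 < N)%N -> 0 < x <= x0 -> exists r : R,
    (K%:E * \int[mu]_(z in [set z | (r < eucl_norm z)%R]) (eucl_norm z `^ p)%:E <=
       (x / 4)%:E)%E /\
    (P [set w | (x%:E <= transport_cost p (empirical N (fun k => X k w)) mu)%E] <=
     (C * expR (- (c * (N%:R * rate d p (Num.min x 1)))))%:E +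
     P [set w | (x / (2 * K) <= tail_mean p r N (fun k => X k w))%R])%E].
Proof.
move=> d0 p0 pq M0 x01 K0 HK.
pose a : R := 2 `^ p; pose Q : R := 2 `^ q; pose dl : R := (q - 2 * p) / 4.
pose e : R := 2 `^ dl.
have dl0 : 0 < dl by rewrite divr_gt0// subr_gt0.
have pow1 (s : R) : 0 < s -> 1 < 2 `^ s.
  by move=> s0; have := ltr_powR2 0 s; rewrite powRr0 s0.
have a1 : 1 < a by exact: pow1.
have e1 : 1 < e by exact: pow1.
have a0 : 0 < a by exact: lt_trans a1.
have e0 : 0 < e by exact: lt_trans e1.
have Q0 : 0 < Q by rewrite powR_gt0.
pose g : R := 2 `^ ((q - 2 * p) / 2).
have g1 : 1 < g by apply: pow1; rewrite divr_gt0// subr_gt0.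
have g0 : 0 < g by exact: lt_trans g1.
have two0 (s t : R) : (s + t == 0) ==> (2 != 0 :> R) by rewrite pnatr_eq0 implybT.
(* 2^q is shared out: a^2 for the weights of the cost, e^2 for the decay of the costs in n, and g
   for the growth of the exponents. *)
have QE : Q = g * a ^+ 2 * e ^+ 2.
  rewrite /Q /g /a /e -!powR_mulrn ?powR_ge0// -!powRrM -!powRD//.
  by congr (_ `^ _); rewrite /dl; field.
pose rho := g * a * e.
have rho1 : 1 < rho by rewrite /rho !mulr_egt1.
have rho0 : 0 < rho by exact: lt_trans rho1.
have QR : Q = rho * a * e by rewrite QE /rho; ring.
pose Mt := 1 + Q * M.
have Mt1 : 1 <= Mt by rewrite lerDl mulr_ge0// ltW.
have Mt0 : 0 < Mt by exact: lt_le_trans Mt1.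
have [C3 C30 HC3] := rate_levels d p0.
have [C7 C70 HC7] := double_exp_sum_le d0 g1.
pose kap := (C3 * a)^-1.
have kap0 : 0 < kap by rewrite invr_gt0 mulr_gt0.
pose G := (1 - e^-1)^-1.
have ei : 0 < e^-1 < 1 by rewrite invr_gt0 e0 invf_lt1.
have G1 : 1 <= G.
  by rewrite /G invf_ge1 ?subr_gt0; case/andP: ei => // ? ?; rewrite ?gerBl ?ltW.
have G0 : 0 < G by exact: lt_le_trans G1.
(* Chosen for c1 x0 <= 1, which gives y0 <= 1, and for 16 K G c1 <= 1, which leaves room for the
   tail mean in the final balance. *)
pose c1 := (x0 * (1 + 16 * K * G))^-1.
have x00 : 0 < x0 by exact: lt_le_trans x01.
have KG0 : 0 < K * G by rewrite mulr_gt0.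
have H16 : 0 < 1 + 16 * K * G by rewrite addr_gt0// !mulr_gt0.
have c10 : 0 < c1 by rewrite invr_gt0 mulr_gt0.
have c1x0 : c1 * x0 <= 1.
  rewrite /c1 invfM mulrAC mulVf ?gt_eqF// mul1r invf_le1//.
  by rewrite lerDl !mulr_ge0// ltW.
have c1KG : 16 * (K * G * c1) <= 1.
  have c1H : c1 <= (1 + 16 * K * G)^-1.
    by rewrite lef_pV2 ?posrE ?mulr_gt0// ler_peMl// ltW.
  apply: (@le_trans _ _ (16 * (K * G / (1 + 16 * K * G)))).
    by rewrite ler_pM2l// ler_pM2l.
  by rewrite mulrA ler_pdivrMr// mul1r mulrA lerDr.
have c11 : c1 <= 1.
  by apply: le_trans c1x0; rewrite ler_peMr// ltW.
pose K' := Mt / c1.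
have K'1 : 1 <= K' by rewrite ler_pdivlMr// mul1r (le_trans c11).
have K'0 : 0 < K' by exact: lt_le_trans K'1.
have [c5 c50 Hc5] := rate_shrink_ge d p0 K'1.
(* The Chernoff exponent has the constant kap^2 c5 / 8; half of it pays for the number of cells. *)
pose c := kap ^+ 2 * c5 / 8 / 2.
have c0 : 0 < c by rewrite !divr_gt0// mulr_gt0// exprn_gt0.
pose A4 : R := (4 ^ d)%:R.
have A41 : 1 <= A4 by rewrite ler1n expn_gt0.
exists (expR A4 + C7), c; split => //; first by rewrite addr_gt0// expR_gt0.
move=> mu Hmu disp Omega P X iidX N x N0 /andP[xgt xle].
have NR : 0 < N%:R :> R by rewrite ltr0n.
pose y0 := c1 * x / Mt.
have y00 : 0 < y0 by rewrite divr_gt0// mulr_gt0.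
have y01 : y0 <= 1.
  rewrite ler_pdivrMr// mul1r; apply: le_trans Mt1; apply: le_trans c1x0.
  by rewrite ler_pM2l.
(* The least such n is positive as y0 <= 1; it is written [B.+1], so annuli 0 to [B] are resolved
   into cells. *)
have exB : exists n, 1 < y0 * rho ^+ n.
  have l0 : 0 < ln rho by rewrite ln_gt0.
  have := truncnS_gt (ln y0^-1 / ln rho); set k := (_.+1) => Hk; exists k.
  rewrite -ltr_pdivrMl// mulr1 -ltr_ln ?posrE ?invr_gt0 ?exprn_gt0//.
  by rewrite lnXn// -mulr_natl -ltr_pdivrMr.
case: (ex_minnP exB) => B' HB HBmin.
have B0 : (0 < B')%N.
  by case: (B') HB => //; rewrite expr0 mulr1 ltNge y01.
move: (B0) HB HBmin; rewrite -(prednK B0); set B := B'.-1 => _ HB HBmin.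
pose y n := y0 * rho ^+ n.
have ygt n : 0 < y n by rewrite mulr_gt0// exprn_gt0.
have yle n : (n < B.+1)%N -> y n <= 1.
  by move=> nB; rewrite leNgt; apply/negP => /HBmin; rewrite leqNgt nB.
have /choice[L HL] : forall n, exists L : nat, (n < B.+1)%N ->
   [/\ a ^- L <= y n, y n <= a * a ^- L &
    Num.sqrt (rate d p (y n)) * \sum_(l < L.+1) (2 `^ (d%:R / 2) / a) ^+ l <= C3 * y n].
  move=> n; have [nB|nB] := boolP (n < B.+1)%N; last by exists 0%N.
  have yn : 0 < y n <= 1 by rewrite ygt yle.
  by have [L HL] := HC3 _ yn; exists L.
pose beta n := Mt * Q ^- n.
have beta0 n : 0 < beta n by rewrite mulr_gt0// invr_gt0 exprn_gt0.
have abey n : a ^+ n * (beta n * y n) = c1 * x * e^-1 ^+ n.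
  rewrite /beta /y /y0 QR !exprMn exprVn; field.
  by rewrite !expf_neq0 ?gt_eqF.
pose D : R := 2 `^ (d%:R / 2).
have Dge1 : 1 <= D by rewrite /D -[leLHS](powRr0 2) ler_powR ?ler1n// divr_ge0.
(* The factor kap = 1 / (C3 a) keeps the threshold within the range 2 beta_n of the discrepancy
   bound, and the sum over l of a^(-l) t_(n,l) below beta_n y_n. *)
pose t n l := kap * beta n * Num.sqrt (rate d p (y n)) * D ^+ l.
have t0 n l : 0 <= t n l.
  have D0 : 0 <= D by rewrite powR_ge0.
  have kb : 0 <= kap * beta n by rewrite ltW// mulr_gt0.
  by rewrite mulr_ge0 ?exprn_ge0// mulr_ge0// sqrtr_ge0.
pose r : R := 2 ^+ B; exists r.
have r0 : 0 < r by rewrite exprn_gt0.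
have outE : [set z : T | (B.+1 <= annulus z)%N] = [set z | r < eucl_norm z].
  by apply/seteqP; split => z /=; rewrite annulus_gt.
have pq' : p <= q by rewrite ltW// (lt_trans _ pq)//; lra.
have q0 : 0 <= q by exact: le_trans (ltW p0) pq'.
have rpq : r `^ (p - q) = (Q / a) ^- B.
  rewrite -opprB powRN; congr (_^-1).
  rewrite /r -powR_mulrn// -powRrM mulrC powRrM powR_mulrn ?powR_ge0//.
  by congr (_ ^+ _); rewrite powRB// pnatr_eq0 implybT.
(* The choice of [B] means Mt rho^(-(B+1)) < c1 x, and Q / a = rho e exceeds rho. *)
have tailint : (\int[mu]_(z in [set z | (r < eucl_norm z)%R]) (eucl_norm z `^ p)%:E <=
    (c1 * x)%:E)%E.
  apply: (le_trans (integral_norm_gt_le pq' r0 Hmu)); rewrite lee_fin rpq.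
  have Qa : Q / a = rho * e by rewrite QR; field; rewrite gt_eqF.
  have Qa1 : 1 < Q / a by rewrite Qa mulr_egt1.
  have Qa0 : 0 < Q / a by exact: lt_trans Qa1.
  have -> : M * (Q / a) ^- B = (M * (Q / a)) * (Q / a) ^- B.+1.
    by rewrite exprS; field; rewrite expf_neq0 ?gt_eqF//.
  apply: (@le_trans _ _ (Mt * rho ^- B.+1)); last first.
    rewrite ler_pdivrMr ?exprn_gt0//; move: HB.
    by rewrite /y0 mulrAC ltr_pdivlMr// mul1r => /ltW.
  apply: ler_pM; [by rewrite mulr_ge0// ltW|by rewrite invr_ge0 exprn_ge0// ltW| |].
    apply: (@le_trans _ _ (Q * M)); last by rewrite /Mt lerDr.
    rewrite mulrC ler_wpM2r// ler_pdivrMr// ler_peMr ?(ltW Q0)//; exact: ltW.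
  rewrite lef_pV2 ?posrE ?exprn_gt0// lerXn2r ?nnegrE ?(ltW Qa0) ?(ltW rho0)//.
  by rewrite Qa ler_peMr ?(ltW rho0)// ltW.
have Kc1x : 16 * (K * (c1 * x)) <= x.
  have Kc1 : 16 * (K * c1) <= 1.
    apply: le_trans c1KG; rewrite ler_pM2l// ler_pM2r// ler_peMr//; exact: ltW.
  by have := ler_wpM2r (ltW xgt) Kc1; rewrite mul1r -!mulrA.
split.
  apply: (le_trans (lee_wpmul2l _ tailint)); first by rewrite lee_fin ltW.
  by rewrite -EFinM lee_fin; lra.
pose x' := Num.min x 1.
have x'0 : 0 < x' by rewrite lt_min xgt ltr01.
have x'1 : x' <= 1 by rewrite ge_min lexx orbT.
have x'x : x' <= x by rewrite ge_min lexx.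
pose A := c * (N%:R * rate d p x').
have mT := @measurable_transport_event R d disp Omega P X N p mu x p0 N0.
have mS := @measurable_tail_mean disp Omega P X p r N (x / (2 * K)).
(* If A < 4^d the bound exceeds 1, as C >= exp(4^d). Otherwise A dominates the factor 4^d in the
   number of cells. *)
have [Asmall|Alarge] := ltP A A4.
  apply: (le_trans (probability_le1 _ mT)); rewrite -[X in (X <= _)%E]adde0.
  apply: leeD; last exact: measure_ge0.
  rewrite lee_fin mulrDl; apply: ler_wpDr; first by rewrite mulr_ge0 ?expR_ge0// ltW.
  rewrite -expRD; have := expR_ge1Dx (A4 - A); apply: le_trans.
  by rewrite lerDl subr_ge0; exact: ltW.
have A1 : 1 <= A by exact: le_trans Alarge.
have rate_y n : rho ^+ n ^+ 2 * (c5 * rate d p x') <= rate d p (y n).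
  have z1 : 1 <= x / x' by rewrite ler_pdivlMr// mul1r.
  have rn1 : 1 <= rho ^+ n by rewrite exprn_ege1// ltW.
  have z2 : 1 <= x / x' * rho ^+ n by rewrite mulr_ege1.
  have -> : y n = x' / K' * (x / x' * rho ^+ n).
    by rewrite /y /y0 /K'; field; rewrite !gt_eqF.
  apply: le_trans (rate_scale_ge d p0 (divr_gt0 x'0 K'0) z2).
  apply: ler_pM; [by rewrite sqr_ge0|by rewrite mulr_ge0 ?(ltW (rate_gt0 _ _ _))// ltW|
    |exact: Hc5].
  by apply: ler_sqr_nneg; rewrite ?ler_peMl ?(le_trans ler01).
have beta_rate n : g ^+ n * (c5 * rate d p x') <= beta n * rate d p (y n).
  apply: (@le_trans _ _ (beta n * (rho ^+ n ^+ 2 * (c5 * rate d p x')))); last first.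
    by rewrite ler_pM2l.
  rewrite [leRHS]mulrA ler_wpM2r//; first by rewrite mulr_ge0 ?(ltW (rate_gt0 _ _ _))// ltW.
  rewrite /beta -mulrA.
  have -> : Q ^- n * rho ^+ n ^+ 2 = g ^+ n.
    rewrite QE -!exprM [(n * 2)%N]mulnC !exprM -exprVn -exprMn; congr (_ ^+ _).
    by rewrite /rho; field; rewrite !gt_eqF.
  by rewrite ler_peMl// exprn_ge0// ltW.
have D2 l : D ^+ l ^+ 2 = (2 ^ (d * l))%:R.
  rewrite natrX -exprM mulnC exprM [RHS]exprM; congr (_ ^+ _).
  rewrite /D -powR_mulrn ?powR_ge0// -powRrM divfK ?pnatr_eq0//.
  by rewrite powR_mulrn.
have t2b n l : (n < B.+1)%N -> (l <= L n)%N -> t n l <= 2 * beta n.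
  move=> nB lL; have [L1 L2 L3] := HL n nB.
  have sq0 : 0 <= Num.sqrt (rate d p (y n)) by exact: sqrtr_ge0.
  have D0 : 0 < D by exact: lt_le_trans Dge1.
  have H1 : Num.sqrt (rate d p (y n)) * D ^+ (L n) <= C3 * a.
    have : Num.sqrt (rate d p (y n)) * (D / a) ^+ L n <= C3 * y n.
      apply: le_trans L3; rewrite ler_wpM2l//.
      rewrite big_ord_recr/= lerDr; apply: sumr_ge0 => k _.
      by rewrite exprn_ge0// divr_ge0 ?(ltW D0)// ltW.
    rewrite exprMn exprVn mulrA ler_pdivrMr ?exprn_gt0// => /le_trans; apply.
    rewrite -mulrA ler_pM2l//; move: L2.
    by rewrite ler_pdivlMr ?exprn_gt0.
  have H2 : Num.sqrt (rate d p (y n)) * D ^+ l <= C3 * a.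
    by apply: le_trans H1; rewrite ler_wpM2l// ler_weXn2l.
  rewrite /t -mulrA -mulrA mulrCA mulrC ler_wpM2r ?(ltW (beta0 n))//.
  rewrite /kap ler_pdivrMl ?mulr_gt0//; apply: (le_trans H2).
  by rewrite ler_peMr ?ler1n// mulr_ge0// ltW.
have mub n : fine (mu [set z | annulus z = n]) <= beta n.
  exact: measure_annulus_le Hmu.
have /choice[E HE] : forall nl : nat * nat, exists E : set Omega, measurable E /\
   ((nl.1 < B.+1)%N -> (nl.2 <= L nl.1)%N ->
    (P E <= (expR (- (A * (2 ^ (d * nl.2))%:R * g ^+ nl.1)))%:E)%E /\
    forall w, t nl.1 nl.2 <= discrepancy (@cell R d) (@annulus R d) mu N
      (fun k => X k w) nl.1 nl.2 -> E w).
  move=> [n l] /=.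
  have [nB|nB] := boolP (n < B.+1)%N; last by exists set0; split.
  have [lL|lL] := boolP (l <= L n)%N; last by exists set0; split => //; lia.
  have tt : 0 <= t n l <= 2 * beta n by rewrite t0 t2b.
  have [E [mE PE EE]] := discrepancy_tail iidX (@measurable_cell R d)
    (@measurable_annulus R d) l N0 (beta0 n) (mub n) tt.
  exists E; split => // _ _; split => //; apply: (le_trans PE).
  rewrite lee_fin ler_expR.
  set u := (2 ^ (d * l))%:R.
  have u0 : 0 < u by rewrite ltr0n expn_gt0.
  have gn1 : 1 <= g ^+ n by rewrite exprn_ege1// ltW.
  have card : #|cell_label d l|%:R <= A * u * g ^+ n.
    apply: (@le_trans _ _ (A4 * u)).
      by rewrite -natrM ler_nat [(d * l)%N]mulnC expnM -expnMn card_cell_label.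
    apply: (@le_trans _ _ (A * u)); first by rewrite ler_pM2r.
    by rewrite ler_peMr// mulr_ge0 ?(ltW u0)// (le_trans ler01).
  have expo : 2 * (A * u * g ^+ n) <= N%:R * t n l ^+ 2 / (8 * beta n).
    have -> : N%:R * t n l ^+ 2 / (8 * beta n) =
        N%:R * kap ^+ 2 / 8 * u * (beta n * rate d p (y n)).
      have sq4 (u1 u2 u3 u4 : R) : (u1 * u2 * u3 * u4) ^+ 2 =
        u1 ^+ 2 * u2 ^+ 2 * u3 ^+ 2 * u4 ^+ 2 by ring.
      rewrite /t sq4 sqr_sqrtr; last exact/ltW/rate_gt0.
      by rewrite D2 -/u; field; rewrite gt_eqF.
    have -> : 2 * (A * u * g ^+ n) = N%:R * kap ^+ 2 / 8 * u * (g ^+ n * (c5 * rate d p x')).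
      by rewrite /A /c; field.
    apply: ler_wpM2l (beta_rate n); apply: mulr_ge0 (ltW u0).
    by apply: divr_ge0 => //; rewrite mulr_ge0 ?sqr_ge0.
  lra.
pose U := \big[setU/set0]_(n < B.+1) \big[setU/set0]_(l < (L n).+1) E (n : nat, l : nat).
have mE nl : measurable (E nl) by case: (HE nl).
have mU : measurable U by apply: bigsetU_measurable => n _; exact: bigsetU_measurable.
pose S := [set w | (x / (2 * K) <= tail_mean p r N (fun k => X k w))%R].
(* Off [U] and [S] the cells contribute at most x / 8, the sample tail less than x / 2 and the mean
   tail at most x / 16: less than x in all. *)
apply: (@le_trans _ _ (P (U `|` S))).
  apply: le_measure; rewrite ?inE//; first exact: measurableU.
  move=> w /= xT; apply: contrapT => /not_orP[nU nS].
  have disc n l : (n < B.+1)%N -> (l <= L n)%N ->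
     discrepancy (@cell R d) (@annulus R d) mu N (fun k => X k w) n l <= t n l.
    move=> nB lL; apply: ltW; rewrite ltNge; apply/negP => /((HE (n, l)).2 nB lL).2 Ew.
    apply: nU; rewrite /U -bigcup_seq; exists (Ordinal nB); first by rewrite /= mem_index_enum.
    rewrite -bigcup_seq; exists (Ordinal (lL : (l < (L n).+1)%N)) => //.
    by rewrite /= mem_index_enum.
  have pfin : (\int[mu]_z (eucl_norm z `^ p)%:E < +oo)%E.
    have pq01 : 0 <= p <= q by rewrite pq' ltW.
    by apply: (le_lt_trans (integral_norm_le pq01 Hmu)); rewrite ltry.
  have := HK N (fun k => X k w) mu B.+1 L N0 pfin.
  move=> /(le_trans xT); apply/negP; rewrite -ltNge.
  have Kint : (K%:E * \int[mu]_(z in [set z | (B.+1 <= annulus z)%N]) (eucl_norm z `^ p)%:E <=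
      (K * (c1 * x))%:E)%E.
    by rewrite outE EFinM; apply: lee_wpmul2l tailint; rewrite lee_fin ltW.
  apply: (le_lt_trans (leeD (lexx _) Kint)); rewrite -EFinD lte_fin.
  have tailE : \sum_(k < N | (B.+1 <= annulus (X k w))%N) N%:R^-1 * eucl_norm (X k w) `^ p =
     tail_mean p r N (fun k => X k w).
    by rewrite /tail_mean; apply: eq_bigl => k; rewrite annulus_gt.
  rewrite tailE.
  have {}nS : K * tail_mean p r N (fun k => X k w) < x / 2.
    move/negP: nS; rewrite -ltNge ltr_pdivlMr ?mulr_gt0//.
    by set tm := tail_mean _ _ _ _ => ?; lra.
  have main : \sum_(n < B.+1) a ^+ n * (a ^- L n * fine (mu [set z | annulus z = n]) +
      \sum_(l < (L n).+1) a ^- l * discrepancy (@cell R d) (@annulus R d) mu N (fun k => X k w) n l)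
      <= 2 * (c1 * x) * G.
    apply: (@le_trans _ _ (\sum_(n < B.+1) 2 * (c1 * x) * e^-1 ^+ n)); last first.
      rewrite -mulr_sumr ler_wpM2l ?mulr_ge0 ?(ltW c10) ?(ltW xgt)//.
      by apply: geometric_sum_le; case/andP: ei => /ltW -> ->.
    apply: ler_sum => n _; rewrite -mulrA -abey mulrCA ler_wpM2l ?exprn_ge0 ?(ltW a0)//.
    have nB := ltn_ord n; have [L1 L2 L3] := HL n nB.
    rewrite (_ : 2 * _ = beta n * y n + beta n * y n); last by ring.
    apply: lerD.
      by rewrite mulrC; apply: ler_pM; rewrite ?fine_ge0 ?invr_ge0 ?exprn_ge0 ?(ltW a0).
    apply: (@le_trans _ _ (\sum_(l < (L n).+1) a ^- l * t n l)).
      apply: ler_sum => l _; rewrite ler_wpM2l ?invr_ge0 ?exprn_ge0 ?(ltW a0)//.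
      by apply: disc => //; rewrite -ltnS.
    have -> : \sum_(l < (L n).+1) a ^- l * t n l = kap * beta n *
        (Num.sqrt (rate d p (y n)) * \sum_(l < (L n).+1) (D / a) ^+ l).
      rewrite !mulr_sumr; apply: eq_bigr => l _; rewrite /t exprMn exprVn.
      by rewrite !mulrA [LHS]mulrC; ring.
    apply: (@le_trans _ _ (kap * beta n * (C3 * y n))).
      by rewrite ler_wpM2l// ltW// mulr_gt0.
    rewrite /kap (_ : _ * _ * _ = a^-1 * (beta n * y n)); last first.
      by field; rewrite !gt_eqF.
    by rewrite ler_piMl ?invf_le1 ?(ltW a1)// mulr_ge0 ?(ltW (beta0 _)) ?(ltW (ygt _)).
  move: (ler_wpM2l (ltW K0) main) nS Kc1x.
  have : 16 * (K * (2 * (c1 * x) * G)) <= 2 * x.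
    have := ler_wpM2r (ltW xgt) c1KG; rewrite mul1r.
    by rewrite (_ : 16 * (K * (2 * (c1 * x) * G)) = 2 * (16 * (K * G * c1) * x)); [lra|ring].
  rewrite -/a mulrDr; set s1 := K * \sum_(n < _) _; lra.
apply: (le_trans (measureU2 _ _ _)) => //; apply: leeD => //.
apply: (@le_trans _ _ (\sum_(n < B.+1) \sum_(l < (L n).+1) P (E (n : nat, l : nat)))%E).
  apply: (le_trans (measure_bigsetU_le _ _ _)).
    by move=> n; exact: bigsetU_measurable.
  by apply: lee_sum => n _; apply: measure_bigsetU_le.
apply: (@le_trans _ _ (\sum_(n < B.+1) \sum_(l < (L n).+1)
   (expR (- (A * (2 ^ (d * l))%:R * g ^+ n)))%:E)%E).
  apply: lee_sum => n _; apply: lee_sum => l _.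
  by case: ((HE (n : nat, l : nat)).2 (ltn_ord n) _) => //=; rewrite -ltnS.
under eq_bigr do rewrite sumEFin.
rewrite sumEFin lee_fin; apply: (le_trans (HC7 A B.+1 (fun n => (L n).+1) A1)).
by rewrite ler_wpM2r ?expR_ge0// lerDr expR_ge0.
Qed.

End deviation.

(** * Reduction to the tail mean and Bernstein's inequality *)

Section tails.
Context (R : realType) (d : nat).
Local Notation T := (d.-tuple R).

(** For x > x0 no cell is used (B = 0): the p-th moment of [mu] costs at most x / 4, so a deviation
    forces the full mean of |X_k|^p to be large. The parameter [x1] lets x0 be pushed upwards. *)
Lemma reduction_to_tail (p : R) : (0 < d)%N -> 0 < p -> exists2 K : R, 0 < K &
  forall q M x1 : R, 2 * p < q -> 0 <= M ->
  exists C c x0 : R, [/\ 0 < C, 0 < c, 1 <= x0 & x1 <= x0] /\ forall mu : probability T R,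
   (moment q mu <= M%:E)%E ->
   forall (disp : measure_display) (Omega : measurableType disp)
      (P : probability Omega R) (X : nat -> {RV P >-> T}), iid mu X ->
   forall N x, (0 < N)%N -> 0 < x -> exists r : R,
    (\int[mu]_(z in [set z | (r < eucl_norm z)%R]) (eucl_norm z `^ p)%:E <=
       (x / (2 * K) / 2)%:E)%E /\
    (P [set w | (x%:E <= transport_cost p (empirical N (fun k => X k w)) mu)%E] <=
     (if x <= x0 then C * expR (- (c * (N%:R * rate d p (Num.min x 1)))) else 0)%:E +
     P [set w | (x / (2 * K) <= tail_mean p r N (fun k => X k w))%R])%E.
Proof.
move=> d0 p0; have [K K0 HK] := transport_cost_dyadic d p0; exists K => // q M x1 pq M0.
have half : forall I : \bar R, forall x : R, (K%:E * I <= (x / 4)%:E)%E -> (0 <= I)%E ->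
    (I <= (x / (2 * K) / 2)%:E)%E.
  move=> [I| |] x; rewrite ?leeNy_eq//; last by rewrite gt0_muley ?lte_fin.
  rewrite -EFinM !lee_fin => H _.
  rewrite (_ : x / (2 * K) / 2 = x / 4 / K); last by field; rewrite gt_eqF.
  by rewrite ler_pdivlMr// mulrC.
pose x0 := 1 + 4 * (K * (1 + M)) + Num.max x1 0.
have KM : 0 <= K * (1 + M) by rewrite mulr_ge0 ?addr_ge0// ltW.
have m0 : 0 <= Num.max x1 0 by rewrite le_max lexx orbT.
have m1 : x1 <= Num.max x1 0 by rewrite le_max lexx.
have x01 : 1 <= x0 by rewrite /x0; lra.
have [C [c [C0 c0 H]]] := small_deviation d0 p0 pq M0 x01 K0 HK.
exists C, c, x0; split; first by split => //; rewrite /x0; lra.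
move=> mu Hmu disp Omega P X iidX N x N0 xgt.
have [xx0|x0x] := leP x x0.
  have xx : 0 < x <= x0 by rewrite xgt.
  have [r [Hr HP]] := H mu Hmu _ _ _ _ iidX N x N0 xx.
  exists r; split => //; apply: half => //.
  by apply: integral_ge0 => z _; rewrite lee_fin powR_ge0.
have ET : [set z : T | -1 < eucl_norm z] = setT.
  by apply/seteqP; split => z //= _; rewrite (lt_le_trans _ (eucl_norm_ge0 z))// ltrN10.
have pq01 : 0 <= p <= q by rewrite ltW//=; lra.
have pI := integral_norm_le pq01 Hmu.
have KI : (K%:E * \int[mu]_z (eucl_norm z `^ p)%:E <= (x / 4)%:E)%E.
  apply: (@le_trans _ _ (K%:E * (1 + M)%:E)%E).
    by apply: lee_wpmul2l pI; rewrite lee_fin ltW.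
  by rewrite -EFinM lee_fin; move: x0x; rewrite /x0; lra.
(* Radius -1 selects every point, the origin included. *)
exists (-1); rewrite ET; split.
  by apply: half => //; apply: integral_ge0 => z _; rewrite lee_fin powR_ge0.
rewrite add0e; apply: le_measure; rewrite ?inE.
- exact: measurable_transport_event.
- exact: measurable_tail_mean.
move=> w /= xT.
have pfin : (\int[mu]_z (eucl_norm z `^ p)%:E < +oo)%E by rewrite (le_lt_trans pI)// ltry.
have := HK N (fun k => X k w) mu 0%N (fun=> 0%N) N0 pfin.
rewrite big_ord0 add0r (_ : [set z : T | _] = setT); last by apply/seteqP; split.
move=> /(le_trans xT)/le_trans /(_ (leeD (lexx _) KI)).
rewrite -EFinD lee_fin.
have -> : \sum_(k < N | (0 <= annulus (X k w))%N) N%:R^-1 * eucl_norm (X k w) `^ p =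
    tail_mean p (-1) N (fun k => X k w).
  apply: eq_bigl => k; rewrite leq0n; apply/esym.
  by rewrite (lt_le_trans _ (eucl_norm_ge0 _))// ltrN10.
by rewrite ler_pdivrMr ?mulr_gt0//; set tm := tail_mean _ _ _ _; lra.
Qed.

Context (disp : measure_display) (Omega : measurableType disp).
Variables (P : probability Omega R) (mu : probability T R).
Variable X : nat -> {RV P >-> T}.
Hypothesis iidX : iid mu X.

(** The inequality exp z (1 - z) <= 1 multiplied by 1 + z. The remainder z^2 exp z is what the
    weighted second moment [V] will control. *)
Lemma expR_le_taylor (z : R) : 0 <= z -> expR z <= 1 + (z + z ^+ 2 * expR z).
Proof.
move=> z0; have H : expR z * (1 - z) <= 1.
  apply: (@le_trans _ _ (expR z * expR (- z))); last by rewrite expRxMexpNx_1.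
  by rewrite ler_wpM2l ?expR_ge0//; exact: expR_ge1Dx.
have H2 : expR z * (1 - z) * (1 + z) <= 1 * (1 + z) by rewrite ler_wpM2r// addr_ge0.
rewrite -subr_ge0 (_ : _ - _ = 1 * (1 + z) - expR z * (1 - z) * (1 + z)); last by ring.
by rewrite subr_ge0.
Qed.

(** The logarithm of the exponential moment is at most lam theta / 2 + lam^2 V <= (3/4) lam theta,
    which leaves lam theta / 4 per variable. *)
Lemma bernstein_tail (Y : T -> R) (theta V lam : R) N :
  measurable_fun setT Y -> (forall z, 0 <= Y z) -> 0 <= lam -> lam * V <= theta / 4 ->
  (\int[mu]_z (Y z)%:E <= (theta / 2)%:E)%E ->
  (\int[mu]_z (Y z ^+ 2 * expR (lam * Y z))%:E <= V%:E)%E ->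
  (P [set w | (N%:R * theta <= \sum_(k < N) Y (X k w))%R] <=
   (expR (- (N%:R * (lam * theta) / 4)))%:E)%E.
Proof.
move=> mY Y0 lam0 lamV YI VI.
have mYE : measurable_fun setT (fun z => (Y z)%:E) by exact/measurable_EFinP.
have mZ : measurable_fun setT (fun z => lam * Y z) by exact: measurable_funM.
pose W z := Y z ^+ 2 * expR (lam * Y z).
have mW : measurable_fun setT W.
  apply: measurable_funM; first exact: measurable_funX.
  exact: (measurableT_comp (@measurable_expR R)).
have mWE : measurable_fun setT (fun z => (W z)%:E) by exact/measurable_EFinP.
have W0 z : 0 <= W z by rewrite mulr_ge0 ?exprn_ge0 ?expR_ge0.
pose v := lam * (theta / 2) + lam ^+ 2 * V.
have expI : (\int[mu]_z (expR (lam * Y z))%:E <= (expR v)%:E)%E.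
  apply: (@le_trans _ _ (\int[mu]_z (1 + (lam%:E * (Y z)%:E + (lam ^+ 2)%:E * (W z)%:E)))%E).
    apply: ge0_le_integral; [exact: measurableT|by move=> z _; rewrite lee_fin expR_ge0| | |].
    - apply/measurable_EFinP; exact: (measurableT_comp (@measurable_expR R)).
    - apply: emeasurable_funD; first exact: measurable_cst.
      by apply: emeasurable_funD; exact: measurable_funeM.
    - move=> z _; rewrite -!EFinM -!EFinD lee_fin.
      apply: (le_trans (expR_le_taylor (mulr_ge0 lam0 (Y0 z)))).
      by rewrite /W exprMn !mulrA.
  rewrite ge0_integralD; [|exact: measurableT|by []|exact: measurable_cst| |]; last 2 first.
  - by move=> z _; rewrite -!EFinM -EFinD lee_fin addr_ge0// mulr_ge0// sqr_ge0.
  - by apply: emeasurable_funD; exact: measurable_funeM.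
  rewrite integral_cst// [X in (_ * X + _)%E]probability_setT mule1.
  rewrite ge0_integralD; [|exact: measurableT| | | |]; last 4 first.
  - by move=> z _; rewrite -EFinM lee_fin mulr_ge0.
  - exact: measurable_funeM.
  - by move=> z _; rewrite -EFinM lee_fin mulr_ge0// sqr_ge0.
  - exact: measurable_funeM.
  rewrite ge0_integralZl; [|exact: measurableT|exact: mYE|
    by move=> z _; rewrite lee_fin|by rewrite lee_fin].
  rewrite ge0_integralZl; [|exact: measurableT|exact: mWE|
    by move=> z _; rewrite lee_fin|by rewrite lee_fin sqr_ge0].
  apply: (@le_trans _ _ (1 + v)%:E); last by rewrite lee_fin expR_ge1Dx.
  rewrite /v !EFinD !EFinM; apply: leeD => //; apply: leeD.
    by apply: lee_wpmul2l; rewrite ?lee_fin.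
  by rewrite -EFinM -expr2; apply: lee_wpmul2l; rewrite ?lee_fin ?sqr_ge0.
have := iid_chernoff iidX (lam * (N%:R * theta)) N mZ expI.
have mE (u : R) (f : T -> R) : measurable_fun setT f ->
    measurable [set w | u <= \sum_(k < N) f (X k w)].
  move=> mf; have mS : measurable_fun setT (fun w => \sum_(k < N) f (X k w)).
    by apply: measurable_sum => k; exact: (measurableT_comp mf).
  have := @measurable_fun_ler _ _ _ setT (cst u) _ (@measurable_cst _ _ _ _ _ _) mS
    measurableT [set true].
  by rewrite setTI; apply.
move=> H; apply: le_trans; last first.
  apply: (le_trans H); rewrite lee_fin ler_expR.
  have : N%:R * (lam * (lam * V)) <= N%:R * (lam * (theta / 4)) by rewrite !ler_wpM2l.
  by rewrite /v expr2; set nn := N%:R; nra.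
apply: le_measure; rewrite ?inE; [exact: mE|exact: (mE _ (fun z => lam * Y z))|].
by move=> w /=; rewrite -mulr_sumr => ?; rewrite ler_wpM2l.
Qed.

Lemma iid_exists_le (B : set T) N : measurable B ->
  measurable (\big[setU/set0]_(k < N) (X k @^-1` B)) /\
  (P (\big[setU/set0]_(k < N) (X k @^-1` B)) <= N%:R%:E * mu B)%E.
Proof.
move=> mB; have [_ dist] := iidX; have mX k : measurable (X k @^-1` B) by exact: measurable_funPTI.
split; first by apply: bigsetU_measurable.
apply: (le_trans (measure_bigsetU_le _ _ _)) => //.
rewrite (eq_bigr (fun=> mu B)); last by move=> k _; exact: (dist k B mB).
by rewrite sumr_const card_ord mule_natl.
Qed.

(** If some sample point leaves [A], a union bound applies. Otherwise truncation to [A] changes no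
    term of the tail mean, and the truncated variables satisfy the Bernstein bound. *)
Lemma tail_truncated p r (A : set T) (theta V lam : R) N :
  (0 < N)%N -> measurable A -> 0 <= lam -> lam * V <= theta / 4 ->
  (\int[mu]_(z in [set z | (r < eucl_norm z)%R]) (eucl_norm z `^ p)%:E <= (theta / 2)%:E)%E ->
  (\int[mu]_(z in A) (eucl_norm z `^ p ^+ 2 * expR (lam * eucl_norm z `^ p))%:E <= V%:E)%E ->
  (P [set w | (theta <= tail_mean p r N (fun k => X k w))%R] <=
   (expR (- (N%:R * (lam * theta) / 4)))%:E + N%:R%:E * mu (~` A))%E.
Proof.
move=> N0 mA lam0 lamV HI HV.
have NR : 0 < N%:R :> R by rewrite ltr0n.
pose D := A `&` [set z : T | r < eucl_norm z].
have mr : measurable [set z : T | r < eucl_norm z] by exact: measurable_norm_gt.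
have mD : measurable D by exact: measurableI.
have mN : measurable_fun setT (fun z : T => eucl_norm z `^ p).
  exact: (measurableT_comp (measurable_powR p) (@measurable_eucl_norm R d)).
pose Y z := eucl_norm z `^ p * \1_D z : R.
have Y0 z : 0 <= Y z by rewrite mulr_ge0 ?powR_ge0.
have mY : measurable_fun setT Y by apply: measurable_funM => //; exact: measurable_indic.
have YI : (\int[mu]_z (Y z)%:E <= (theta / 2)%:E)%E.
  apply: le_trans HI; rewrite [leRHS]integral_mkcond.
  apply: ge0_le_integral; [exact: measurableT|by move=> z _; rewrite lee_fin|
    exact/measurable_EFinP| |].
    apply/(measurable_restrictT _ mr); apply: measurable_funTS; exact/measurable_EFinP.
  move=> z _; rewrite patchE /Y indicE; case: ifPn => zr.
    by rewrite lee_fin ler_piMr ?powR_ge0//; case: (z \in D).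
  rewrite (_ : z \in D = false) ?mulr0//; apply/negP; rewrite inE => -[_ /mem_set].
  by apply/negP.
have VI : (\int[mu]_z (Y z ^+ 2 * expR (lam * Y z))%:E <= V%:E)%E.
  apply: le_trans HV; rewrite [leRHS]integral_mkcond.
  apply: ge0_le_integral; [exact: measurableT| | | |].
  - by move=> z _; rewrite lee_fin mulr_ge0 ?sqr_ge0 ?expR_ge0.
  - apply/measurable_EFinP/measurable_funM; first exact: measurable_funX.
    by apply: (measurableT_comp (@measurable_expR R)); exact: measurable_funM.
  - apply/(measurable_restrictT _ mA); apply: measurable_funTS.
    apply/measurable_EFinP/measurable_funM; first exact: measurable_funX.
    by apply: (measurableT_comp (@measurable_expR R)); exact: measurable_funM.
  - move=> z _; rewrite patchE /Y indicE; have [zD|zD] := boolP (z \in D).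
      have -> : z \in A by move: zD; rewrite !inE => -[].
      by rewrite mulr1.
    rewrite mulr0 expr0n/= mul0r; case: ifP => // _.
    by rewrite lee_fin mulr_ge0 ?sqr_ge0 ?expR_ge0.
have H := bernstein_tail N mY Y0 lam0 lamV YI VI.
have [mU HU] := iid_exists_le N (measurableC mA).
have mE : measurable [set w | N%:R * theta <= \sum_(k < N) Y (X k w)].
  have mS : measurable_fun setT (fun w => \sum_(k < N) Y (X k w)).
    by apply: measurable_sum => k; exact: (measurableT_comp mY).
  have := @measurable_fun_ler _ _ _ setT (cst (N%:R * theta)) _
    (@measurable_cst _ _ _ _ _ _) mS measurableT [set true].
  by rewrite setTI; apply.
apply: le_trans (leeD H HU); apply: le_trans (measureU2 _ mE mU).
apply: le_measure; rewrite ?inE.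
- exact: measurable_tail_mean.
- exact: measurableU.
move=> w /= Hw.
have [[k Xk]|nA] := pselect (exists k : 'I_N, ~ A (X k w)).
  right; rewrite -bigcup_seq; exists k => //=; exact: mem_index_enum.
left; apply: (@le_trans _ _ (N%:R * tail_mean p r N (fun k => X k w))).
  by rewrite ler_wpM2l.
rewrite /tail_mean big_mkcond mulr_sumr; apply: ler_sum => k _.
have AX : A (X k w) by apply: contrapT => nAk; apply: nA; exists k.
case: ifPn => rk; last by rewrite mulr0.
rewrite mulVKf ?gt_eqF// /Y indicE mem_set ?mulr1//.
Qed.

End tails.

(** With y = t^al, the power y^(s/al) is at most 1 + y^m for an integer m > s/al, and y^m is
    controlled by the term of degree m of the exponential series. *)
Lemma powR_le_expR (R : realType) (s ga al : R) : 0 <= s -> 0 < ga -> 0 < al ->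
  exists2 C : R, 0 < C & forall t, 0 <= t -> t `^ s <= C * expR (ga * t `^ al).
Proof.
move=> s0 ga0 al0; pose n := Num.truncn (s / al); pose m := n.+1.
have sm : s / al <= m%:R by rewrite ltW// truncnS_gt.
have gm : 0 < ga ^+ m by rewrite exprn_gt0.
have f0 : 0 < m`!%:R :> R by rewrite ltr0n fact_gt0.
have C0 : 0 < 1 + m`!%:R / ga ^+ m by rewrite addr_gt0// divr_gt0.
exists (1 + m`!%:R / ga ^+ m) => // t t0.
pose y := t `^ al; have y0 : 0 <= y by rewrite powR_ge0.
have w0 : 0 <= ga * y by rewrite mulr_ge0// ltW.
have e1 : 1 <= expR (ga * y) by rewrite (le_trans _ (expR_ge1Dx _))// lerDl.
have tE : t `^ s = y `^ (s / al) by rewrite /y -powRrM mulrCA divff ?mulr1// gt_eqF.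
have ypow : y `^ (s / al) <= 1 + y ^+ m.
  have [y1|y1] := leP y 1.
    apply: (@le_trans _ _ 1); last by rewrite lerDl exprn_ge0.
    have sal : 0 <= s / al by rewrite divr_ge0// ltW.
    have := @ge0_ler_powR R _ sal y 1; rewrite !nnegrE powR1; exact.
  apply: (@le_trans _ _ (y ^+ m)); last by rewrite lerDr.
  by rewrite -powR_mulrn// ler_powR// ltW.
rewrite tE; apply: (le_trans ypow); rewrite mulrDl mul1r lerD//.
have H : ga ^+ m * y ^+ m <= m`!%:R * expR (ga * y).
  have : (ga * y) ^+ m / m`!%:R <= expR (ga * y).
    by apply: le_trans (expR_ge1Dxn n w0); rewrite lerDr.
  by rewrite ler_pdivrMr// exprMn [leRHS]mulrC.
by rewrite mulrAC ler_pdivlMr// mulrC.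
Qed.

Section transport_deviation_split.
Context (R : realType) (d : nat).
Local Notation T := (d.-tuple R).

Lemma measurable_expR_norm (al ga : R) :
  measurable_fun setT (fun z : T => expR (ga * eucl_norm z `^ al)).
Proof.
apply: (measurableT_comp (@measurable_expR R)); apply: measurable_funM => //.
exact: (measurableT_comp (measurable_powR al) (@measurable_eucl_norm R d)).
Qed.

Lemma measurable_sqr_expR_norm (p ga : R) :
  measurable_fun setT (fun z : T => eucl_norm z `^ p ^+ 2 * expR (ga * eucl_norm z `^ p)).
Proof.
apply: measurable_funM; last exact: measurable_expR_norm.
apply: measurable_funX.
exact: (measurableT_comp (measurable_powR p) (@measurable_eucl_norm R d)).
Qed.

Lemma expR_min_le (x y : R) : expR (- Num.min x y) <= expR (- x) + expR (- y).
Proof.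
by have [_|_] := leP x y; rewrite ?lerDl ?lerDr expR_ge0.
Qed.

(** The Bernstein parameter is the smaller of theta / (4 V), imposed by the variance, and [lam1],
    imposed by integrability on [A]. The first yields the Gaussian term, the second the exponent
    proportional to N x lam1. *)
Lemma transport_deviation_split (p : R) : (0 < d)%N -> 0 < p -> exists2 K : R, 0 < K &
  forall q M x1 V : R, 2 * p < q -> 0 <= M -> 0 < V ->
  exists C c c1 x0 : R, [/\ 0 < C, 0 < c, 0 < c1, 1 <= x0 & x1 <= x0] /\
   forall mu : probability T R, (moment q mu <= M%:E)%E ->
   forall (disp : measure_display) (Omega : measurableType disp)
      (P : probability Omega R) (X : nat -> {RV P >-> T}), iid mu X ->
   forall N x, (0 < N)%N -> 0 < x ->
    (x0 < x -> exists r : R,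
      (P [set w | (x%:E <= transport_cost p (empirical N (fun k => X k w)) mu)%E] <=
       P [set w | (x / (2 * K) <= tail_mean p r N (fun k => X k w))%R])%E) /\
    forall (A : set T) (lam1 : R), measurable A -> 0 <= lam1 ->
     (\int[mu]_(z in A) (eucl_norm z `^ p ^+ 2 * expR (lam1 * eucl_norm z `^ p))%:E
       <= V%:E)%E ->
     (P [set w | (x%:E <= transport_cost p (empirical N (fun k => X k w)) mu)%E] <=
     ((if x <= x0 then C * expR (- (c * (N%:R * rate d p (Num.min x 1)))) else 0) +
      (expR (- (c1 * (N%:R * x ^+ 2))) + expR (- (N%:R * x * lam1 / (8 * K)))))%:E +
     N%:R%:E * mu (~` A))%E.
Proof.
move=> d0 p0; have [K K0 HK] := reduction_to_tail d0 p0; exists K => //.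
move=> q M x1 V pq M0 V0.
have [C [c [x0 [[C0 c0 x01 x1x0] H]]]] := HK q M x1 pq M0.
(* From N theta / 4 times theta / (4 V), with theta = x / (2 K). *)
pose c1 := (64 * K ^+ 2 * V)^-1.
have c10 : 0 < c1 by rewrite invr_gt0 !mulr_gt0// exprn_gt0.
exists C, c, c1, x0; split => // mu Hmu disp Omega P X iidX N x N0 xgt.
have [r [Hr HP]] := H mu Hmu _ _ _ _ iidX N x N0 xgt; split.
  move=> x0x; exists r; have xf : (x <= x0) = false by exact: lt_geF.
  by move: HP; rewrite xf add0e.
move=> A lam1 mA lam10 HV; apply: (le_trans HP); rewrite EFinD -addeA; apply: leeD => //.
pose theta := x / (2 * K); have theta0 : 0 < theta by rewrite divr_gt0// mulr_gt0.
pose lam := Num.min (theta / (4 * V)) lam1.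
have lam0 : 0 <= lam by rewrite le_min lam10 andbT ltW// divr_gt0// mulr_gt0.
have lamV : lam * V <= theta / 4.
  apply: (@le_trans _ _ (theta / (4 * V) * V)); last first.
    by rewrite le_eqVlt; apply/orP; left; apply/eqP; field; rewrite gt_eqF.
  by rewrite ler_pM2r// ge_min lexx.
have lam_le : lam <= lam1 by rewrite ge_min lexx orbT.
have mf (l : R) : measurable_fun A
    (fun z : T => (eucl_norm z `^ p ^+ 2 * expR (l * eucl_norm z `^ p))%:E).
  by apply: measurable_funTS; apply/measurable_EFinP; exact: measurable_sqr_expR_norm.
have HV' : (\int[mu]_(z in A) (eucl_norm z `^ p ^+ 2 * expR (lam * eucl_norm z `^ p))%:E
    <= V%:E)%E.
  apply: le_trans HV; apply: ge0_le_integral; [exact: mA| |exact: mf|exact: mf|].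
    by move=> z _; rewrite lee_fin mulr_ge0 ?sqr_ge0 ?expR_ge0.
  move=> z _; rewrite lee_fin ler_wpM2l ?sqr_ge0// ler_expR.
  by rewrite ler_wpM2r ?powR_ge0.
apply: (le_trans (tail_truncated iidX N0 mA lam0 lamV Hr HV')).
apply: leeD => //; rewrite lee_fin.
have NR : 0 < N%:R :> R by rewrite ltr0n.
have k0 : 0 < N%:R * theta / 4 by rewrite divr_gt0// mulr_gt0.
have -> : N%:R * (lam * theta) / 4 = Num.min (c1 * (N%:R * x ^+ 2)) (N%:R * x * lam1 / (8 * K)).
  have -> : N%:R * (lam * theta) / 4 = (N%:R * theta / 4) * lam by ring.
  rewrite /lam minr_pMr ?(ltW k0)//; congr Num.min.
    by rewrite /c1 /theta; field; rewrite !gt_eqF.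
  by rewrite /theta; field; rewrite !gt_eqF.
exact: expR_min_le.
Qed.

End transport_deviation_split.

Section transport_deviation.
Context (R : realType) (d : nat).
Local Notation T := (d.-tuple R).

Lemma ge0_integral_subset_le (mu : probability T R) (f g : T -> R) (A : set T) (c E : R) :
  measurable A -> measurable_fun setT f -> measurable_fun setT g ->
  (forall z, 0 <= f z) -> (forall z, 0 <= g z) -> 0 <= c ->
  (forall z, A z -> f z <= c * g z) -> (\int[mu]_z (g z)%:E <= E%:E)%E ->
  (\int[mu]_(z in A) (f z)%:E <= (c * E)%:E)%E.
Proof.
move=> mA mf mg f0 g0 c0 fg gE.
have mgE : measurable_fun setT (fun z => (g z)%:E) by exact/measurable_EFinP.
apply: (@le_trans _ _ (\int[mu]_(z in A) (c%:E * (g z)%:E))%E).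
  apply: ge0_le_integral; [exact: mA|by move=> z _; rewrite lee_fin| | |].
  - by apply: measurable_funTS; exact/measurable_EFinP.
  - by apply: measurable_funTS; exact: measurable_funeM.
  - by move=> z Az; rewrite -EFinM lee_fin; exact: fg.
rewrite ge0_integralZl; [|exact: mA|exact: measurable_funTS|
  by move=> z _; rewrite lee_fin|by rewrite lee_fin].
rewrite EFinM; apply: lee_wpmul2l; first by rewrite lee_fin.
by apply: le_trans gE; apply: ge0_subset_integral => // z _; rewrite lee_fin.
Qed.

Lemma ler_expRN (x y : R) : x <= y -> expR (- y) <= expR (- x).
Proof. by move=> xy; rewrite ler_expR lerN2. Qed.

(** Merges two exponentials: for x <= 1 the Gaussian one is absorbed by [rate]; for x > 1 both decay
    at least like exp(-c N x), since x <= x0 in the one and x^2 >= x in the other. *)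
Lemma transport_deviation (p : R) : (0 < d)%N -> 0 < p -> exists2 K : R, 0 < K &
  forall q M x1 V : R, 2 * p < q -> 0 <= M -> 0 < V ->
  exists C c x0 : R, [/\ 0 < C, 0 < c, 1 <= x0 & x1 <= x0] /\
   forall mu : probability T R, (moment q mu <= M%:E)%E ->
   forall (disp : measure_display) (Omega : measurableType disp)
      (P : probability Omega R) (X : nat -> {RV P >-> T}), iid mu X ->
   forall N x, (0 < N)%N -> 0 < x ->
    (x0 < x -> exists r : R,
      (P [set w | (x%:E <= transport_cost p (empirical N (fun k => X k w)) mu)%E] <=
       P [set w | (x / (2 * K) <= tail_mean p r N (fun k => X k w))%R])%E) /\
    forall (A : set T) (lam : R), measurable A -> 0 <= lam ->
     (\int[mu]_(z in A) (eucl_norm z `^ p ^+ 2 * expR (lam * eucl_norm z `^ p))%:E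
       <= V%:E)%E ->
     (P [set w | (x%:E <= transport_cost p (empirical N (fun k => X k w)) mu)%E] <=
     (C * expR (- (c * (N%:R * if x <= 1 then rate d p x else x))) +
      expR (- (N%:R * x * lam / (8 * K))))%:E + N%:R%:E * mu (~` A))%E.
Proof.
move=> d0 p0; have [K K0 HK] := transport_deviation_split d0 p0; exists K => //.
move=> q M x1 V pq M0 V0.
have [C [c [c1 [x0 [[C0 c0 c10 x01 x1x0] H]]]]] := HK q M x1 V pq M0 V0.
have [C4 C40 rle] := @rate_le_sqr R d p p0.
have r0 : 0 < rate d p 1 by exact: rate_gt0.
have x00 : 0 < x0 by exact: lt_le_trans x01.
pose c' := Num.min (Num.min c (c1 / C4)) (Num.min (c * rate d p 1 / x0) c1).
have c'0 : 0 < c' by rewrite !lt_min c0 c10 !divr_gt0// mulr_gt0.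
exists (C + 1), c', x0; split; first by split => //; rewrite addr_gt0.
move=> mu Hmu disp Omega P X iidX N x N0 xgt.
have [H1 H2] := H mu Hmu _ _ _ _ iidX N x N0 xgt; split=> // A lam mA lam0 HV.
apply: (le_trans (H2 A lam mA lam0 HV)); apply: leeD => //; rewrite lee_fin addrA lerD2r.
have NR : 0 < N%:R :> R by rewrite ltr0n.
set e := expR (- (c' * _)).
have e0 : 0 < e by exact: expR_gt0.
have [c'1 c'2 c'3 c'4] : [/\ c' <= c, c' <= c1 / C4, c' <= c * rate d p 1 / x0 & c' <= c1].
  by split; rewrite /c' !ge_min lexx ?orbT.
have E1 : (if x <= x0 then C * expR (- (c * (N%:R * rate d p (Num.min x 1)))) else 0) <= C * e.
  case: ifP => xx0; last by rewrite mulr_ge0// ltW.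
  rewrite ler_pM2l// /e; apply: ler_expRN; have [x1'|x1'] := leP x 1.
    by rewrite ler_wpM2r// mulr_ge0 ?(ltW NR)// ltW// rate_gt0.
  apply: (@le_trans _ _ (c * rate d p 1 / x0 * (N%:R * x))).
    by rewrite ler_wpM2r// mulr_ge0// ltW.
  have -> : c * rate d p 1 / x0 * (N%:R * x) = c * (N%:R * rate d p 1) * (x / x0).
    by field; rewrite gt_eqF.
  by rewrite ler_piMr ?ler_pdivrMr ?mul1r// !mulr_ge0// ltW.
have E2 : expR (- (c1 * (N%:R * x ^+ 2))) <= e.
  rewrite /e; apply: ler_expRN; case: ifP => x1'.
    apply: (@le_trans _ _ (c1 / C4 * (N%:R * (C4 * x ^+ 2)))); last first.
      by rewrite le_eqVlt; apply/orP; left; apply/eqP; field; rewrite gt_eqF.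
    apply: ler_pM; rewrite ?(ltW c'0)//.
      by rewrite mulr_ge0 ?(ltW NR)// ltW// rate_gt0.
    by rewrite ler_pM2l// rle// xgt.
  have xgt1 : 1 < x by rewrite ltNge x1'.
  apply: ler_pM; rewrite ?(ltW c'0)//; first by rewrite mulr_ge0// ltW.
  by rewrite ler_pM2l// expr2 ler_pMr// ltW.
by rewrite mulrDl mul1r lerD.
Qed.

Lemma exp_moment_le_moment (mu : probability T R) (al ga s C E : R) : 0 <= C ->
  (forall t, 0 <= t -> t `^ s <= C * expR (ga * t `^ al)) ->
  (exp_moment al ga mu <= E%:E)%E -> (moment s mu <= (C * E)%:E)%E.
Proof.
move=> C0 H; rewrite /exp_moment /moment => HE.
apply: (@ge0_integral_subset_le mu (fun z => eucl_norm z `^ s)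
  (fun z => expR (ga * eucl_norm z `^ al))) => //.
- exact: (measurableT_comp (measurable_powR s) (@measurable_eucl_norm R d)).
- exact: measurable_expR_norm.
- by move=> z; rewrite powR_ge0.
- by move=> z _; apply: H; rewrite eucl_norm_ge0.
Qed.

End transport_deviation.

(** * The three moment conditions *)

Section superexponential_case.
Context (R : realType) (d : nat).
Local Notation T := (d.-tuple R).

(** A line below the power s^rho, with value h^rho at s = 2 h. Summed over the sample it does the
    work of Jensen's inequality. *)
Lemma powR_ge_slope (rho h s : R) : 1 <= rho -> 0 < h -> 0 <= s ->
  h `^ (rho - 1) * (s - h) <= s `^ rho.
Proof.
move=> rho1 h0 s0; have rho10 : 0 <= rho - 1 by rewrite subr_ge0.
have [sh|hs] := leP s h.
  by apply: (@le_trans _ _ 0); rewrite ?powR_ge0// mulr_ge0_le0 ?powR_ge0// subr_le0.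
have s1 : 0 < s by exact: lt_trans hs.
have -> : s `^ rho = s `^ (rho - 1) * s.
  rewrite -[X in _ * X](@powRr1 _ s)// -powRD ?subrK//.
  by apply/implyP => _; rewrite gt_eqF.
apply: ler_pM; rewrite ?powR_ge0 ?subr_ge0 ?(ltW hs)//; last by rewrite gerBl ltW.
by rewrite ge0_ler_powR ?nnegrE ?(ltW h0)// ltW.
Qed.

(** If the mean of |X_k|^p is at least 2 h, the linear minorant shows that the mean of |X_k|^al is
    at least h^(al/p), and the Chernoff bound applies to the latter. *)
Lemma tail_mean_chernoff (mu : probability T R) (disp : measure_display)
    (Omega : measurableType disp) (P : probability Omega R) (X : nat -> {RV P >-> T})
    (p al ga v h r : R) N : iid mu X -> 0 < p -> p < al -> 0 < ga -> 0 < h -> (0 < N)%N ->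
  (exp_moment al ga mu <= (expR v)%:E)%E ->
  (P [set w | (2 * h <= tail_mean p r N (fun k => X k w))%R] <=
   (expR (N%:R * v - N%:R * (ga * h `^ (al / p))))%:E)%E.
Proof.
move=> iidX p0 pal ga0 h0 N0 Hv.
have NR : 0 < N%:R :> R by rewrite ltr0n.
have mZ : measurable_fun setT (fun z : T => ga * eucl_norm z `^ al).
  apply: measurable_funM => //.
  exact: (measurableT_comp (measurable_powR al) (@measurable_eucl_norm R d)).
apply: le_trans (iid_chernoff iidX (N%:R * (ga * h `^ (al / p))) N mZ Hv).
apply: le_measure; rewrite ?inE.
- exact: measurable_tail_mean.
- have mS : measurable_fun setT (fun w => \sum_(k < N) ga * eucl_norm (X k w) `^ al).
    by apply: measurable_sum => k; exact: (measurableT_comp mZ).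
  have := @measurable_fun_ler _ _ _ setT (cst (N%:R * (ga * h `^ (al / p)))) _
    (@measurable_cst _ _ _ _ _ _) mS measurableT [set true].
  by rewrite setTI; apply.
move=> w /= Hw; have rho1 : 1 <= al / p by rewrite ler_pdivlMr// mul1r ltW.
have S1 : N%:R * (2 * h) <= \sum_(k < N) eucl_norm (X k w) `^ p.
  rewrite mulrC -ler_pdivlMr//; apply: (le_trans Hw); rewrite /tail_mean -mulr_sumr mulrC.
  rewrite ler_pM2r ?invr_gt0// [leRHS](bigID (fun k : 'I_N => r < eucl_norm (X k w)))/=.
  by rewrite lerDl sumr_ge0// => k _; rewrite powR_ge0.
apply: (@le_trans _ _ (\sum_(k < N) ga * (h `^ (al / p - 1) * (eucl_norm (X k w) `^ p - h)))).
  rewrite -!mulr_sumr sumrB sumr_const card_ord -mulr_natl mulrCA ler_pM2l//.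
  have -> : h `^ (al / p) = h `^ (al / p - 1) * h.
    rewrite -[X in _ = _ * X](@powRr1 _ h) ?ltW// -powRD ?subrK//.
    by apply/implyP => _; rewrite gt_eqF.
  rewrite mulrCA ler_pM2l ?powR_gt0//; lra.
apply: ler_sum => k _; rewrite ler_pM2l//.
have -> : eucl_norm (X k w) `^ al = eucl_norm (X k w) `^ p `^ (al / p).
  by rewrite -powRrM mulrCA divff ?mulr1// gt_eqF.
by apply: powR_ge_slope; rewrite ?powR_ge0.
Qed.

(** On the bounded range 1 < x <= x0 all exponents are comparable with N, so the Bernstein bound
    still suffices there; only x > x0 calls for the Chernoff bound on |X_k|^al. *)
Lemma deviation_bound_superexponential (p al ga E : R) : (0 < d)%N -> 0 < p -> p < al ->
  0 < ga -> exists C c : R, [/\ 0 < C, 0 < c &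
    forall mu : probability T R, exp_moment al ga mu = E%:E ->
      deviation_bound p mu (bound_a d p C c) (bound_b1 p al C c)].
Proof.
move=> d0 p0 pal ga0; have [K K0 HK] := @transport_deviation R d p d0 p0.
have al0 : 0 < al by exact: lt_trans pal.
have g2 : 0 < ga / 2 by rewrite divr_gt0.
have p20 : 0 <= 2 * p by rewrite mulr_ge0// ltW.
have p21 : 0 <= 2 * p + 1 by rewrite addr_ge0.
have [C2 C20 HC2] := powR_le_expR p20 g2 al0.
have [C3 C30 HC3] := powR_le_expR p21 ga0 al0.
pose E' := Num.max E 1.
have E'1 : 1 <= E' by rewrite le_max lexx orbT.
have E'0 : 0 < E' by exact: lt_le_trans E'1.
have [C4 C40 rle] := @rate_le_sqr R d p p0.
pose V := C2 * expR (ga / 2) * E'.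
have V0 : 0 < V by rewrite !mulr_gt0// expR_gt0.
have pq : 2 * p < 2 * p + 1 by rewrite ltrDl.
have M0 : 0 <= C3 * E' by rewrite mulr_ge0// ltW.
pose v := ln E'; have v0 : 0 <= v by rewrite ln_ge0.
(* Beyond it h = x / (4 K) satisfies 2 v / ga <= h <= h^(al/p), so N v uses at most half of the
   exponent N ga h^(al/p). *)
pose x1 := 4 * K * (1 + 2 * v / ga).
have [C [c [x0 [[C0 c0 x01 x1x0] H]]]] := HK (2 * p + 1) (C3 * E') x1 V pq M0 V0.
have x00 : 0 < x0 by exact: lt_le_trans x01.
pose rho := al / p; have rho1 : 1 <= rho by rewrite ler_pdivlMr// mul1r ltW.
have rho0 : 0 <= rho by exact: le_trans rho1.
have xr0 : 0 < x0 `^ rho by rewrite powR_gt0.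
pose g := ga / 2 / (8 * K); have g0 : 0 < g by rewrite divr_gt0// mulr_gt0.
pose k := ga / 2 / (4 * K) `^ rho.
have K4 : 0 < 4 * K by rewrite mulr_gt0.
have k0 : 0 < k by rewrite divr_gt0// powR_gt0.
pose c' := Num.min (Num.min c (g / C4)) (Num.min (Num.min c g / x0 `^ rho) k).
have cg0 : 0 < Num.min c g by rewrite lt_min c0.
have c'0 : 0 < c' by rewrite !lt_min c0 k0 (divr_gt0 g0 C40) (divr_gt0 cg0 xr0).
have [c'1 c'2 c'3 c'4] : [/\ c' <= c, c' <= g / C4, c' <= Num.min c g / x0 `^ rho & c' <= k].
  by split; rewrite /c' !ge_min lexx ?orbT.
exists (C + 1), c'; split => //; first by rewrite addr_gt0.
move=> mu HE disp Omega P X iidX N x N0 xgt.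
have HE' : (exp_moment al ga mu <= E'%:E)%E by rewrite HE lee_fin le_max lexx.
have Hmu : (moment (2 * p + 1) mu <= (C3 * E')%:E)%E.
  by apply: exp_moment_le_moment HE' => //; exact: ltW.
have NR : 0 < N%:R :> R by rewrite ltr0n.
have NR1 : 1 <= N%:R :> R by rewrite ler1n.
have [H1 H2] := H mu Hmu _ _ _ _ iidX N x N0 xgt.
(* As |z|^p <= 1 + |z|^al, half of the exponential moment bounds exp(ga / 2 |z|^p) and the other
   half absorbs |z|^(2p). *)
have HV : (\int[mu]_(z in [set: T])
    (eucl_norm z `^ p ^+ 2 * expR (ga / 2 * eucl_norm z `^ p))%:E <= V%:E)%E.
  apply: (@ge0_integral_subset_le _ _ mu
    (fun z => eucl_norm z `^ p ^+ 2 * expR (ga / 2 * eucl_norm z `^ p))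
    (fun z => expR (ga * eucl_norm z `^ al))) => //.
  - exact: measurable_sqr_expR_norm.
  - exact: measurable_expR_norm.
  - by move=> z; rewrite mulr_ge0 ?sqr_ge0 ?expR_ge0.
  - by rewrite mulr_ge0 ?expR_ge0// ltW.
  move=> z _; set t := eucl_norm z; have t0 : 0 <= t by exact: eucl_norm_ge0.
  have -> : t `^ p ^+ 2 = t `^ (2 * p) by rewrite -powR_mulrn ?powR_ge0// -powRrM mulrC.
  have tp : t `^ p <= 1 + t `^ al.
    have [t1|t1] := leP t 1.
      apply: (@le_trans _ _ 1); last by rewrite lerDl powR_ge0.
      have := @ge0_ler_powR R p (ltW p0) t 1; rewrite !nnegrE powR1; exact.
    by apply: (@le_trans _ _ (t `^ al)); [rewrite ler_powR// ltW|rewrite lerDr].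
  apply: (@le_trans _ _ (C2 * expR (ga / 2 * t `^ al) * expR (ga / 2 * (1 + t `^ al)))).
    apply: ler_pM; rewrite ?powR_ge0 ?expR_ge0//; first exact: HC2.
    by rewrite ler_expR ler_pM2l.
  rewrite le_eqVlt -!mulrA -!expRD; apply/orP; left; apply/eqP; congr (_ * expR _).
  by field.
have H3 := H2 setT (ga / 2) measurableT (ltW g2) HV.
rewrite setCT measure0 mule0 adde0 in H3.
have gE : N%:R * x * (ga / 2) / (8 * K) = g * (N%:R * x) by rewrite /g; ring.
rewrite gE {gE} in H3.
have b0 : 0 <= C + 1 by rewrite addr_ge0// ltW.
have [x1'|x1'] := leP x 1.
  apply: (le_trans H3); rewrite lee_fin x1' /= mulr1 bound_aE /bound_b1 ltNge x1'/= !mulr0 addr0.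
  have rx0 : 0 <= rate d p x by rewrite ltW// rate_gt0.
  rewrite mulrDl mul1r; apply: lerD.
    rewrite ler_pM2l//; apply: ler_expRN; rewrite ler_wpM2r// mulr_ge0// ltW//.
  apply: ler_expRN; apply: (@le_trans _ _ (g / C4 * (N%:R * (C4 * x)))); last first.
    by rewrite le_eqVlt; apply/orP; left; apply/eqP; field; rewrite gt_eqF.
  apply: ler_pM; rewrite ?(ltW c'0) ?mulr_ge0 ?(ltW NR)//.
  rewrite ler_pM2l//; apply: (le_trans (rle x _)); first by rewrite xgt.
  by rewrite ler_pM2l// expr2 ler_piMr// ltW.
rewrite /= mulr0 add0r /bound_b1 x1' mulr1 !mulNr -mulrA.
rewrite (lt_geF x1') in H3.
have [xx0|xx0] := leP x x0.
  apply: (le_trans H3); rewrite lee_fin.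
  have Hc : c' * (N%:R * x `^ rho) <= Num.min c g * (N%:R * x).
    apply: (@le_trans _ _ (Num.min c g / x0 `^ rho * (N%:R * x0 `^ rho))).
      apply: ler_pM; rewrite ?(ltW c'0) ?mulr_ge0 ?powR_ge0 ?(ltW NR)//.
      by rewrite ler_pM2l// ge0_ler_powR ?nnegrE ?(ltW x00) ?(ltW xgt).
    have -> : Num.min c g / x0 `^ rho * (N%:R * x0 `^ rho) = Num.min c g * N%:R.
      by field; rewrite gt_eqF.
    by rewrite ler_pM2l// ler_peMr// ltW.
  have Nx : 0 <= N%:R * x by rewrite mulr_ge0// ltW.
  rewrite mulrDl mul1r; apply: lerD.
    rewrite ler_pM2l//; apply: ler_expRN; apply: (le_trans Hc).
    by rewrite ler_wpM2r// ge_min lexx.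
  by apply: ler_expRN; apply: (le_trans Hc); rewrite ler_wpM2r// ge_min lexx orbT.
have [r Hr] := H1 xx0; apply: (le_trans Hr).
pose h := x / (4 * K); have h0 : 0 < h by rewrite divr_gt0.
have hE : x / (2 * K) = 2 * h by rewrite /h; field; rewrite gt_eqF.
have Hv : (exp_moment al ga mu <= (expR v)%:E)%E by rewrite /v lnK.
rewrite hE; apply: (le_trans (tail_mean_chernoff r iidX p0 pal ga0 h0 N0 Hv)).
rewrite lee_fin -/rho; apply: (@le_trans _ _ (1 * expR (- (c' * (N%:R * x `^ rho))))); last first.
  by rewrite ler_wpM2r ?expR_ge0// lerDr ltW.
rewrite mul1r ler_expR.
have hv : 1 + 2 * v / ga <= h.
  by rewrite ler_pdivlMr// mulrC (le_trans x1x0)// ltW.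
have h1 : 1 <= h by apply: le_trans hv; rewrite lerDl divr_ge0 ?mulr_ge0// ltW.
have hr : 2 * v / ga <= h `^ rho.
  apply: (@le_trans _ _ h); first by apply: le_trans hv; rewrite lerDr.
  by rewrite -[leLHS]powRr1 ?ler_powR// ltW.
rewrite ler_pdivrMr// in hr.
have kE : k * x `^ rho = ga / 2 * h `^ rho.
  have -> : h `^ rho = x `^ rho * ((4 * K) `^ rho)^-1.
    rewrite /h powRM ?(ltW xgt) ?invr_ge0 ?(ltW K4)//; congr (_ * _).
    by rewrite -(@powR_inv1 _ (4 * K)) ?(ltW K4)// -powRrM mulN1r powRN.
  by rewrite /k; ring.
have : c' * (N%:R * x `^ rho) <= N%:R * (ga / 2 * h `^ rho).
  by rewrite -kE mulrCA ler_pM2l// ler_wpM2r ?powR_ge0.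
have : N%:R * (2 * v) <= N%:R * (h `^ rho * ga) by rewrite ler_pM2l.
lra.
Qed.

End superexponential_case.

(** * Case (2): exponential moment with alpha < p *)

Section subexponential_case.
Context (R : realType) (d : nat).
Local Notation T := (d.-tuple R).

Lemma measurable_norm_powR_le (p u : R) : measurable [set z : T | eucl_norm z `^ p <= u].
Proof.
have mN := measurableT_comp (measurable_powR p) (@measurable_eucl_norm R d).
have := @measurable_fun_ler _ _ _ setT _ (cst u) mN (@measurable_cst _ _ _ _ _ _)
  measurableT [set true].
by rewrite setTI; apply.
Qed.

Lemma measure_norm_powR_gt_expR (mu : probability T R) (p al ga u E : R) :
  0 < p -> 0 < al -> 0 <= ga -> 0 <= u -> (exp_moment al ga mu <= E%:E)%E ->
  (mu (~` [set z | (eucl_norm z `^ p <= u)%R]) <= (expR (- (ga * u `^ (al / p))) * E)%:E)%E.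
Proof.
move=> p0 al0 ga0 u0 HE.
have mA : measurable (~` [set z : T | eucl_norm z `^ p <= u]).
  by apply: measurableC; exact: measurable_norm_powR_le.
rewrite -(mul1e (mu _)) -integral_cst//.
apply: (@ge0_integral_subset_le _ _ mu (fun=> 1) (fun z => expR (ga * eucl_norm z `^ al))) => //.
- exact: measurable_expR_norm.
move=> z /= /negP; rewrite -ltNge => uz.
rewrite -expRD -[leLHS]expR0 ler_expR addrC subr_ge0 ler_wpM2l//.
have -> : eucl_norm z `^ al = eucl_norm z `^ p `^ (al / p).
  by rewrite -powRrM mulrCA divff ?mulr1// gt_eqF.
by rewrite ge0_ler_powR ?nnegrE ?powR_ge0 ?divr_ge0 ?(ltW p0) ?(ltW al0) ?(ltW uz).
Qed.

Lemma deviation_bound_subexponential (p al ga E eps : R) : (0 < d)%N -> 0 < p ->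
  0 < al < p -> 0 < ga -> 0 < eps < al -> exists C c : R, [/\ 0 < C, 0 < c &
    forall mu : probability T R, exp_moment al ga mu = E%:E ->
      deviation_bound p mu (bound_a d p C c) (bound_b2 p al eps C c)].
Proof.
move=> d0 p0 /andP[al0 alp] ga0 /andP[eps0 epsal].
have [K K0 HK] := @transport_deviation R d p d0 p0.
have g2 : 0 < ga / 2 by rewrite divr_gt0.
have p20 : 0 <= 2 * p by rewrite mulr_ge0// ltW.
have p21 : 0 <= 2 * p + 1 by rewrite addr_ge0.
pose rho := al / p; have rho0 : 0 < rho by rewrite divr_gt0.
pose sig := (al - eps) / p; have sig0 : 0 < sig by rewrite divr_gt0// subr_gt0.
have rho1 : rho <= 1 by rewrite ler_pdivrMr// mul1r ltW.
have sigrho : sig <= rho by rewrite ler_pM2r ?invr_gt0// gerBl ltW.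
have [C2 C20 HC2] := powR_le_expR p20 g2 al0.
have [C3 C30 HC3] := powR_le_expR p21 ga0 al0.
have [C8 C80 HC8] := powR_le_expR (ler0n R 2) g2 rho0.
pose E' := Num.max E 1.
have E'1 : 1 <= E' by rewrite le_max lexx orbT.
have E'0 : 0 < E' by exact: lt_le_trans E'1.
have [C4 C40 rle] := @rate_le_sqr R d p p0.
pose V := C2 * E'; have V0 : 0 < V by rewrite mulr_gt0.
have pq : 2 * p < 2 * p + 1 by rewrite ltrDl.
have M0 : 0 <= C3 * E' by rewrite mulr_ge0// ltW.
have [C [c [x0 [[C0 c0 _ _] H]]]] := HK (2 * p + 1) (C3 * E') 0 V pq M0 V0.
pose g := ga / 2 / (8 * K); have g0 : 0 < g by rewrite divr_gt0// mulr_gt0.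
pose c' := Num.min (Num.min c 1) (Num.min g (ga / 2)).
have c'0 : 0 < c' by rewrite !lt_min c0 g0 g2 ltr01.
have [c'1 c'2 c'3 c'4] : [/\ c' <= c, c' <= 1, c' <= g & c' <= ga / 2].
  by split; rewrite /c' !ge_min lexx ?orbT.
have C8E : 0 < C8 * E' by rewrite mulr_gt0.
(* The summand exp C4 makes the bound at least 1 where N x^2 < 1. *)
pose C' := expR C4 + (C + (1 + C8 * E')).
have C'0 : 0 < C' by rewrite !addr_gt0// expR_gt0.
exists C', c'; split => //.
move=> mu HE disp Omega P X iidX N x N0 xgt.
have HE' : (exp_moment al ga mu <= E'%:E)%E by rewrite HE lee_fin le_max lexx.
have Hmu : (moment (2 * p + 1) mu <= (C3 * E')%:E)%E.
  by apply: exp_moment_le_moment HE' => //; exact: ltW.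
have NR : 0 < N%:R :> R by rewrite ltr0n.
have NR1 : 1 <= N%:R :> R by rewrite ler1n.
have [_ H2] := H mu Hmu _ _ _ _ iidX N x N0 xgt.
pose u := N%:R * x; have u0 : 0 < u by rewrite mulr_gt0.
pose A := [set z : T | eucl_norm z `^ p <= u].
have mA : measurable A by exact: measurable_norm_powR_le.
(* On [A] this gives [lam * |z|^p <= ga / 2 * |z|^al], since [|z|^p <= u]. *)
pose lam := ga / 2 * u `^ (rho - 1).
have lam0 : 0 <= lam by rewrite mulr_ge0 ?powR_ge0// ltW.
have HV : (\int[mu]_(z in A)
    (eucl_norm z `^ p ^+ 2 * expR (lam * eucl_norm z `^ p))%:E <= V%:E)%E.
  apply: (@ge0_integral_subset_le _ _ mu
    (fun z => eucl_norm z `^ p ^+ 2 * expR (lam * eucl_norm z `^ p))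
    (fun z => expR (ga * eucl_norm z `^ al))) => //.
  - exact: measurable_sqr_expR_norm.
  - exact: measurable_expR_norm.
  - by move=> z; rewrite mulr_ge0 ?sqr_ge0 ?expR_ge0.
  - by rewrite ltW.
  move=> z; rewrite /A /=; set t := eucl_norm z => tu; have t0 : 0 <= t by exact: eucl_norm_ge0.
  have -> : t `^ p ^+ 2 = t `^ (2 * p) by rewrite -powR_mulrn ?powR_ge0// -powRrM mulrC.
  have tE : t `^ al = t `^ p `^ rho.
    by rewrite -powRrM mulrCA divff ?mulr1// gt_eqF.
  have ltal : lam * t `^ p <= ga / 2 * t `^ al.
    rewrite /lam -mulrA ler_pM2l// tE.
    have [->|tp0] := eqVneq (t `^ p) 0; first by rewrite mulr0 powR_ge0.
    have {}tp0 : 0 < t `^ p by rewrite lt_neqAle eq_sym tp0 powR_ge0.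
    have -> : t `^ p `^ rho = t `^ p `^ (rho - 1) * t `^ p.
      rewrite -[X in _ = _ * X](@powRr1 _ (t `^ p)) ?(ltW tp0)// -powRD ?subrK//.
      by apply/implyP => _; rewrite gt_eqF.
    rewrite ler_pM2r// -opprB !powRN lef_pV2 ?posrE ?(powR_gt0 _ tp0) ?(powR_gt0 _ u0)//.
    by rewrite ge0_ler_powR ?nnegrE ?subr_ge0 ?(ltW tp0) ?(ltW u0).
  apply: (@le_trans _ _ (C2 * expR (ga / 2 * t `^ al) * expR (ga / 2 * t `^ al))).
    apply: ler_pM; rewrite ?powR_ge0 ?expR_ge0//; first exact: HC2.
    by rewrite ler_expR.
  rewrite le_eqVlt -!mulrA -!expRD; apply/orP; left; apply/eqP; congr (_ * expR _).
  by field.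
have lamE : N%:R * x * lam / (8 * K) = g * u `^ rho.
  have -> : u `^ rho = u `^ (rho - 1) * u.
    rewrite -[X in _ = _ * X](@powRr1 _ u) ?(ltW u0)// -powRD ?subrK//.
    by apply/implyP => _; rewrite gt_eqF.
  by rewrite /lam /g -/u; ring.
have H3 := H2 A lam mA lam0 HV; rewrite {}lamE in H3.
have ur0 : 0 <= u `^ rho by exact: powR_ge0.
have us0 : 0 <= u `^ sig by exact: powR_ge0.
have H4 : (P [set w | x%:E <= transport_cost p (empirical N (fun k => X k w)) mu] <=
   (C * expR (- (c * (N%:R * if x <= 1 then rate d p x else x))) + expR (- (g * u `^ rho)) +
    N%:R * (expR (- (ga * u `^ rho)) * E'))%:E)%E.
  apply: (le_trans H3); rewrite [leRHS]EFinD; apply: leeD => //.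
  rewrite [leRHS]EFinM; apply: lee_wpmul2l; first by rewrite lee_fin ltW.
  exact: (measure_norm_powR_gt_expR p0 al0 (ltW ga0) (ltW u0) HE').
(* The factor N of the union bound over the sample is absorbed by half of the exponent once N <=
   u^2, that is N x^2 >= 1. *)
have H5 : N%:R <= u ^+ 2 -> N%:R * (expR (- (ga * u `^ rho)) * E') <=
    C8 * E' * expR (- (ga / 2 * u `^ rho)).
  move=> Nu; have : N%:R <= C8 * expR (ga / 2 * u `^ rho).
    by apply: (le_trans Nu); rewrite -powR_mulrn ?(ltW u0)//; apply: HC8; exact: ltW.
  move=> /(ler_wpM2r (ltW E'0)) /(ler_wpM2r (expR_ge0 (- (ga * u `^ rho)))).
  have -> : C8 * expR (ga / 2 * u `^ rho) * E' * expR (- (ga * u `^ rho)) =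
     C8 * E' * (expR (ga / 2 * u `^ rho) * expR (- (ga * u `^ rho))) by ring.
  rewrite -expRD (_ : ga / 2 * u `^ rho + _ = - (ga / 2 * u `^ rho)); last by field.
  by apply: le_trans; rewrite le_eqVlt; apply/orP; left; apply/eqP; ring.
have C'1 : expR C4 <= C' by rewrite lerDl !addr_ge0// ltW.
have C'2 : C <= C' by rewrite /C' addrCA lerDl !addr_ge0 ?expR_ge0// ltW.
have C'3 : 1 + C8 * E' <= C' by rewrite /C' addrA lerDr addr_ge0 ?expR_ge0// ltW.
have C'4 : C + (1 + C8 * E') <= C' by rewrite lerDr expR_ge0.
have [x1|x1] := leP x 1.
  rewrite bound_aE /bound_b2 x1 ltNge x1 /= !mulr1 mulr0 addr0 !mulNr -/u -/sig.
  rewrite x1 in H4.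
  have rx0 : 0 <= rate d p x by rewrite ltW// rate_gt0.
  have rx : rate d p x <= C4 * x ^+ 2 by rewrite rle// xgt.
  (* If [N x^2 < 1] then [N * rate d p x <= C4] and the bound exceeds [1]. *)
  have [Nx|Nx] := ltP (N%:R * x ^+ 2) 1.
    apply: (@le_trans _ _ 1%E).
      by apply: probability_le1; exact: measurable_transport_event.
    rewrite lee_fin; apply: (@le_trans _ _ (C' * expR (- (c' * (N%:R * rate d p x))))); last first.
      by rewrite lerDl mulr_ge0 ?expR_ge0// ltW.
    apply: (@le_trans _ _ (expR C4 * expR (- (c' * (N%:R * rate d p x))))); last first.
      by rewrite ler_wpM2r ?expR_ge0.
    rewrite -expRD -[leLHS]expR0 ler_expR subr_ge0.
    have S : N%:R * rate d p x <= C4.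
      apply: (@le_trans _ _ (N%:R * (C4 * x ^+ 2))); first by rewrite ler_pM2l.
      by rewrite mulrCA ler_piMr// ltW.
    apply: (@le_trans _ _ (1 * (N%:R * rate d p x))); last by rewrite mul1r.
    by rewrite ler_wpM2r// mulr_ge0// ltW.
  have u1 : 1 <= u by apply: (le_trans Nx); rewrite ler_pM2l// expr2 ler_piMl// ltW.
  have Nu : N%:R <= u ^+ 2.
    by rewrite /u exprMn expr2 -mulrA ler_peMr// ltW.
  have usr : u `^ sig <= u `^ rho by rewrite ler_powR.
  apply: (le_trans H4); rewrite lee_fin -addrA; apply: lerD.
    apply: ler_pM; rewrite ?(ltW C0) ?expR_ge0//.
    by apply: ler_expRN; rewrite ler_wpM2r// mulr_ge0// ltW.
  apply: (@le_trans _ _ ((1 + C8 * E') * expR (- (c' * u `^ sig)))); last first.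
    by rewrite ler_wpM2r ?expR_ge0.
  rewrite mulrDl mul1r; apply: lerD.
    by apply: ler_expRN; apply: ler_pM => //; exact: ltW.
  apply: (le_trans (H5 Nu)); rewrite ler_pM2l//; apply: ler_expRN.
  by apply: ler_pM => //; exact: ltW.
rewrite /= mulr0 add0r /bound_b2 (lt_geF x1) x1 /= mulr0 add0r mulr1 !mulNr -/u -/rho.
rewrite (lt_geF x1) -/u in H4.
have Nu1 : N%:R <= u by rewrite ler_peMr// ltW.
have u1 : 1 <= u by exact: le_trans Nu1.
have Nu : N%:R <= u ^+ 2 by apply: (le_trans Nu1); rewrite expr2 ler_peMl// ltW.
have uru : u `^ rho <= u by rewrite -[leRHS]powRr1 ?(ltW u0)// ler_powR.
apply: (le_trans H4); rewrite lee_fin -addrA.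
apply: (@le_trans _ _ ((C + (1 + C8 * E')) * expR (- (c' * u `^ rho)))); last first.
  by rewrite ler_wpM2r ?expR_ge0.
rewrite !mulrDl mul1r; apply: lerD.
  by rewrite ler_pM2l//; apply: ler_expRN; apply: ler_pM => //; exact: ltW.
apply: lerD; first by apply: ler_expRN; rewrite ler_wpM2r.
apply: (le_trans (H5 Nu)); rewrite ler_pM2l//; apply: ler_expRN.
by rewrite ler_wpM2r.
Qed.

End subexponential_case.

(** * Case (3): polynomial moment *)

Section polynomial_case.
Context (R : realType) (d : nat).
Local Notation T := (d.-tuple R).

(** On [A], where |z|^p <= tau = u^(1 - eta), the parameter 1 / tau keeps the exponential weight
    below exp 1, so the moment of order 2p controls [V]. The Bernstein exponent is then of order
    u^eta, which beats every power of u. With eta = eps / q, the mass off [A] is at most M'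
    tau^(-q/p) = M' u^(-(q - eps)/p). *)
Lemma deviation_bound_polynomial (p q M eps : R) : (0 < d)%N -> 0 < p -> 2 * p < q ->
  0 < eps < q -> exists C c : R, [/\ 0 < C, 0 < c &
    forall mu : probability T R, moment q mu = M%:E ->
      deviation_bound p mu (bound_a d p C c) (bound_b3 p q eps C)].
Proof.
move=> d0 p0 pq /andP[eps0 epsq].
have [K K0 HK] := @transport_deviation R d p d0 p0.
have q0 : 0 < q by apply: lt_trans pq; rewrite mulr_gt0.
pose eta := eps / q; have eta0 : 0 < eta by rewrite divr_gt0.
pose s := (q - eps) / p; have s0 : 0 < s by rewrite divr_gt0// subr_gt0.
pose M' := Num.max M 0.
have M'0 : 0 <= M' by rewrite le_max lexx orbT.
pose V : R := expR 1 * (1 + M').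
have V0 : 0 < V by rewrite mulr_gt0 ?expR_gt0// ltr_pwDl.
have [C [c [x0 [[C0 c0 _ _] H]]]] := HK q M' 0 V pq M'0 V0.
have K8 : 0 < (8 * K)^-1 by rewrite invr_gt0 mulr_gt0.
have [C9 C90 HC9] := powR_le_expR (ltW s0) K8 eta0.
(* Turns exp(-c u), the term of the cells when x > 1, into a multiple of u^(-s). *)
have [C10 C100 HC10] := powR_le_expR (ltW s0) c0 (@ltr01 R).
have CC10 : 0 < C * C10 by rewrite mulr_gt0.
pose C' := C + (C * C10 + (C9 + M')).
have C'0 : 0 < C' by rewrite ltr_pwDl// !addr_ge0// ltW.
have C'1 : C <= C' by rewrite lerDl !addr_ge0// ltW.
have C'2 : C * C10 + (C9 + M') <= C' by rewrite lerDr ltW.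
have C'3 : C9 + M' <= C' by rewrite /C' addrA lerDr addr_ge0// ltW.
exists C', c; split => //.
move=> mu HE disp Omega P X iidX N x N0 xgt.
have Hmu : (moment q mu <= M'%:E)%E by rewrite HE lee_fin le_max lexx.
have NR : 0 < N%:R :> R by rewrite ltr0n.
have NR1 : 1 <= N%:R :> R by rewrite ler1n.
have [_ H2] := H mu Hmu _ _ _ _ iidX N x N0 xgt.
pose u := N%:R * x; have u0 : 0 < u by rewrite mulr_gt0.
pose tau := u `^ (1 - eta); have tau0 : 0 < tau by rewrite powR_gt0.
pose A := [set z : T | eucl_norm z `^ p <= tau].
have mA : measurable A by exact: measurable_norm_powR_le.
have lam0 : 0 <= tau^-1 by rewrite invr_ge0 ltW.
have HV : (\int[mu]_(z in A)
    (eucl_norm z `^ p ^+ 2 * expR (tau^-1 * eucl_norm z `^ p))%:E <= V%:E)%E.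
  apply: (@ge0_integral_subset_le _ _ mu
    (fun z => eucl_norm z `^ p ^+ 2 * expR (tau^-1 * eucl_norm z `^ p))
    (fun z => eucl_norm z `^ (2 * p))) => //.
  - exact: measurable_sqr_expR_norm.
  - exact: (measurableT_comp (measurable_powR (2 * p)) (@measurable_eucl_norm R d)).
  - by move=> z; rewrite mulr_ge0 ?sqr_ge0 ?expR_ge0.
  - by move=> z; rewrite powR_ge0.
  - move=> z; rewrite /A /=; set t := eucl_norm z => tu.
    have -> : t `^ p ^+ 2 = t `^ (2 * p) by rewrite -powR_mulrn ?powR_ge0// -powRrM mulrC.
    rewrite mulrC ler_wpM2r ?powR_ge0// ler_expR.
    by rewrite mulrC ler_pdivrMr// mul1r.
  apply: (@integral_norm_le R d mu (2 * p) q M') => //.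
  by rewrite mulr_ge0 ?(ltW p0)//= ltW.
have taue : u = tau * u `^ eta.
  rewrite /tau -powRD; last by apply/implyP => _; rewrite gt_eqF.
  by rewrite subrK powRr1 ?ltW.
have lamE : N%:R * x * tau^-1 / (8 * K) = (8 * K)^-1 * u `^ eta.
  rewrite -/u [X in X * _ / _]taue; field; rewrite !gt_eqF//.
have H3 := H2 A tau^-1 mA lam0 HV; rewrite {}lamE in H3.
have us0 : 0 < u `^ s by exact: powR_gt0.
have b3E : u `^ (- (q - eps) / p) = (u `^ s)^-1 by rewrite mulNr -powRN.
have muA : (mu (~` A) <= (M' / u `^ s)%:E)%E.
  have tp0 : 0 < tau `^ p^-1 by rewrite powR_gt0.
  have := measure_norm_gt_le (ltW q0) tp0 Hmu.
  have -> : (tau `^ p^-1) `^ q = u `^ s.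
    rewrite /tau -!powRrM; congr (_ `^ _); rewrite /s /eta; field.
    by rewrite !gt_eqF.
  apply: le_trans; apply: le_measure; rewrite ?inE.
  - exact: measurableC.
  - exact: measurable_norm_gt.
  move=> z; rewrite /A /= => /negP; rewrite -ltNge => tz.
  have -> : eucl_norm z = (eucl_norm z `^ p) `^ p^-1.
    by rewrite -powRrM divff ?gt_eqF// powRr1 ?eucl_norm_ge0.
  by rewrite gt0_ltr_powR ?invr_gt0 ?nnegrE ?powR_ge0 ?(ltW tau0).
have H4 : (P [set w | x%:E <= transport_cost p (empirical N (fun k => X k w)) mu] <=
   (C * expR (- (c * (N%:R * if x <= 1 then rate d p x else x))) +
    (C9 + M') * (N%:R / u `^ s))%:E)%E.
  apply: (le_trans H3); apply: (@le_trans _ _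
    ((C * expR (- (c * (N%:R * if x <= 1 then rate d p x else x))) +
      expR (- ((8 * K)^-1 * u `^ eta)))%:E + N%:R%:E * (M' / u `^ s)%:E)%E).
    by apply: leeD => //; apply: lee_wpmul2l; rewrite ?lee_fin// ltW.
  rewrite -EFinM -EFinD lee_fin -addrA lerD2l [leRHS]mulrDl; apply: lerD.
    rewrite mulrA ler_pdivlMr//.
    apply: (@le_trans _ _ (C9 * 1)); last by rewrite ler_pM2l.
    rewrite mulr1 expRN mulrC ler_pdivrMr ?expR_gt0//.
    by apply: HC9; exact: ltW.
  by rewrite le_eqVlt; apply/orP; left; apply/eqP; ring.
rewrite /bound_b3 -/u b3E.
have Nus : 0 <= N%:R / u `^ s by rewrite divr_ge0// ltW.
have [x1|x1] := leP x 1.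
  rewrite x1 in H4; apply: (le_trans H4); rewrite lee_fin mulr1 bound_aE; apply: lerD.
    by rewrite ler_wpM2r ?expR_ge0.
  by rewrite ler_wpM2r.
rewrite (lt_geF x1) -/u in H4; apply: (le_trans H4); rewrite lee_fin mulr0 add0r.
apply: (@le_trans _ _ ((C * C10 + (C9 + M')) * (N%:R / u `^ s))); last first.
  by rewrite ler_wpM2r.
rewrite [leRHS]mulrDl lerD2r -[leRHS]mulrA ler_pM2l// [leRHS]mulrA ler_pdivlMr//.
apply: (@le_trans _ _ (C10 * 1)); last by rewrite ler_pM2l.
rewrite mulr1 expRN mulrC ler_pdivrMr ?expR_gt0//.
by have := HC10 u (ltW u0); rewrite powRr1 ?(ltW u0).
Qed.

End polynomial_case.

Theorem theorem2 (R : realType) (d : nat) (p : R) (hd : (1 <= d)%N) (hp : 0 < p) :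
  (* (1) *)
  (forall alpha gamma E : R, p < alpha -> 0 < gamma ->
   exists C c : R, [/\ 0 < C, 0 < c &
     forall mu : probability (d.-tuple R) R,
       exp_moment alpha gamma mu = E%:E ->
       deviation_bound p mu (bound_a d p C c) (bound_b1 p alpha C c)]) /\
  (* (2) *)
  (forall alpha gamma E eps : R, 0 < alpha < p -> 0 < gamma ->
   0 < eps < alpha ->
   exists C c : R, [/\ 0 < C, 0 < c &
     forall mu : probability (d.-tuple R) R,
       exp_moment alpha gamma mu = E%:E ->
       deviation_bound p mu (bound_a d p C c) (bound_b2 p alpha eps C c)]) /\
  (* (3) *)
  (forall q M eps : R, 2 * p < q -> 0 < eps < q ->
   exists C c : R, [/\ 0 < C, 0 < c &
     forall mu : probability (d.-tuple R) R,
       moment q mu = M%:E ->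
       deviation_bound p mu (bound_a d p C c) (bound_b3 p q eps C)]).
Proof.
split; [|split].
- by move=> al ga E pal ga0; exact: deviation_bound_superexponential.
- by move=> al ga E eps alp ga0 epsal; exact: deviation_bound_subexponential.
- by move=> q M eps pq epsq; exact: deviation_bound_polynomial.
Qed.
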